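(* Let $R$ be a ring and let $M$ be a $1$-nilpotent $R$-bimodule, i.e. $M\otimes_R M=0$. (1) If $\mathrm{Tor}^R_{j}(M,M\otimes_R F)=0$ for all $j\ge1$ and all flat $R$-modules $F$, $\mathrm{fd}_R M<\infty$ and $\mathrm{fd}_{R^{\mathrm{op}}}M<\infty$, then $\mathsf{DP}(R\ltimes M)=\Phi(\mathsf{DP}(R))$. (2) Let $R\ltimes M$ be a right coherent ring and let $M$ be finitely generated as a right $R$-module. If $\mathrm{Ext}^{j}_{R^{\mathrm{op}}}(M,\mathrm{Hom}_{R^{\mathrm{op}}}(M,E))=0$ for all $j\ge1$ and all $FP$-injective $R^{\mathrm{op}}$-modules $E$, $\mathrm{fd}_R M<\infty$ and $\mathrm{pd}_{R^{\mathrm{op}}}M<\infty$, then $\mathsf{DI}((R\ltimes M)^{\mathrm{op}})=\Psi(\mathsf{DI}(R^{\mathrm{op}}))$.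
   Context: Rings are nonzero, associative and unital. ''$R$-module'' means left $R$-module; right $R$-modules are viewed as $R^{\mathrm{op}}$-modules. $\mathrm{fd}$, $\mathrm{pd}$ denote flat and projective dimension. The trivial extension $R\ltimes M$ is $R\oplus M$ with componentwise addition and multiplication $(r_1,m_1)(r_2,m_2)=(r_1r_2,r_1m_2+m_1r_2)$; when $M\otimes_R M=0$ it is the tensor ring $T_R(M)=R\oplus M$. An $R\ltimes M$-module is then identified with a pair $(X,u)$, $X$ an $R$-module and $u:M\otimes_R X\to X$ an $R$-homomorphism. An $(R\ltimes M)^{\mathrm{op}}$-module is identified with a pair $[Y,v]$, $Y$ an $R^{\mathrm{op}}$-module and $v:Y\to\mathrm{Hom}_{R^{\mathrm{op}}}(M,Y)$ an $R^{\mathrm{op}}$-homomorphism. For a class $\mathsf X$ of $R$-modules, $\Phi(\mathsf X)$ is the class of $R\ltimes M$-modules $(X,u)$ with $u$ a monomorphism and $\mathrm{coker}(u)\in\mathsf X$. For a class $\mathsf Y$ of $R^{\mathrm{op}}$-modules, $\Psi(\mathsf Y)$ is the class of $(R\ltimes M)^{\mathrm{op}}$-modules $[Y,v]$ with $v$ an epimorphism and $\ker(v)\in\mathsf Y$. For a ring $S$: $\mathsf{DP}(S)$ is the class of Ding projective $S$-modules, i.e. modules isomorphic to $\mathrm{Im}(P^{-1}\to P^0)$ for an exact complex $P^\bullet$ of projective $S$-modules with $\mathrm{Hom}_S(P^\bullet,F)$ exact for every flat $S$-module $F$. An $S^{\mathrm{op}}$-module $B$ is $FP$-injective if $\mathrm{Ext}^1_{S^{\mathrm{op}}}(L,B)=0$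 for every finitely presented $S^{\mathrm{op}}$-module $L$. $\mathsf{DI}(S^{\mathrm{op}})$ is the class of Ding injective $S^{\mathrm{op}}$-modules, i.e. modules isomorphic to $\ker(I^0\to I^1)$ for an exact complex $I^\bullet$ of injective $S^{\mathrm{op}}$-modules with $\mathrm{Hom}_{S^{\mathrm{op}}}(E,I^\bullet)$ exact for every $FP$-injective $S^{\mathrm{op}}$-module $E$. *)

(* Defs.v *)
From HB Require Import structures.
From mathcomp Require Import all_boot all_order all_algebra.
From mathcomp Require Import generic_quotient ring_quotient.
From mathcomp Require Import boolp functions.
From mathcomp Require Import freeg.

Set Implicit Arguments.
Unset Strict Implicit.
Unset Printing Implicit Defensive.

Import GRing.Theory.
Local Open Scope ring_scope.
Local Open Scope quotient_scope.

(* Left R-modules are [lmodType R]; right R-modules (= R^op-modules) are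
   [lmodType R^c], where [R^c] is the converse ring, so that the right action
   x.r is written [(r : R^c) *: x]. *)

Section SubQuot.
Variables (R : nzRingType) (V : lmodType R) (I : submodClosed V).

Definition submod : Type := {x : V | x \in I}.
HB.instance Definition _ := SubChoice.on submod.
HB.instance Definition _ := [SubChoice_isSubLmodule of submod by <:].

Definition sub_pred : {pred V} := I.
HB.instance Definition _ := GRing.isZmodClosed.Build V sub_pred
  (GRing.submod_closedB (GRing.submodClosedP I)).

Definition quotmod : Type := Quotient.quot sub_pred.
HB.instance Definition _ := GRing.Zmodule.on quotmod.

Definition quotmod_pi (x : V) : quotmod := \pi_(Quotient.quot sub_pred) x.

Fact quotmod_piP x y : quotmod_pi x = quotmod_pi y <-> x - y \in I.
Proof.
have -> : (x - y \in I) = (x - y \in sub_pred) by [].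
by rewrite Quotient.idealrBE; split=> /eqP.
Qed.

Fact quotmod_pi_surj (q : quotmod) : exists x, quotmod_pi x = q.
Proof. by exists (repr (q : Quotient.quot sub_pred)); rewrite /quotmod_pi reprK. Qed.

Fact quotmod_piD : {morph quotmod_pi : x y / x + y}.
Proof. by move=> x y; rewrite /quotmod_pi raddfD. Qed.

Definition quotmod_scale (a : R) (q : quotmod) : quotmod :=
  quotmod_pi (a *: repr (q : Quotient.quot sub_pred)).

Fact quotmod_piZ a x : quotmod_scale a (quotmod_pi x) = quotmod_pi (a *: x).
Proof.
apply/quotmod_piP; rewrite -scalerBr rpredZ //.
by apply/quotmod_piP; rewrite /quotmod_pi reprK.
Qed.

Fact quotmod_scaleA a b q :
  quotmod_scale a (quotmod_scale b q) = quotmod_scale (a * b) q.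
Proof.
by have [x <-] := quotmod_pi_surj q; rewrite !quotmod_piZ scalerA.
Qed.
Fact quotmod_scale1 : left_id 1 quotmod_scale.
Proof.
by move=> q; have [x <-] := quotmod_pi_surj q; rewrite quotmod_piZ scale1r.
Qed.
Fact quotmod_scaleDr : right_distributive quotmod_scale +%R.
Proof.
move=> a p q; have [x <-] := quotmod_pi_surj p.
have [y <-] := quotmod_pi_surj q.
by rewrite -quotmod_piD !quotmod_piZ scalerDr quotmod_piD.
Qed.
Fact quotmod_scaleDl q : {morph quotmod_scale^~ q : a b / a + b}.
Proof.
move=> a b; have [x <-] := quotmod_pi_surj q.
by rewrite !quotmod_piZ scalerDl quotmod_piD.
Qed.
HB.instance Definition _ := GRing.Zmodule_isLmodule.Build R quotmod
  quotmod_scaleA quotmod_scale1 quotmod_scaleDr quotmod_scaleDl.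
End SubQuot.

Section KerCoker.
Variables (R : nzRingType) (U V : lmodType R) (f : {linear U -> V}).

Definition ker_pred : {pred U} := fun x => f x == 0.

Fact ker_pred_closed : submod_closed ker_pred.
Proof.
split=> [|a x y]; rewrite !unfold_in ?linear0 // => /eqP fx /eqP fy.
by rewrite linearP fx fy scaler0 addr0.
Qed.
HB.instance Definition _ := GRing.isSubmodClosed.Build R U ker_pred
  ker_pred_closed.

Definition im_pred : {pred V} := fun y => `[< exists x, f x = y >].

Fact im_pred_closed : submod_closed im_pred.
Proof.
split=> [|a x y]; rewrite !unfold_in.
  by apply/asboolP; exists 0; rewrite linear0.
move=> /asboolP[x' <-] /asboolP[y' <-]; apply/asboolP.
by exists (a *: x' + y'); rewrite linearP.
Qed.
HB.instance Definition _ := GRing.isSubmodClosed.Build R V im_pred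
  im_pred_closed.

Definition kermod : lmodType R := submod ker_pred.
Definition immod : lmodType R := submod im_pred.
Definition cokermod : lmodType R := quotmod im_pred.
End KerCoker.

(* The tensor product N (x)_R X of a right and a left R-module: the free abelian
    group on N * X modulo the subgroup [tensor_rel] generated by the usual
    relations. *)

Section Tensor.
Variables (R : nzRingType) (N : lmodType R^c) (X : lmodType R).

Inductive tensor_rel : {freeg (N * X)} -> Prop :=
| tensor_rel0 : tensor_rel 0
| tensor_relB a b : tensor_rel a -> tensor_rel b -> tensor_rel (a - b)
| tensor_relDl n n' x :
    tensor_rel (<< (n + n', x) >> - << (n, x) >> - << (n', x) >>)
| tensor_relDr n x x' :
    tensor_rel (<< (n, x + x') >> - << (n, x) >> - << (n, x') >>)
| tensor_relZ (r : R) n x :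
    tensor_rel (<< ((r : R^c) *: n, x) >> - << (n, r *: x) >>).

Definition tensor_pred : {pred {freeg (N * X)}} := fun a => `[< tensor_rel a >].

Fact tensor_pred_closed : zmod_closed tensor_pred.
Proof.
split=> [|a b]; rewrite !unfold_in; first exact/asboolP/tensor_rel0.
by move=> /asboolP Ra /asboolP Rb; exact/asboolP/tensor_relB.
Qed.
HB.instance Definition _ := GRing.isZmodClosed.Build _ tensor_pred
  tensor_pred_closed.

Definition tensor : Type := Quotient.quot tensor_pred.
HB.instance Definition _ := GRing.Zmodule.on tensor.

Definition tensor_pi (D : {freeg (N * X)}) : tensor :=
  \pi_(Quotient.quot tensor_pred) D.

Fact tensor_pi_is_zmod_morphism : zmod_morphism tensor_pi.
Proof. by move=> a b; rewrite /tensor_pi raddfB. Qed.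
HB.instance Definition _ := GRing.isZmodMorphism.Build _ _ tensor_pi
  tensor_pi_is_zmod_morphism.

Fact tensor_piP a b : tensor_pi a = tensor_pi b <-> tensor_rel (a - b).
Proof.
have -> : tensor_rel (a - b) <-> a - b \in tensor_pred.
  by split=> /asboolP.
by rewrite Quotient.idealrBE; split=> /eqP.
Qed.

Definition tens (n : N) (x : X) : tensor := tensor_pi << (n, x) >>.

Fact tensor_ind (P : tensor -> Prop) :
    P 0 -> (forall s t, P s -> P t -> P (s - t)) ->
    (forall n x, P (tens n x)) -> forall t, P t.
Proof.
move=> P0 PB Pt t; have PN s : P s -> P (- s).
  by move=> /(PB 0 s P0); rewrite sub0r.
have PD s s' : P s -> P s' -> P (s + s').
  by move=> Ps /PN Ps'; rewrite -[s']opprK; exact: PB.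
have -> : t = tensor_pi (repr (t : Quotient.quot tensor_pred)).
  by rewrite /tensor_pi reprK.
move: (repr _) => D; rewrite -[D]freeg_sumE raddf_sum /=.
elim/big_ind: _ => // -[n x] _; set k := coeff _ _.
have -> : << k *g (n, x) >> = << (n, x) >> *~ k :> {freeg (N * X)}.
  by rewrite freeg_mulz intz.
rewrite raddfMz /=; have Pn m : P (tens n x *+ m).
  by elim: m => [|m IHm]; rewrite ?mulr0n // mulrS; exact: PD.
by case: k => m; [exact: Pn | rewrite NegzE mulrNz; exact/PN/Pn].
Qed.

Record balanced (A : zmodType) (b : N -> X -> A) : Prop := Balanced {
  balancedDl : forall x, {morph b^~ x : n n' / n + n'};
  balancedDr : forall n, {morph b n : x x' / x + x'};
  balancedZ : forall (r : R) n x, b ((r : R^c) *: n) x = b n (r *: x) }.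

Fact tens_balanced : balanced tens.
Proof.
have piE2 (a b c : {freeg (N * X)}) :
    tensor_rel (a - b - c) -> tensor_pi a = tensor_pi b + tensor_pi c.
  by move=> h; rewrite -raddfD; apply/tensor_piP; rewrite opprD addrA.
split=> [x n n'|n x x'|r n x]; rewrite /tens.
- exact/piE2/tensor_relDl.
- exact/piE2/tensor_relDr.
- exact/tensor_piP/tensor_relZ.
Qed.

Section Lift.
Variables (A : zmodType) (b : N -> X -> A).

Definition freeg_lift (D : {freeg (N * X)}) : A :=
  fglift (fun p : N * X => b p.1 p.2 : zmodule A) D.

Fact freeg_lift_is_zmod_morphism : zmod_morphism freeg_lift.
Proof.
have := @lift_is_additive _ _ _ (fun p : N * X => b p.1 p.2 : zmodule A).
exact.
Qed.
HB.instance Definition _ := GRing.isZmodMorphism.Build _ _ freeg_lift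
  freeg_lift_is_zmod_morphism.

Definition tensor_lift (t : tensor) : A :=
  freeg_lift (repr (t : Quotient.quot tensor_pred)).

Hypothesis bP : balanced b.

Fact freeg_liftU n x : freeg_lift << (n, x) >> = b n x.
Proof. by rewrite /freeg_lift liftU scale1r. Qed.

Fact tensor_lift_pi D : tensor_lift (tensor_pi D) = freeg_lift D.
Proof.
apply/eqP; rewrite -subr_eq0 -raddfB; apply/eqP.
have : tensor_rel (repr (tensor_pi D : Quotient.quot tensor_pred) - D).
  by apply/tensor_piP; rewrite /tensor_pi reprK.
elim=> [|u v _ IHu _ IHv|n n' x|n x x'|r n x]; rewrite ?raddf0 ?raddfB //=.
- by rewrite IHu IHv subrr.
- by rewrite !freeg_liftU (balancedDl bP) addrAC addrK subrr.
- by rewrite !freeg_liftU (balancedDr bP) addrAC addrK subrr.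
- by rewrite !freeg_liftU (balancedZ bP) subrr.
Qed.

Fact tensor_lift_is_zmod_morphism : zmod_morphism tensor_lift.
Proof.
have surj t : tensor_pi (repr (t : Quotient.quot tensor_pred)) = t.
  by rewrite /tensor_pi reprK.
move=> s t; rewrite -[s]surj -[t]surj -raddfB.
by rewrite !tensor_lift_pi raddfB.
Qed.

Fact tensor_liftE n x : tensor_lift (tens n x) = b n x.
Proof. by rewrite tensor_lift_pi freeg_liftU. Qed.
End Lift.
End Tensor.

Section TensorMap.
Variables (R : nzRingType) (N N' : lmodType R^c) (X X' : lmodType R).
Variables (g : {linear N -> N'}) (f : {linear X -> X'}).

Fact tensor_map_balanced : balanced (fun n x => tens (g n) (f x)).
Proof.
have [Dl Dr Z] := tens_balanced N' X'.
by split=> [x n n'|n x x'|r n x] /=; rewrite ?linearD ?linearZ /= ?Dl ?Dr ?Z.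
Qed.

Definition tensor_map : tensor N X -> tensor N' X' :=
  tensor_lift (fun n x => tens (g n) (f x)).
HB.instance Definition _ := GRing.isZmodMorphism.Build _ _ tensor_map
  (tensor_lift_is_zmod_morphism tensor_map_balanced).
End TensorMap.

HB.mixin Record Lmodule_isBimodule (R : nzRingType) M of GRing.Lmodule R M := {
  rscale : M -> R -> M;
  rscaleA : forall m a b, rscale (rscale m a) b = rscale m (a * b);
  rscale1 : forall m, rscale m 1 = m;
  rscaleDl : forall a, {morph rscale^~ a : m n / m + n};
  rscaleDr : forall m, {morph rscale m : a b / a + b};
  rscaleAl : forall (a : R) m b, rscale (a *: m) b = a *: rscale m b }.

#[short(type="bimodType")]
HB.structure Definition Bimodule (R : nzRingType) :=
  {M of Lmodule_isBimodule R M & GRing.Lmodule R M}.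

Definition rmod (R : nzRingType) (M : bimodType R) : Type := M.

Section RMod.
Variables (R : nzRingType) (M : bimodType R).
HB.instance Definition _ := GRing.Zmodule.copy (rmod M) M.

Definition rmod_scale (a : R^c) (m : rmod M) : rmod M := rscale (m : M) a.

Fact rmod_scaleA a b m : rmod_scale a (rmod_scale b m) = rmod_scale (a * b) m.
Proof. exact: rscaleA. Qed.
Fact rmod_scale1 : left_id 1 rmod_scale.
Proof. exact: rscale1. Qed.
Fact rmod_scaleDr : right_distributive rmod_scale +%R.
Proof. by move=> a m n; exact: rscaleDl. Qed.
Fact rmod_scaleDl m : {morph rmod_scale^~ m : a b / a + b}.
Proof. by move=> a b; exact: (rscaleDr (m : M) a b). Qed.
HB.instance Definition _ := GRing.Zmodule_isLmodule.Build R^c (rmod M)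
  rmod_scaleA rmod_scale1 rmod_scaleDr rmod_scaleDl.
End RMod.

(* M (x)_R X as a left R-module. *)
Definition btensor (R : nzRingType) (M : bimodType R) (X : lmodType R) : Type :=
  tensor (rmod M) X.

Section BTensor.
Variables (R : nzRingType) (M : bimodType R) (X : lmodType R).
HB.instance Definition _ := GRing.Zmodule.copy (btensor M X) (tensor (rmod M) X).

Definition btensor_scale (a : R) : btensor M X -> btensor M X :=
  tensor_lift (fun (m : rmod M) (x : X) => tens (a *: (m : M) : rmod M) x).

Fact btensor_scale_balanced (a : R) :
  balanced (fun (m : rmod M) (x : X) => tens (a *: (m : M) : rmod M) x).
Proof.
have [Dl Dr Z] := tens_balanced (rmod M) X.
split=> [x m n|m x y|r m x] //=.
- by rewrite (scalerDr a (m : M) n); exact: Dl.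
- exact: Dr.
- rewrite -[RHS]Z; congr tens. exact: esym (rscaleAl a (m : M) r).
Qed.

Fact btensor_scale_additive a : zmod_morphism (btensor_scale a).
Proof. exact: tensor_lift_is_zmod_morphism (btensor_scale_balanced a). Qed.

Fact btensor_scaleE a (m : rmod M) (x : X) :
  btensor_scale a (tens m x) = tens (a *: (m : M) : rmod M) x.
Proof. exact: tensor_liftE (btensor_scale_balanced a) _ _. Qed.

HB.instance Definition _ a := GRing.isZmodMorphism.Build _ _ (btensor_scale a)
  (btensor_scale_additive a).

Fact btensor_scaleA a b t :
  btensor_scale a (btensor_scale b t) = btensor_scale (a * b) t.
Proof.
elim/tensor_ind: t => [|s t IHs IHt|m x]; first by rewrite !raddf0.
  by rewrite !btensor_scale_additive IHs IHt.
by rewrite !btensor_scaleE; congr tens; exact: (scalerA a b (m : M)).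
Qed.
Fact btensor_scale1 : left_id 1 btensor_scale.
Proof.
elim/tensor_ind => [|s t IHs IHt|m x]; first by rewrite raddf0.
  by rewrite btensor_scale_additive IHs IHt.
by rewrite btensor_scaleE; congr tens; exact: (scale1r (m : M)).
Qed.
Fact btensor_scaleDr : right_distributive btensor_scale +%R.
Proof. by move=> a s t; exact: raddfD. Qed.
Fact btensor_scaleDl t : {morph btensor_scale^~ t : a b / a + b}.
Proof.
move=> a b; elim/tensor_ind: t => [|s t IHs IHt|m x].
- by rewrite !raddf0 addr0.
- by rewrite !btensor_scale_additive IHs IHt opprD addrACA.
- rewrite !btensor_scaleE (scalerDl (m : M)).
  exact: (balancedDl (tens_balanced (rmod M) X)).
Qed.
HB.instance Definition _ := GRing.Zmodule_isLmodule.Build R (btensor M X)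
  btensor_scaleA btensor_scale1 btensor_scaleDr btensor_scaleDl.

Fact btensor_ind (P : btensor M X -> Prop) :
    P 0 -> (forall s t, P s -> P t -> P (s - t)) ->
    (forall (m : rmod M) x, P (tens m x)) -> forall t, P t.
Proof. exact: tensor_ind. Qed.
End BTensor.

(* Hom_{R^op}(M, Y) as a right R-module: (h.a)(m) = h(am). *)
Section RHom.
Variables (R : nzRingType) (M : bimodType R) (Y : lmodType R^c).

Definition linear_pred : {pred rmod M -> Y} := fun h => `[< linear h >].

Fact linear_pred_closed : zmod_closed linear_pred.
Proof.
split=> [|h k]; rewrite !unfold_in.
  apply/asboolP => a x y; have E z : (0 : rmod M -> Y) z = 0 by [].
  by rewrite !E scaler0 addr0.
move=> /asboolP hP /asboolP kP; apply/asboolP => a x y.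
have E z : (h - k) z = h z - k z by [].
by rewrite !E hP kP scalerBr opprD addrACA.
Qed.
HB.instance Definition _ := GRing.isZmodClosed.Build _ linear_pred
  linear_pred_closed.

Definition rhom : Type := {h : rmod M -> Y | h \in linear_pred}.
HB.instance Definition _ := SubChoice.on rhom.
HB.instance Definition _ := [SubChoice_isSubZmodule of rhom by <:].

Definition rhom_fun (h : rhom) : rmod M -> Y := val h.

Fact rhom_linear (h : rhom) : linear (rhom_fun h).
Proof. by have /asboolP := valP h. Qed.

Definition to_rhom (h : rmod M -> Y) (hP : linear h) : rhom :=
  exist _ h (asboolT hP : h \in linear_pred).

Fact rhomP (h k : rhom) : rhom_fun h =1 rhom_fun k -> h = k.
Proof. by move=> hk; apply: val_inj; exact/funext. Qed.

Fact rhom_scale_subproof (a : R^c) (h : rhom) :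
  linear (fun m : rmod M => rhom_fun h ((a : R) *: (m : M) : rmod M)).
Proof.
move=> r m n; rewrite -rhom_linear; congr (rhom_fun h).
rewrite (scalerDr (a : R) ((r : R^c) *: m : M) n); congr (_ + _).
exact: esym (rscaleAl (a : R) (m : M) (r : R)).
Qed.

Definition rhom_scale (a : R^c) (h : rhom) : rhom :=
  to_rhom (rhom_scale_subproof a h).

Fact rhom_scaleA a b h : rhom_scale a (rhom_scale b h) = rhom_scale (a * b) h.
Proof.
by apply: rhomP => m; congr (rhom_fun h); exact: (scalerA _ _ (m : M)).
Qed.
Fact rhom_scale1 : left_id 1 rhom_scale.
Proof.
by move=> h; apply: rhomP => m; congr (rhom_fun h); exact: (scale1r (m : M)).
Qed.
Fact rhom_scaleDr : right_distributive rhom_scale +%R.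
Proof. by move=> a h k; apply: rhomP. Qed.
Fact rhom_scaleDl h : {morph rhom_scale^~ h : a b / a + b}.
Proof.
move=> a b; apply: rhomP => m; pose hm := rhom_linear h.
have hD x y : rhom_fun h (x + y) = rhom_fun h x + rhom_fun h y.
  by have := rhom_linear h 1 x y; rewrite !scale1r.
by rewrite -[RHS]hD; congr (rhom_fun h); exact: (scalerDl (m : M)).
Qed.
HB.instance Definition _ := GRing.Zmodule_isLmodule.Build R^c rhom
  rhom_scaleA rhom_scale1 rhom_scaleDr rhom_scaleDl.
End RHom.

Definition trivext (R : nzRingType) (M : bimodType R) : Type := (R * M)%type.

Section TrivExt.
Variables (R : nzRingType) (M : bimodType R).
HB.instance Definition _ := GRing.Zmodule.copy (trivext M) (R * M)%type.

Definition trivext_one : trivext M := (1, 0).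
Definition trivext_mul (x y : trivext M) : trivext M :=
  (x.1 * y.1, x.1 *: y.2 + rscale x.2 y.1).

Let rscale0l (a : R) : rscale (0 : M) a = 0.
Proof. by apply: (addrI (rscale 0 a)); rewrite -rscaleDl !addr0. Qed.
Let rscale0r (m : M) : rscale m 0 = 0.
Proof. by apply: (addrI (rscale m 0)); rewrite -rscaleDr !addr0. Qed.

Fact trivext_mulA : associative trivext_mul.
Proof.
move=> [a m] [b n] [c p]; congr pair; rewrite /= ?mulrA //.
by rewrite scalerDr rscaleDl scalerA rscaleA rscaleAl addrA.
Qed.
Fact trivext_mul1l : left_id trivext_one trivext_mul.
Proof.
by case=> a m; congr pair; rewrite /= ?mul1r // scale1r rscale0l addr0.
Qed.
Fact trivext_mul1r : right_id trivext_one trivext_mul.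
Proof.
by case=> a m; congr pair; rewrite /= ?mulr1 // scaler0 rscale1 add0r.
Qed.
Fact trivext_mulDl : left_distributive trivext_mul +%R.
Proof.
move=> [a m] [b n] [c p]; congr pair; rewrite /= ?mulrDl //.
by rewrite scalerDl rscaleDl addrACA.
Qed.
Fact trivext_mulDr : right_distributive trivext_mul +%R.
Proof.
move=> [a m] [b n] [c p]; congr pair; rewrite /= ?mulrDr //.
by rewrite scalerDr rscaleDr addrACA.
Qed.
Fact trivext_one_neq0 : trivext_one != 0.
Proof. by apply/eqP => -[/eqP]; rewrite oner_eq0. Qed.
HB.instance Definition _ := GRing.Zmodule_isNzRing.Build (trivext M)
  trivext_mulA trivext_mul1l trivext_mul1r trivext_mulDl trivext_mulDr
  trivext_one_neq0.

Definition triv_inl (a : R) : trivext M := (a, 0).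
Definition triv_inr (m : M) : trivext M := (0, m).

Fact triv_inl_is_zmod_morphism : zmod_morphism triv_inl.
Proof. by move=> a b; congr pair; rewrite /= subr0. Qed.
Fact triv_inl_is_monoid_morphism : monoid_morphism triv_inl.
Proof.
by split=> [//|a b]; congr pair; rewrite /= scaler0 rscale0l addr0.
Qed.
HB.instance Definition _ := GRing.isZmodMorphism.Build R (trivext M) triv_inl
  triv_inl_is_zmod_morphism.
HB.instance Definition _ := GRing.isMonoidMorphism.Build R (trivext M) triv_inl
  triv_inl_is_monoid_morphism.

Fact triv_inrD m n : triv_inr (m + n) = triv_inr m + triv_inr n.
Proof. by congr pair; rewrite /= addr0. Qed.
Fact triv_inrZr m a : triv_inr m * triv_inl a = triv_inr (rscale m a).
Proof. by congr pair; rewrite /= ?mul0r // scaler0 add0r. Qed.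
Fact triv_inrZl a m : triv_inl a * triv_inr m = triv_inr (a *: m).
Proof. by congr pair; rewrite /= ?mulr0 // rscale0r addr0. Qed.

Definition triv_inlc (a : R^c) : (trivext M)^c := triv_inl a.

Fact triv_inlc_is_zmod_morphism : zmod_morphism triv_inlc.
Proof. exact: triv_inl_is_zmod_morphism. Qed.
Fact triv_inlc_is_monoid_morphism : monoid_morphism triv_inlc.
Proof. by split=> [//|a b]; exact: (rmorphM triv_inl b a). Qed.
HB.instance Definition _ := GRing.isZmodMorphism.Build R^c (trivext M)^c
  triv_inlc triv_inlc_is_zmod_morphism.
HB.instance Definition _ := GRing.isMonoidMorphism.Build R^c (trivext M)^c
  triv_inlc triv_inlc_is_monoid_morphism.
End TrivExt.

Definition restr (R S : nzRingType) (f : {rmorphism R -> S}) (W : lmodType S) :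
  Type := W.

Section Restr.
Variables (R S : nzRingType) (f : {rmorphism R -> S}) (W : lmodType S).
HB.instance Definition _ := GRing.Zmodule.copy (restr f W) W.

Definition restr_scale (a : R) (w : restr f W) : restr f W := f a *: (w : W).

Fact restr_scaleA a b w :
  restr_scale a (restr_scale b w) = restr_scale (a * b) w.
Proof. by rewrite /restr_scale (scalerA _ _ (w : W)) rmorphM. Qed.
Fact restr_scale1 : left_id 1 restr_scale.
Proof. by move=> w; rewrite /restr_scale rmorph1 (scale1r (w : W)). Qed.
Fact restr_scaleDr : right_distributive restr_scale +%R.
Proof. by move=> a v w; exact: (scalerDr (f a) (v : W) w). Qed.
Fact restr_scaleDl w : {morph restr_scale^~ w : a b / a + b}.
Proof. by move=> a b; rewrite /restr_scale rmorphD (scalerDl (w : W)). Qed.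
HB.instance Definition _ := GRing.Zmodule_isLmodule.Build R (restr f W)
  restr_scaleA restr_scale1 restr_scaleDr restr_scaleDl.
End Restr.

(* A left module W over R |x M corresponds to the pair (X, u) where X is W
   viewed as an R-module and u (m (x) w) = (0, m) w. *)
Section LeftPair.
Variables (R : nzRingType) (M : bimodType R) (W : lmodType (trivext M)).

Definition lbase : lmodType R := restr (@triv_inl R M) W.

Definition laction (m : rmod M) (w : lbase) : lbase := triv_inr (m : M) *: (w : W).

Fact laction_balanced : balanced laction.
Proof.
split=> [w m n|m v w|r m w]; rewrite /laction.
- by rewrite (triv_inrD (m : M)) (scalerDl (w : W)).
- exact: (scalerDr (triv_inr (m : M)) (v : W) w).
- rewrite -[r *: w]/(triv_inl M r *: (w : W)) (scalerA _ _ (w : W)).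
  by rewrite triv_inrZr.
Qed.

Definition lpair_map : btensor M lbase -> lbase := tensor_lift laction.

Fact lpair_map_is_zmod_morphism : zmod_morphism lpair_map.
Proof. exact: tensor_lift_is_zmod_morphism laction_balanced. Qed.
HB.instance Definition _ := GRing.isZmodMorphism.Build _ _ lpair_map
  lpair_map_is_zmod_morphism.

Fact lpair_map_tens m w : lpair_map (tens m w) = laction m w.
Proof. exact: (tensor_liftE laction_balanced). Qed.

Fact lpair_map_is_scalable : scalable lpair_map.
Proof.
move=> a; elim/btensor_ind => [|s t IHs IHt|m w].
- by rewrite scaler0 raddf0 scaler0.
- by rewrite scalerBr !lpair_map_is_zmod_morphism IHs IHt scalerBr.
- have -> : a *: (tens m w : btensor M lbase) = tens (a *: (m : M) : rmod M) w.
    exact: btensor_scaleE.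
  rewrite !lpair_map_tens /laction -triv_inrZl.
  exact/esym/(scalerA _ _ (w : W)).
Qed.
HB.instance Definition _ := GRing.isScalable.Build R _ _ _ lpair_map
  lpair_map_is_scalable.
End LeftPair.

(* A right module W over R |x M corresponds to the pair [Y, v] where Y is W
   viewed as a right R-module and v(y)(m) = y (0, m). *)
Section RightPair.
Variables (R : nzRingType) (M : bimodType R) (W : lmodType (trivext M)^c).

Definition rbase : lmodType R^c := @restr R^c (trivext M)^c (@triv_inlc R M) W.

Definition raction (y : rbase) (m : rmod M) : rbase :=
  (triv_inr (m : M) : (trivext M)^c) *: (y : W).

Fact raction_linear y : linear (raction y).
Proof.
move=> r m n; rewrite /raction (triv_inrD ((r : R^c) *: m : M)).
rewrite (scalerDl (y : W)); congr (_ + _).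
have -> : triv_inr ((r : R^c) *: m : M) = triv_inr (m : M) * triv_inl M r.
  exact/esym/triv_inrZr.
exact/esym/(scalerA (triv_inlc M r) (triv_inr (m : M) : (trivext M)^c) (y : W)).
Qed.

Definition rpair_map (y : rbase) : rhom M rbase := to_rhom (raction_linear y).

Fact rpair_map_is_linear : linear rpair_map.
Proof.
move=> a x y; apply: rhomP => m.
have -> : rhom_fun (a *: rpair_map x + rpair_map y) m =
          raction x ((a : R) *: (m : M) : rmod M) + raction y m by [].
rewrite /= /raction -triv_inrZl.
have -> : a *: x + y = (triv_inlc M a *: (x : W) + y :> W) by [].
rewrite -[LHS]/((triv_inr (m : M) : (trivext M)^c) *: (triv_inlc M a *: (x : W) + (y : W))).
rewrite (scalerDr _ (_ : W)); congr (_ + _).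
exact: (scalerA (triv_inr (m : M) : (trivext M)^c) (triv_inlc M a) (x : W)).
Qed.
HB.instance Definition _ := GRing.isLinear.Build R^c _ _ _ rpair_map
  rpair_map_is_linear.
End RightPair.

(* Exactness of A -> B -> C at B. *)
Definition exact_at (A B : Type) (C : zmodType) (f : A -> B) (g : B -> C) :=
  forall y, g y = 0 <-> exists x, f x = y.

Section Modules.
Variable S : nzRingType.
Implicit Types A B C X : lmodType S.

Definition isomorphic A B := exists f : {linear A -> B}, bijective f.

(* Exactness of Hom(C, X) -> Hom(B, X) -> Hom(A, X) at Hom(B, X). *)
Definition hom_to_exact A B C (f : {linear A -> B}) (g : {linear B -> C}) X :=
  forall h : {linear B -> X},
    (forall a, h (f a) = 0) <-> exists k : {linear C -> X}, forall b, h b = k (g b).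

(* Exactness of Hom(X, A) -> Hom(X, B) -> Hom(X, C) at Hom(X, B). *)
Definition hom_from_exact X A B C (f : {linear A -> B}) (g : {linear B -> C}) :=
  forall h : {linear X -> B},
    (forall x, g (h x) = 0) <-> exists k : {linear X -> A}, forall x, h x = f (k x).

Definition projective X :=
  forall A B (g : {linear A -> B}) (h : {linear X -> B}),
    (forall b, exists a, g a = b) ->
    exists k : {linear X -> A}, forall x, h x = g (k x).

Definition injective_mod X :=
  forall A B (f : {linear A -> B}) (h : {linear A -> X}),
    injective f -> exists k : {linear B -> X}, forall a, h a = k (f a).

Definition flat X :=
  forall (N N' : lmodType S^c) (g : {linear N -> N'}),
    injective g -> injective (tensor_map g (idfun : {linear X -> X})).

Record resolution A := Resolution {
  res_mod :> nat -> lmodType S;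
  res_d : forall n, {linear res_mod n.+1 -> res_mod n};
  res_aug : {linear res_mod 0 -> A};
  res_aug_surj : forall a, exists x, res_aug x = a;
  res_exact0 : exact_at (res_d 0) res_aug;
  res_exactS : forall n, exact_at (res_d n.+1) (res_d n) }.

(* A resolution of finite length is encoded as one whose terms vanish from some
   point on; the classes P used below contain the zero module. *)
Definition finite_dimension (P : lmodType S -> Prop) A :=
  exists (n : nat) (F : resolution A),
    (forall k, P (F k)) /\ (forall k, (n < k)%N -> forall x : F k, x = 0).

Definition finite_fd A := finite_dimension flat A.
Definition finite_pd A := finite_dimension projective A.

(* Ext^j_S(A, B) = 0, i.e. the j-th cohomology of Hom(P, B) vanishes for P a
   projective resolution of A. Resolutions exist and the cohomology does not
   depend on P, so quantifying over all of them is harmless. *)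
Definition Ext_zero (j : nat) A B :=
  forall P : resolution A, (forall k, projective (P k)) ->
    match j with
    | 0 => forall h : {linear P 0 -> B}, (forall x, h (res_d P 0 x) = 0) ->
             forall x, h x = 0
    | i.+1 => hom_to_exact (res_d P i.+1) (res_d P i) B
    end.

Definition finitely_generated A :=
  exists n (p : {linear 'rV[S]_n -> A}), forall a, exists x, p x = a.

Definition finitely_presented A :=
  exists m n (q : {linear 'rV[S]_m -> 'rV[S]_n}) (p : {linear 'rV[S]_n -> A}),
    (forall a, exists x, p x = a) /\ exact_at q p.

Definition FP_injective B := forall L, finitely_presented L -> Ext_zero 1 L B.

(* Every finitely generated left ideal, given as a submodule of S, is finitely
   presented. *)
Definition left_coherent :=
  forall I : submodClosed S^o,
    finitely_generated (submod I) -> finitely_presented (submod I).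

Record exact_complex := ExactComplex {
  cpx_mod :> int -> lmodType S;
  cpx_d : forall i, {linear cpx_mod i -> cpx_mod (i + 1)};
  cpx_exact : forall i, exact_at (cpx_d i) (cpx_d (i + 1)) }.

Definition ding_projective X :=
  exists P : exact_complex, [/\ forall i, projective (P i),
    forall F, flat F -> forall i, hom_to_exact (cpx_d P i) (cpx_d P (i + 1)) F &
    isomorphic X (immod (cpx_d P (- 1)))].

Definition ding_injective X :=
  exists I : exact_complex, [/\ forall i, injective_mod (I i),
    forall E, FP_injective E ->
      forall i, hom_from_exact E (cpx_d I i) (cpx_d I (i + 1)) &
    isomorphic X (kermod (cpx_d I 0))].
End Modules.

Definition right_coherent (S : nzRingType) := left_coherent S^c.

(* Tor_j^R(N, X) = 0, i.e. the j-th homology of P (x)_R X vanishes for P a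
   projective resolution of N; same remark as for Ext. *)
Definition Tor_zero (R : nzRingType) (j : nat) (N : lmodType R^c) (X : lmodType R) :=
  forall P : resolution N, (forall k, projective (P k)) ->
    let d k := tensor_map (res_d P k) (idfun : {linear X -> X}) in
    match j with
    | 0 => forall t, exists s, d 0 s = t
    | i.+1 => exact_at (d i.+1) (d i)
    end.

Section PhiPsi.
Variables (R : nzRingType) (M : bimodType R).

Definition Phi (C : lmodType R -> Prop) (W : lmodType (trivext M)) : Prop :=
  injective (@lpair_map R M W) /\ C (cokermod (@lpair_map R M W)).

Definition Psi (C : lmodType R^c -> Prop) (W : lmodType (trivext M)^c) : Prop :=
  (forall h, exists y, @rpair_map R M W y = h) /\ 
  C (@kermod R^c (rbase W) (rhom M (rbase W)) (@rpair_map R M W)).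
End PhiPsi.

(* Main.v *)
Require Import Defs.
From HB Require Import structures.
From mathcomp Require Import all_boot all_order all_algebra.
From mathcomp Require Import generic_quotient ring_quotient.
From mathcomp Require Import boolp functions.
From mathcomp Require Import freeg.
From mathcomp Require classical_sets.

(** Write T for the trivial extension R |x M.

    A module is Ding projective as soon as it belongs to some class of modules G
    such that every Z in G sits in short exact sequences Z -> P -> Z' and Z'' ->
    P' -> Z with P, P' projective and Z', Z'' in G, and such that Ext^1(Z, F) =
    0 for Z in G and F flat: the sequences splice into a complete resolution.
    The Ding projectives form such a class themselves ([ding_projective_coind],
    [ding_proj_self]), so no complex has to be handled after this, and both
    inclusions between classes of Ding projectives amount to exhibiting a
    suitable class.

    The hypothesis M (x) M = 0 enters mainly through one fact: for every
    T-module W the map M (x) W -> M (x) (W / MW) is an isomorphism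
    ([btr_coker_inj]). So if the action M (x) W -> W is injective, W is an
    extension of X = W / MW by M (x) X ([coker_ses]). This is the case for flat
    W, with W / MW flat over R ([flat_act_inj], [flat_coker]), and for the
    module X + M (x) X induced by X.

    Two vanishing results over R are used throughout. Since M has finite flat
    dimension on the left, so has M (x) F for F flat, and Ding projectives have
    no Ext^1 into M (x) F ([dp_orth_btensor]). Since M has finite flat dimension
    on the right, an exact sequence running to the right through modules Q with
    Tor_j(M, Q) = 0 for all j > 0 stays exact under M (x) - ([tor1_coresolved]).

    That Phi(DP(R)) is contained in DP(T): let W be in Phi(DP(R)) with cokernel
    X. A surjection P -> X from a projective with Ding projective kernel lifts
    to a cover of W by the module induced by P ([Phi_cover]), an embedding X ->
    P with Ding projective cokernel lifts to an embedding of W because Ext^1(X,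
    M (x) P) = 0 ([Phi_next]), and a map into a flat T-module F is extended in
    two steps, along M (x) C -> F -> C with C = F / MF ([Phi_ext]).

    That DP(T) is contained in Phi(DP(R)): a projective T-module Q is an
    extension of a projective C by M (x) C, so Tor_j(M, Q) = 0 by hypothesis,
    and M (x) - keeps complete T-resolutions exact. Hence Ding projective
    T-modules have injective action and their cokernels W / MW inherit complete
    resolutions ([coker_ses3]). It remains to see that Ding projective T-modules
    have no Ext^1 into flat R-modules N, on which M acts as zero
    ([dp_orth_triv]). There is an exact sequence M (x) N -> T (x) N -> N of
    T-modules; its middle term is flat, and its left term is induced by the
    R-module M (x) N, so the hypothesis on Tor_j(M, M (x) N) turns a finite flat
    resolution of M (x) N over R into one over T ([ind_orth]).

    The description of Ding injectives is dual, with X + Hom(M, X) in place of X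
    + M (x) X, kernels of W -> Hom(M, W) in place of cokernels, and embeddings
    into injectives in place of free covers. What has no counterpart above is
    the behaviour of FP-injective modules. The elements killed by M in an
    FP-injective T-module E form an FP-injective R-module, and E -> Hom(M, E) is
    onto, because T / M is finitely presented ([FP_injective_ker],
    [FP_injective_ract]); coinduction preserves FP-injectivity because M is
    finitely presented over R ([FP_injective_coind], [fp_bimod]); and Hom(M, X)
    has finite FP-injective dimension for X FP-injective, by adjunction from the
    finite flat dimension of M on the left ([ext_at_rhom]), which requires
    resolutions by finitely presented modules and hence the coherence of R,
    inherited from T ([fp_sub_rV]). *)

Set Implicit Arguments.
Unset Strict Implicit.
Unset Printing Implicit Defensive.

Import GRing.Theory.
Local Open Scope ring_scope.

(** * Short exact sequences and Ext^1 *)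

Definition to_linear (S : nzRingType) (A B : lmodType S) (f : A -> B)
    (fP : linear f) : {linear A -> B} :=
  HB.pack f (GRing.isLinear.Build S A B _ f fP).

Definition to_additive (U V : zmodType) (f : U -> V) (fB : zmod_morphism f) :
  {additive U -> V} := HB.pack f (GRing.isZmodMorphism.Build U V f fB).

Section Homs.
Variable S : nzRingType.
Implicit Types A B C E F I J K L N P Q X Y Z : lmodType S.

Definition surj (U V : Type) (f : U -> V) := forall y, exists x, f x = y.

Record ses A B C (f : {linear A -> B}) (g : {linear B -> C}) : Prop := Ses {
  ses_inj : injective f;
  ses_surj : surj g;
  ses_exact : exact_at f g }.

Lemma ker0_inj A B (f : {linear A -> B}) :
  (forall x, f x = 0 -> x = 0) -> injective f.
Proof.
move=> f0 x y /eqP; rewrite -subr_eq0 -linearB => /eqP/f0/eqP.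
by rewrite subr_eq0 => /eqP.
Qed.

Lemma inj_ker0 A B (f : {linear A -> B}) x : injective f -> f x = 0 -> x = 0.
Proof. by move=> fI fx; apply: fI; rewrite fx linear0. Qed.

Lemma ses_gf A B C (f : {linear A -> B}) (g : {linear B -> C}) :
  ses f g -> forall a, g (f a) = 0.
Proof. by case=> _ _ ex a; apply/ex; exists a. Qed.

Lemma ses_ker A B C (f : {linear A -> B}) (g : {linear B -> C}) :
  ses f g -> forall b, g b = 0 -> exists a, f a = b.
Proof. by case=> _ _ ex b /ex. Qed.

Lemma lin_factor B C X (g : {linear B -> C}) (h : {linear B -> X}) :
  surj g -> (forall b, g b = 0 -> h b = 0) ->
  exists k : {linear C -> X}, forall b, h b = k (g b).
Proof.
move=> /choice[s sP] gh; pose k c := h (s c).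
have kP b : h b = k (g b).
  apply/eqP; rewrite -subr_eq0 -linearB; apply/eqP/gh.
  by rewrite linearB sP subrr.
have kl : linear k.
  move=> a x y; rewrite -[x in LHS]sP -[y in LHS]sP -linearP -kP.
  by rewrite linearP.
by exists (to_linear kl).
Qed.

Lemma lin_lift A B X (f : {linear A -> B}) (h : {linear X -> B}) :
  injective f -> (forall x, exists a, f a = h x) ->
  exists k : {linear X -> A}, forall x, f (k x) = h x.
Proof.
move=> fI /choice[k kP].
have kl : linear k by move=> a x y; apply: fI; rewrite linearP !kP linearP.
by exists (to_linear kl).
Qed.

Lemma lift_ker A B C X (f : {linear A -> B}) (g : {linear B -> C})
    (h : {linear X -> B}) :
  ses f g -> (forall x, g (h x) = 0) ->
  exists k : {linear X -> A}, forall x, f (k x) = h x.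
Proof.
by move=> fg gh; apply: (lin_lift (ses_inj fg) _) => x; apply: (ses_ker fg).
Qed.

Lemma factor_coker A B C X (f : {linear A -> B}) (g : {linear B -> C})
    (h : {linear B -> X}) :
  ses f g -> (forall x, h (f x) = 0) ->
  exists k : {linear C -> X}, forall x, h x = k (g x).
Proof.
move=> fg hf; apply: lin_factor (ses_surj fg) _ => b.
by move=> /(ses_ker fg)[a <-].
Qed.

Lemma bij_inj_surj A B (f : A -> B) : injective f -> surj f -> bijective f.
Proof.
move=> fI /choice[k kP]; exists k => [x|//].
by apply: fI; rewrite kP.
Qed.

Lemma isom_inj_surj A B (f : {linear A -> B}) :
  injective f -> surj f -> isomorphic A B.
Proof. by move=> fI fS; exists f; exact: bij_inj_surj. Qed.

Fact linear_pair_linear A B C (f : {linear A -> B}) (g : {linear A -> C}) :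
  linear (fun x => (f x, g x) : (B * C)%type).
Proof. by move=> a x y; rewrite !linearP. Qed.

Definition linear_pair A B C (f : {linear A -> B}) (g : {linear A -> C}) :
  {linear A -> (B * C)%type} := to_linear (linear_pair_linear f g).

Definition kincl A B (f : {linear A -> B}) : {linear kermod f -> A} := \val.
Arguments kincl : simpl never.

Lemma kincl_inj A B (f : {linear A -> B}) : injective (@kincl A B f).
Proof. exact: val_inj. Qed.

Lemma kinclP A B (f : {linear A -> B}) : exact_at (@kincl A B f) f.
Proof.
move=> y; split=> [fy|[x <-]]; last first.
  by have := valP x; rewrite unfold_in => /eqP.
have yk : y \in ker_pred f by rewrite unfold_in; apply/eqP.
by exists (Sub y yk : submod (ker_pred f)); exact: SubK.
Qed.

Lemma kincl0 A B (f : {linear A -> B}) x : f (kincl f x) = 0.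
Proof. by apply/kinclP; exists x. Qed.

Lemma ses_kincl A B (f : {linear A -> B}) : surj f -> ses (kincl f) f.
Proof. by move=> fS; split; [exact: kincl_inj | exact: fS | exact: kinclP]. Qed.

Fact quot_pi_linear A (I : submodClosed A) : linear (@quotmod_pi S A I).
Proof. by move=> a x y; rewrite quotmod_piD -quotmod_piZ. Qed.

Definition cproj A B (f : {linear A -> B}) : {linear B -> cokermod f} :=
  to_linear (@quot_pi_linear B (im_pred f)).
Arguments cproj : simpl never.

Lemma cproj_surj A B (f : {linear A -> B}) : surj (cproj f).
Proof. exact: quotmod_pi_surj. Qed.

Lemma cprojP A B (f : {linear A -> B}) : exact_at f (cproj f).
Proof.
move=> y; rewrite -(linear0 (cproj f)); split.
  by move/quotmod_piP; rewrite subr0 unfold_in => /asboolP.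
by move=> yf; apply/quotmod_piP; rewrite subr0 unfold_in; apply/asboolP.
Qed.

Lemma ses_cproj A B (f : {linear A -> B}) : injective f -> ses f (cproj f).
Proof. by move=> fI; split; [exact: fI | exact: cproj_surj | exact: cprojP]. Qed.

Definition iincl A B (f : {linear A -> B}) : {linear immod f -> B} := \val.
Arguments iincl : simpl never.

Lemma iincl_inj A B (f : {linear A -> B}) : injective (iincl f).
Proof. exact: val_inj. Qed.

Lemma iinclP A B (f : {linear A -> B}) y :
  (exists x, iincl f x = y) <-> exists x, f x = y.
Proof.
split=> [[x <-]|fy]; first by have /asboolP := valP x.
have yi : y \in im_pred f by rewrite unfold_in; apply/asboolP.
by exists (Sub y yi : submod (im_pred f)); exact: SubK.
Qed.

(** Vanishing of Ext^1(X, N), free of any choice of resolution. *)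
Definition ext1 X N := forall A B (f : {linear A -> B}) (g : {linear B -> X}),
  ses f g -> forall h : {linear A -> N},
  exists k : {linear B -> N}, forall a, h a = k (f a).

(** The other standard reading of Ext^1 = 0, obtained by pulling the sequence
    back along h and retracting the pullback onto N. *)
Lemma ext1_lift X N B C (f : {linear N -> B}) (g : {linear B -> C}) :
  ext1 X N -> ses f g -> forall h : {linear X -> C},
  exists k : {linear X -> B}, forall x, g (k x) = h x.
Proof.
move=> XN fg h.
pose d : {linear (B * X)%type -> C} := (g \o fst) \- (h \o snd).
pose pX : {linear kermod d -> X} := snd \o kincl d.
pose pB : {linear kermod d -> B} := fst \o kincl d.
have dP e : g (pB e) = h (pX e).
  have /kinclP : exists x, kincl d x = kincl d e by exists e.
  by move=> /eqP; rewrite subr_eq0 => /eqP.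
have mk b x : g b = h x -> exists e, pB e = b /\ pX e = x.
  move=> bx; have /kinclP[e ee] : d (b, x) = 0 by rewrite /= bx subrr.
  by exists e; rewrite -[pB e]/(kincl d e).1 -[pX e]/(kincl d e).2 ee.
pose i0 : {linear N -> (B * X)%type} := (linear_pair f (\0 : {linear N -> X})).
have [i iP] : exists i : {linear N -> kermod d}, forall n, kincl d (i n) = i0 n.
  apply: lin_lift (kincl_inj (f := d)) _ => n.
  by apply/kinclP; rewrite /= (ses_gf fg) linear0 subr0.
have iB n : pB (i n) = f n by rewrite -[LHS]/(kincl d (i n)).1 iP.
have iX n : pX (i n) = 0 by rewrite -[LHS]/(kincl d (i n)).2 iP.
have sesi : ses i pX.
  split.
  - by move=> x y xy; apply: (ses_inj fg); rewrite -!iB xy.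
  - move=> x; have [b bx] := ses_surj fg (h x).
    by have [e [_ <-]] := mk _ _ bx; exists e.
  - move=> e; split=> [e0|[n <-] //].
    have [n nb] : exists n, f n = pB e.
      by apply: (ses_ker fg); rewrite dP e0 linear0.
    exists n; apply: (kincl_inj (f := d)); rewrite iP.
    by rewrite [RHS]surjective_pairing -[(kincl d e).1]/(pB e) -nb -[(kincl d e).2]/(pX e) e0.
have [r rP] := XN _ _ _ _ sesi (idfun : {linear N -> N}).
pose s : {linear kermod d -> B} := pB \- (f \o r).
have [k kP] : exists k : {linear X -> B}, forall e, s e = k (pX e).
  apply: (factor_coker sesi _) => n.
  by rewrite -[LHS]/(pB (i n) - f (r (i n))) iB -rP subrr.
exists k => x; have [b bx] := ses_surj fg (h x).
have [e [eb <-]] := mk _ _ bx.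
rewrite -kP -[s e]/(pB e - f (r e)) linearB (ses_gf fg) subr0.
exact: dP.
Qed.

(** A single projective presentation suffices: the middle term of any other
    sequence A -> B -> X is a quotient of A + P, and a map on A together with an
    extension to P defines a map on the sum. *)
Lemma ext1_of_proj K P X N (f : {linear K -> P}) (g : {linear P -> X}) :
  ses f g -> projective P ->
  (forall h : {linear K -> N}, exists k : {linear P -> N},
    forall a, h a = k (f a)) ->
  ext1 X N.
Proof.
move=> fg Ppr PN A B f' g' fg' h.
have [u uP] := Ppr _ _ g' g (ses_surj fg').
have [v vP] : exists v : {linear K -> A}, forall x, f' (v x) = (u \o f) x.
  apply: (lift_ker (g := g')) => // x.
  by rewrite /= -uP (ses_gf fg).
have [w wP] := PN (h \o v).
pose q : {linear (A * P)%type -> B} :=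
  (f' \o (fst : {linear (A * P)%type -> A}))
    \+ (u \o (snd : {linear (A * P)%type -> P})).
pose e : {linear (A * P)%type -> N} :=
  (h \o (fst : {linear (A * P)%type -> A}))
    \+ (w \o (snd : {linear (A * P)%type -> P})).
have [k kP] : exists k : {linear B -> N}, forall x, e x = k (q x).
  apply: lin_factor => [b|[a p] /= q0].
    have [p pb] := ses_surj fg (g' b).
    have [a ab] : exists a, f' a = b - u p.
      by apply: (ses_ker fg'); rewrite linearB -uP pb subrr.
    by exists (a, p); rewrite /q /= ab subrK.
  have [x xp] : exists x, f x = p.
    apply: (ses_ker fg); rewrite uP.
    by rewrite -[RHS](linear0 g') -q0 linearD (ses_gf fg') add0r.
  have -> : a = - v x.
    apply: (ses_inj fg'); rewrite linearN vP /= xp.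
    by apply/eqP; rewrite -addr_eq0 q0.
  by rewrite linearN -xp -wP addNr.
exists k => a; have := kP (a, 0).
by rewrite /e /q /= !linear0 !addr0.
Qed.

(** Dually, a single injective copresentation of N suffices: subtract from an
    extension to J a lift of what it induces on X. *)
Lemma ext1_of_inj X N J C (f : {linear N -> J}) (g : {linear J -> C}) :
  ses f g -> injective_mod J ->
  (forall h : {linear X -> C}, exists k : {linear X -> J},
    forall x, g (k x) = h x) ->
  ext1 X N.
Proof.
move=> fg Jinj XC A B f' g' fg' h.
have [u uP] := Jinj _ _ f' (f \o h) (ses_inj fg').
have [v vP] : exists v : {linear X -> C}, forall b, (g \o u) b = v (g' b).
  by apply: (factor_coker fg' _) => a; rewrite /= -uP /= (ses_gf fg).
have [w wP] := XC v.
have [k kP] : exists k : {linear B -> N}, forall b, f (k b) = (u \- (w \o g')) b.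
  by apply: (lift_ker (g := g)) => // b; rewrite /= linearB wP -vP subrr.
exists k => a; apply: (ses_inj fg).
by rewrite kP /= (ses_gf fg') linear0 subr0 -uP.
Qed.

(** Ext^1(K, X) and Ext^1(Y, C) both compute Ext^2(Y, X). *)
Lemma ext1_shift K P Y X J C (f : {linear K -> P}) (g : {linear P -> Y})
    (f' : {linear X -> J}) (g' : {linear J -> C}) :
  ses f g -> projective P -> ses f' g' -> injective_mod J ->
  ext1 K X <-> ext1 Y C.
Proof.
move=> fg Ppr fg' Jinj; split=> [KX|YC].
  apply: (ext1_of_proj fg Ppr) => h.
  have [u uP] := ext1_lift KX fg' h.
  have [v vP] := Jinj _ _ f u (ses_inj fg).
  by exists (g' \o v) => a; rewrite /= -vP uP.
apply: (ext1_of_inj fg' Jinj) => h.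
have [u uP] := YC _ _ _ _ fg h.
have [v vP] := Ppr _ _ g' u (ses_surj fg').
by exists (v \o f) => a; rewrite /= -vP -uP.
Qed.

(** Exactness of Ext^1(Y, B) -> Ext^1(Y, C) -> Ext^2(Y, A), the last group being
    Ext^1(K, A). *)
Lemma ext1_quot K P Y A B C (f : {linear K -> P}) (g : {linear P -> Y})
    (f' : {linear A -> B}) (g' : {linear B -> C}) :
  ses f g -> projective P -> ses f' g' -> ext1 Y B -> ext1 K A -> ext1 Y C.
Proof.
move=> fg Ppr fg' YB KA; apply: (ext1_of_proj fg Ppr) => h.
have [u uP] := ext1_lift KA fg' h.
have [v vP] := YB _ _ _ _ fg u.
by exists (g' \o v) => a; rewrite /= -vP uP.
Qed.

(** Exactness of Ext^1(B, X) -> Ext^1(A, X) -> Ext^2(C, X), the last group being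
    Ext^1(C, X'). *)
Lemma ext1_sub X J X' A B C (f : {linear X -> J}) (g : {linear J -> X'})
    (f' : {linear A -> B}) (g' : {linear B -> C}) :
  ses f g -> injective_mod J -> ses f' g' ->
  ext1 B X -> ext1 C X' -> ext1 A X.
Proof.
move=> fg Jinj fg' BX CX'; apply: (ext1_of_inj fg Jinj) => h.
have [u uP] := CX' _ _ _ _ fg' h.
have [v vP] := ext1_lift BX fg u.
by exists (v \o f') => a; rewrite /= vP -uP.
Qed.

Lemma ext1_proj X N : projective X -> ext1 X N.
Proof.
move=> Xpr A B f g fg h.
have [s sP] := Xpr _ _ g (idfun : {linear X -> X}) (ses_surj fg).
have [k kP] : exists k : {linear B -> A}, forall b, f (k b) = (idfun \- (s \o g)) b.
  by apply: (lift_ker (g := g)) => // b; rewrite /= linearB -sP subrr.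
exists (h \o k) => a /=; congr (h _); apply: (ses_inj fg).
by rewrite kP /= (ses_gf fg) linear0 subr0.
Qed.

Lemma ext1_inj X N : injective_mod N -> ext1 X N.
Proof. by move=> Ninj A B f g [fI _ _] h; exact: Ninj. Qed.

Lemma ext1_0l X N : (forall x : X, x = 0) -> ext1 X N.
Proof.
move=> X0; apply: ext1_proj => A B g h gS; exists \0 => x.
by rewrite [x]X0 !linear0.
Qed.
End Homs.
Arguments kincl {S A B}.
Arguments iincl {S A B}.
Arguments cproj {S A B}.
Arguments kincl0 {S A B}.

(** * Complete resolutions spliced from short exact sequences *)

Section TwoSided.
Variables (S : nzRingType) (Pr : lmodType S -> Prop).
Implicit Types X Z : lmodType S.

(** The pieces of which complete resolutions are spliced. *)
Record link Z Z' := Link {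
  link_mod : lmodType S;
  link_in : {linear Z -> link_mod};
  link_out : {linear link_mod -> Z'};
  link_ses : ses link_in link_out;
  link_Pr : Pr link_mod }.

Record two_sided (G : lmodType S -> Prop) : Prop := TwoSided {
  ts_next : forall Z, G Z -> exists Z', inhabited (link Z Z') /\ G Z';
  ts_prev : forall Z, G Z -> exists Z', inhabited (link Z' Z) /\ G Z' }.

(** Dependent choice from X in both directions. *)
Lemma splice G X : two_sided G -> G X ->
  exists (Z : int -> lmodType S) (l : forall i, link (Z i) (Z (i + 1))),
    (forall i, G (Z i)) /\ Z 0 = X.
Proof.
move=> [nx pv] GX; pose sg := {Z | G Z}.
have /choice[n nP] : forall s : sg, exists t : sg, inhabited (link (sval s) (sval t)).
  by case=> Z GZ; have [Z' [l GZ']] := nx _ GZ; exists (exist _ _ GZ').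
have /choice[p pP] : forall s : sg, exists t : sg, inhabited (link (sval t) (sval s)).
  by case=> Z GZ; have [Z' [l GZ']] := pv _ GZ; exists (exist _ _ GZ').
pose z0 : sg := exist _ X GX.
pose z (i : int) := match i with Posz k => iter k n z0 | Negz k => iter k.+1 p z0 end.
have zl i : exists l : link (sval (z i)) (sval (z (i + 1))), True.
  have [l] : inhabited (link (sval (z i)) (sval (z (i + 1)))).
    case: i => [k|[|k]].
    - have -> : Posz k + 1 = Posz k.+1 by rewrite -PoszD addn1.
      exact: nP.
    - exact: pP.
    - have -> : Negz k.+1 + 1 = Negz k by rewrite !NegzE -[k.+2]addn1 PoszD opprD subrK.
      exact: pP.
  by exists l.
exists (fun i => sval (z i)), (fun i => sval (cid (zl i))).
by split=> // i; exact: svalP (z i).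
Qed.

Section Spliced.
Variables (Z : int -> lmodType S) (l : forall i, link (Z i) (Z (i + 1))).

Definition spliced_d i : {linear link_mod (l i) -> link_mod (l (i + 1))} :=
  link_in (l (i + 1)) \o link_out (l i).

Fact spliced_exact i : exact_at (spliced_d i) (spliced_d (i + 1)).
Proof.
have [inI _ _] := link_ses (l (i + 1 + 1)).
have [_ outS _] := link_ses (l i).
have [_ _ ex] := link_ses (l (i + 1)).
move=> y; split=> [/= /(inj_ker0 inI)/ex[x <-]|[x <-] /=].
  by have [w <-] := outS x; exists w.
by rewrite (ses_gf (link_ses (l (i + 1)))) linear0.
Qed.

Definition spliced : exact_complex S := ExactComplex spliced_exact.

Lemma spliced_im i : isomorphic (Z (i + 1)) (immod (spliced_d i)).
Proof.
have [inI _ _] := link_ses (l (i + 1)).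
have [_ outS _] := link_ses (l i).
have [k kP] : exists k : {linear Z (i + 1) -> immod (spliced_d i)},
    forall x, iincl (spliced_d i) (k x) = link_in (l (i + 1)) x.
  apply: lin_lift; first exact: iincl_inj.
  by move=> x; apply/iinclP; have [w <-] := outS x; exists w.
apply: (@isom_inj_surj _ _ _ k) => [x y xy|y].
  by apply: inI; rewrite -!kP xy.
have [w wy] : exists w, spliced_d i w = iincl _ y by apply/iinclP; exists y.
by exists (link_out (l i) w); apply: (iincl_inj (f := spliced_d i)); rewrite kP -wy.
Qed.

Lemma spliced_ker i : isomorphic (Z i) (kermod (spliced_d i)).
Proof.
have [inI _ _] := link_ses (l (i + 1)).
have [inI' _ ex'] := link_ses (l i).
have [k kP] : exists k : {linear Z i -> kermod (spliced_d i)},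
    forall x, kincl (spliced_d i) (k x) = link_in (l i) x.
  apply: lin_lift; first exact: kincl_inj.
  by move=> x; apply/kinclP; rewrite /= (ses_gf (link_ses (l i))) linear0.
apply: (@isom_inj_surj _ _ _ k) => [x y xy|y].
  by apply: inI'; rewrite -!kP xy.
have /ex'[w wy] : link_out (l i) (kincl _ y) = 0.
  by apply: (inj_ker0 inI); apply/(kinclP (spliced_d i)); exists y.
by exists w; apply: (kincl_inj (f := spliced_d i)); rewrite kP -wy.
Qed.
End Spliced.

(** The cycles of an exact complex, up to isomorphism; no index is fixed, so that
    the class is stable under shifts without transporting the complex. *)
Definition cycle_of (P : exact_complex S) Z :=
  exists i (f : {linear Z -> P i}), injective f /\ exact_at f (cpx_d P i).

Lemma cycle_ses (P : exact_complex S) i :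
  exists g : {linear P i -> kermod (cpx_d P (i + 1))},
    ses (kincl (cpx_d P i)) g /\ forall x, kincl _ (g x) = cpx_d P i x.
Proof.
have [g gP] : exists g : {linear P i -> kermod (cpx_d P (i + 1))},
    forall x, kincl _ (g x) = cpx_d P i x.
  apply: lin_lift; first exact: kincl_inj.
  by move=> x; apply/kinclP/cpx_exact; exists x.
have gI := kincl_inj (f := cpx_d P (i + 1)).
exists g; split=> //; split.
- exact: kincl_inj.
- move=> y; have [x xy] : exists x, cpx_d P i x = kincl _ y.
    by apply/cpx_exact/kinclP; exists y.
  by exists x; apply: gI; rewrite gP.
- move=> y; split=> [gy|[x <-]]; last first.
    by apply: gI; rewrite gP linear0; apply/kinclP; exists x.
  by apply/kinclP; rewrite -gP gy linear0.
Qed.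

Lemma cycle_kermod (P : exact_complex S) i : cycle_of P (kermod (cpx_d P i)).
Proof. by exists i, (kincl _); split; [exact: kincl_inj | exact: kinclP]. Qed.

Lemma cycle_link_next (P : exact_complex S) i Z (f : {linear Z -> P i}) :
  injective f -> exact_at f (cpx_d P i) ->
  exists g : {linear P i -> kermod (cpx_d P (i + 1))},
    ses f g /\ forall x, kincl _ (g x) = cpx_d P i x.
Proof.
move=> fI fex; have [g [gs gP]] := cycle_ses P i; exists g; split=> //.
split=> //; first exact: ses_surj gs.
by move=> y; split=> [/(ses_exact gs)/kinclP/fex //|/fex/kinclP/(ses_exact gs)].
Qed.

Lemma cycle_link_prev (P : exact_complex S) j Z (f : {linear Z -> P (j + 1)}) :
  injective f -> exact_at f (cpx_d P (j + 1)) ->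
  exists g : {linear P j -> Z},
    ses (kincl (cpx_d P j)) g /\ forall x, f (g x) = cpx_d P j x.
Proof.
move=> fI fex.
have [g gP] : exists g : {linear P j -> Z}, forall x, f (g x) = cpx_d P j x.
  by apply: lin_lift => // x; apply/fex/cpx_exact; exists x.
exists g; split=> //; split=> [|y|y]; first exact: kincl_inj.
  have [x xy] : exists x, cpx_d P j x = f y by apply/cpx_exact/fex; exists y.
  by exists x; apply: fI; rewrite gP.
rewrite -kinclP -gP; split=> [->|fy]; first by rewrite linear0.
exact: (inj_ker0 fI).
Qed.

Lemma cycles_two_sided (P : exact_complex S) :
  (forall i, Pr (P i)) -> two_sided (cycle_of P).
Proof.
move=> PrP; split=> Z [i [f [fI fex]]].
  have [g [gs _]] := cycle_link_next fI fex.
  exists (kermod (cpx_d P (i + 1))); split; last exact: cycle_kermod.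
  by constructor; apply: Link gs (PrP i).
move: f fI fex; have -> : i = i - 1 + 1 by rewrite subrK.
move: (i - 1) => {}i f fI fex; have [g [gs _]] := cycle_link_prev fI fex.
exists (kermod (cpx_d P i)); split; last exact: cycle_kermod.
by constructor; apply: Link gs (PrP i).
Qed.
End TwoSided.

Section Ding.
Variable S : nzRingType.
Implicit Types X Y Z F E N A B C : lmodType S.

(** Closure under links yields a complex of projectives through any member, and
    the vanishing of Ext^1 makes Hom(-, F) preserve its exactness. *)
Definition ding_proj_class (G : lmodType S -> Prop) :=
  two_sided (@projective S) G /\ forall Z F, G Z -> flat F -> ext1 Z F.

Definition ding_inj_class (G : lmodType S -> Prop) :=
  two_sided (@injective_mod S) G /\
  forall E Z, G Z -> (forall L, finitely_presented L -> ext1 L E) -> ext1 E Z.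

End Ding.

(** * Free resolutions, finite dimension and Ding modules *)

Section Free.
Variable S : nzRingType.
Implicit Types A B C X Y Z F E N : lmodType S.

Fact fglift_linear (K : choiceType) X (f : K -> X) :
  linear (fglift f : {freeg K / S} -> X).
Proof.
have fB : zmod_morphism (fglift f : {freeg K / S} -> X) by exact: lift_is_additive.
pose fz : {additive {freeg K / S} -> X} :=
  to_additive fB.
have fD u v : fglift f (u + v) = fglift f u + fglift f v by exact: (raddfD fz).
have fS (r : seq K) (u : K -> {freeg K / S}) :
    fglift f (\sum_(z <- r) u z) = \sum_(z <- r) fglift f (u z).
  exact: (raddf_sum fz).
move=> a x y; rewrite fD; congr (_ + _).
rewrite -[a *: x]/(fgscale a x) /fgscale -[x in RHS]freeg_sumE !fS scaler_sumr.
by apply: eq_bigr => z _; rewrite !liftU scalerA.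
Qed.

Definition free (K : choiceType) : lmodType S := {freeg K / S}.

Definition gen (K : choiceType) (k : K) : free K := << k >>.

Definition free_lift (K : choiceType) X (f : K -> X) : {linear free K -> X} :=
  to_linear (fglift_linear f).

Lemma free_liftU (K : choiceType) X (f : K -> X) k : free_lift f (gen k) = f k.
Proof. by rewrite /free_lift /= liftU scale1r. Qed.

Lemma free_sumE (K : choiceType) (D : free K) :
  D = \sum_(z <- dom D) coeff z D *: gen z.
Proof.
rewrite -[LHS]freeg_sumE; apply: eq_bigr => z _.
by apply/eqP/freeg_eqP => y; rewrite coeffZ !coeffU mul1r.
Qed.

Lemma free_ext (K : choiceType) X (f g : {linear free K -> X}) :
  (forall k, f (gen k) = g (gen k)) -> forall D, f D = g D.
Proof.
move=> fg D; rewrite [D]free_sumE !linear_sum; apply: eq_bigr => z _.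
by rewrite !linearZ fg.
Qed.

Lemma free_projective (K : choiceType) : projective (free K).
Proof.
move=> A B g h /choice[s sP].
exists (free_lift (fun k => s (h (gen k)))) => D.
apply: (free_ext (f := h) (g := g \o free_lift (fun k => s (h (gen k))))) => k.
by rewrite -[RHS]/(g (free_lift _ (gen k))) free_liftU sP.
Qed.

(** The canonical free cover; [syz] iterated is a projective resolution that
    depends on X alone, which lets higher Ext and Tor be indexed by a number. *)
Definition cover X : {linear free X -> X} := free_lift id.
Arguments cover : simpl never.

Lemma cover_surj X : surj (cover X).
Proof. by move=> x; exists (gen x); exact: free_liftU. Qed.

Definition syz X : lmodType S := kermod (cover X).

Lemma ses_cover X : ses (kincl (cover X)) (cover X).
Proof. exact/ses_kincl/cover_surj. Qed.

Definition syzn n X := iter n syz X.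

Section FreeResolution.
Variable X : lmodType S.
Let F n : lmodType S := free (syzn n X).
Let d n : {linear F n.+1 -> F n} := kincl (cover (syzn n X)) \o cover (syzn n.+1 X).

Fact free_res_exact0 : exact_at (d 0) (cover (syzn 0 X)).
Proof.
move=> y; rewrite kinclP; split=> [[x <-]|[x <-]]; last by exists (cover _ x).
by have [z <-] := @cover_surj (syzn 1 X) x; exists z.
Qed.

Fact free_res_exactS n : exact_at (d n.+1) (d n).
Proof.
have kI m : injective (kincl (cover (syzn m X))) by exact: kincl_inj.
move=> y; split=> [dy|[x <-]]; last first.
  exact: (etrans (congr1 (kincl _) (kincl0 _ (cover _ x))) (linear0 _)).
have /kinclP[z <-] := inj_ker0 (@kI n) (dy : kincl _ (cover _ y) = 0).
by have [w <-] := @cover_surj (syzn n.+2 X) z; exists w.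
Qed.

Definition free_res : resolution X :=
  Resolution (@cover_surj X) free_res_exact0 free_res_exactS.

Lemma free_res_proj n : projective (free_res n).
Proof. exact: free_projective. Qed.
End FreeResolution.

(** Vanishing of Ext^(n+1)(X, N), shifted down to Ext^1. *)
Definition extn n X N := ext1 (syzn n X) N.

(** A map on the (n+1)-st syzygy is a cocycle on the free module covering it. *)
Lemma extn_Ext_zero n X N : Ext_zero n.+1 X N -> extn n X N.
Proof.
move=> XN0.
have XN : hom_to_exact (res_d (free_res X) n.+1) (res_d (free_res X) n) N.
  exact: XN0 (@free_res_proj X).
apply: (ext1_of_proj (ses_cover _) (@free_projective _)) => h.
have [|k kP] := (XN (h \o cover (syzn n.+1 X))).1.
  move=> a.
  exact: (etrans (congr1 h (kincl0 _ (cover _ a))) (linear0 _)).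
by exists k => x; have [z <-] := cover_surj x; exact: kP.
Qed.

Lemma ext1_Ext_zero1 X N : ext1 X N -> Ext_zero 1 X N.
Proof.
move=> XN P _ h; split=> [h0|[k kP] a]; last first.
  rewrite kP; have -> : res_d P 0 (res_d P 1 a) = 0.
    by apply/(@res_exactS _ _ P); exists a.
  exact: linear0.
have s := ses_kincl (res_aug_surj P).
have [g gP] : exists g : {linear P 1%N -> kermod (res_aug P)},
    forall x, kincl _ (g x) = res_d P 0 x.
  apply: lin_lift; first exact: kincl_inj.
  by move=> x; apply/kinclP/(@res_exact0 _ _ P); exists x.
have [u uP] : exists u : {linear kermod (res_aug P) -> N}, forall x, h x = u (g x).
  apply: lin_factor => [y|x gx].
    have [x xy] : exists x, res_d P 0 x = kincl _ y.
      by apply/(@res_exact0 _ _ P)/kinclP; exists y.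
    by exists x; apply: (kincl_inj (f := res_aug P)); rewrite gP.
  have /(@res_exactS _ _ P)[w <-] : res_d P 0 x = 0 by rewrite -gP gx linear0.
  exact: h0.
have [k kP] := XN _ _ _ _ s u.
by exists k => b; rewrite uP kP gP.
Qed.

Lemma FP_injectiveP N :
  FP_injective N <-> forall L, finitely_presented L -> ext1 L N.
Proof.
split=> NP L /NP; first exact: extn_Ext_zero.
exact: ext1_Ext_zero1.
Qed.

(** Finite dimension with respect to a class, unrolled into short exact sequences
    so that dimension shifting becomes an induction on n. *)
Fixpoint dim_lt (P : lmodType S -> Prop) n A : Prop :=
  if n is n'.+1 then
    exists (K F : lmodType S) (f : {linear K -> F}) (g : {linear F -> A}),
      [/\ ses f g, P F & dim_lt P n' K]
  else forall a : A, a = 0.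

Lemma dim_lt_finite P A : finite_dimension P A -> exists n, dim_lt P n A.
Proof.
move=> [n [F [PF F0]]]; exists n.+1.
have resK A' (F' : resolution A') : exists F'' : resolution (kermod (res_aug F')),
    forall k, F'' k = F' k.+1 :> lmodType S.
  have [g gP] : exists g : {linear F' 1%N -> kermod (res_aug F')},
      forall x, kincl _ (g x) = res_d F' 0 x.
    apply: lin_lift; first exact: kincl_inj.
    by move=> x; apply/kinclP/(@res_exact0 _ _ F'); exists x.
  have gS : surj g.
    move=> y; have [x xy] : exists x, res_d F' 0 x = kincl _ y.
      by apply/(@res_exact0 _ _ F')/kinclP; exists y.
    by exists x; apply: (kincl_inj (f := res_aug F')); rewrite gP.
  have gx : exact_at (res_d F' 1) g.
    move=> y; rewrite -(@res_exactS _ _ F') -gP; split=> [->|]; first exact: linear0.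
    exact: (inj_ker0 (kincl_inj (f := res_aug F'))).
  by exists (Resolution gS gx (fun k => @res_exactS _ _ F' k.+1)).
elim: n A F PF F0 => [|n IHn] A F PF F0.
  exists (kermod (res_aug F)), (F 0), (kincl _), (res_aug F).
  split=> //; first exact/ses_kincl/res_aug_surj.
  move=> a; apply: (kincl_inj (f := res_aug F)); rewrite linear0.
  have [x <-] : exists x, res_d F 0 x = kincl _ a.
    by apply/(@res_exact0 _ _ F)/kinclP; exists a.
  by rewrite (F0 1%N isT x) linear0.
exists (kermod (res_aug F)), (F 0), (kincl _), (res_aug F).
split=> //; first exact/ses_kincl/res_aug_surj.
have [F' F'E] := resK _ F.
apply: (IHn _ F') => k; rewrite F'E; first exact: PF.
by move=> nk; apply: F0.
Qed.

End Free.

Section DingP.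
Variable S : nzRingType.
Implicit Types X Y Z F E N A B C : lmodType S.

(** Ding projectives form the largest class closed under both kinds of links
    whose members have no Ext^1 into flat modules: links splice into a complete
    resolution, and conversely its cycles form such a class. *)
Lemma ding_projective_coind G X : ding_proj_class G -> G X -> ding_projective X.
Proof.
move=> [ts GF] /(splice ts)[Z [l [GZ <-]]].
exists (spliced l); split=> [i|F flF i h|]; last 2 first.
- split=> [h0|[k kP] a]; last by rewrite kP; have /= -> : cpx_d (spliced l) (i + 1)
    (cpx_d (spliced l) i a) = 0 by [apply/(@cpx_exact _ (spliced l)); exists a];
    exact: linear0.
  have [inI _ _] := link_ses (l (i + 1)).
  have [u uP] : exists u : {linear Z (i + 1 + 1) -> F},
      forall x, h x = u (link_out (l (i + 1)) x).
    apply: (factor_coker (link_ses (l (i + 1)))) => x.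
    have [y <-] := ses_surj (link_ses (l i)) x; exact: h0.
  have [k kP] := GF _ _ (GZ (i + 1 + 1 + 1)) flF _ _ _ _ (link_ses (l (i + 1 + 1))) u.
  by exists k => b; rewrite uP kP.
- have -> : Z 0 = Z (-1 + 1) by rewrite addNr.
  exact: spliced_im.
exact: link_Pr.
Qed.

Lemma cycles_ding_proj (P : exact_complex S) :
  (forall i, projective (P i)) ->
  (forall F, flat F -> forall i, hom_to_exact (cpx_d P i) (cpx_d P (i + 1)) F) ->
  ding_proj_class (cycle_of P).
Proof.
move=> Ppr PF; split; first exact: cycles_two_sided.
move=> Z F [i [f [fI fex]]] flF.
move: f fI fex; have -> : i = i - 1 - 1 - 1 + 1 + 1 + 1 by rewrite !subrK.
move: (i - 1 - 1 - 1) => {}i f fI fex.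
have [g [gs gP]] := cycle_link_prev fI fex.
apply: (ext1_of_proj gs (Ppr _)) => h.
have [q [qs qP]] := cycle_ses P (i + 1).
have [|k kP] := (PF _ flF i (h \o q)).1.
  move=> a /=; have -> : q (cpx_d P i a) = 0; last exact: linear0.
  apply: (kincl_inj (f := cpx_d P (i + 1 + 1))); rewrite qP linear0.
  by apply/(@cpx_exact _ P); exists a.
by exists k => x; have [y <-] := ses_surj qs x; rewrite qP -kP.
Qed.

Lemma ding_projP X :
  ding_projective X -> exists G, ding_proj_class G /\ G X.
Proof.
move=> [P [Ppr PF [f fb]]]; exists (cycle_of P).
split; first exact: cycles_ding_proj.
exists (-1 + 1), (iincl _ \o f); split.
  by move=> x y /iincl_inj; exact: bij_inj.
move=> y; rewrite (@cpx_exact _ P) -iinclP; split=> [[x <-]|[x <-]].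
  by have [f' _ fK] := fb; exists (f' x); rewrite /= fK.
by eexists.
Qed.

Lemma ding_proj_self : ding_proj_class (@ding_projective S).
Proof.
split=> [|Z F /ding_projP[G [[_ GF] GZ]]]; last exact: GF.
split=> Z /ding_projP[G [[ts GF] GZ]].
  have [Z' [l GZ']] := ts_next ts GZ; exists Z'; split=> //.
  exact: ding_projective_coind GZ'.
have [Z' [l GZ']] := ts_prev ts GZ; exists Z'; split=> //.
exact: ding_projective_coind GZ'.
Qed.

(** The dual splicing, with FP-injective test modules mapping into the
    complex. *)
Lemma ding_injective_coind G X : ding_inj_class G -> G X -> ding_injective X.
Proof.
move=> [ts GE] /(splice ts)[Z [l [GZ <-]]].
exists (spliced l); split=> [i|E /FP_injectiveP flE i h|]; last exact: spliced_ker.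
  exact: link_Pr.
split=> [h0|[k kP] x]; last first.
  by rewrite kP; apply/(@cpx_exact _ (spliced l)); exists (k x).
have [inI _ _] := link_ses (l (i + 1 + 1)).
have [u uP] : exists u : {linear E -> Z (i + 1)},
    forall x, link_in (l (i + 1)) (u x) = h x.
  apply: (lift_ker (link_ses (l (i + 1)))) => x.
  by apply: (inj_ker0 inI); exact: h0.
have [k kP] := ext1_lift (GE _ _ (GZ i) flE) (link_ses (l i)) u.
by exists k => x; rewrite /= kP uP.
Qed.

Lemma ding_injP X : ding_injective X -> exists G, ding_inj_class G /\ G X.
Proof.
move=> [P [Pinj PE [f fb]]]; exists (cycle_of P); split; last first.
  exists 0, (kincl _ \o f); split.
    by move=> x y /kincl_inj; exact: bij_inj.
  move=> y; rewrite kinclP; split=> [[x <-]|[x <-]]; last by eexists.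
  by have [f' _ fK] := fb; exists (f' x); rewrite /= fK.
split; first exact: cycles_two_sided.
move=> E Z [i [f' [fI fex]]] /FP_injectiveP flE.
have [g [gs gP]] := cycle_link_next fI fex.
apply: (ext1_of_inj gs (Pinj _)) => h.
have [|k kP] := (PE _ flE i (kincl _ \o h)).1.
  by move=> x; apply/kinclP; eexists.
by exists k => x; apply: (kincl_inj (f := cpx_d P (i + 1))); rewrite gP -kP.
Qed.

Lemma ding_inj_self : ding_inj_class (@ding_injective S).
Proof.
split=> [|E Z /ding_injP[G [[_ GE] GZ]]]; last exact: GE.
split=> Z /ding_injP[G [[ts GE] GZ]].
  have [Z' [l GZ']] := ts_next ts GZ; exists Z'; split=> //.
  exact: ding_injective_coind GZ'.
have [Z' [l GZ']] := ts_prev ts GZ; exists Z'; split=> //.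
exact: ding_injective_coind GZ'.
Qed.

(** Right orthogonality to the Ding projectives: it holds for flat modules and,
    since every Ding projective is a syzygy of another one, passes to cokernels of
    monomorphisms; hence it holds in finite flat dimension. *)
Definition dp_orth N := forall Z, ding_projective Z -> ext1 Z N.

Lemma dp_orth_flat F : flat F -> dp_orth F.
Proof. by move=> flF Z DZ; exact: (ding_proj_self.2). Qed.

Lemma dp_orth_quot A B C (f : {linear A -> B}) (g : {linear B -> C}) :
  ses f g -> dp_orth A -> dp_orth B -> dp_orth C.
Proof.
move=> fg OA OB Z DZ; have [Z' [[l] DZ']] := ts_prev ding_proj_self.1 DZ.
exact: (ext1_quot (link_ses l) (link_Pr l) fg (OB _ DZ) (OA _ DZ')).
Qed.

(** The dual class contains the modules of finite FP-injective dimension. *)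
Definition di_orth N := forall Z, ding_injective Z -> ext1 N Z.

Lemma di_orth_FP E : FP_injective E -> di_orth E.
Proof. by move=> /FP_injectiveP EP Z DZ; exact: (ding_inj_self.2). Qed.

Lemma di_orth_sub A B C (f : {linear A -> B}) (g : {linear B -> C}) :
  ses f g -> di_orth B -> di_orth C -> di_orth A.
Proof.
move=> fg OB OC Z DZ; have [Z' [[l] DZ']] := ts_next ding_inj_self.1 DZ.
exact: (ext1_sub (link_ses l) (link_Pr l) fg (OB _ DZ) (OC _ DZ')).
Qed.
End DingP.

(** * The tensor product *)

Section Tensors.
Variable R : nzRingType.
Implicit Types (N L Y K : lmodType R^c) (X F Q : lmodType R).

Lemma tensDl N X (n n' : N) (x : X) : tens (n + n') x = tens n x + tens n' x.
Proof. exact: (balancedDl (tens_balanced N X)). Qed.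

Lemma tensDr N X (n : N) (x x' : X) : tens n (x + x') = tens n x + tens n x'.
Proof. exact: (balancedDr (tens_balanced N X)). Qed.

Lemma tensZ N X (r : R) (n : N) (x : X) : tens ((r : R^c) *: n) x = tens n (r *: x).
Proof. exact: (balancedZ (tens_balanced N X)). Qed.

Lemma tens0l N X (x : X) : tens (0 : N) x = 0.
Proof. by apply: (addrI (tens 0 x)); rewrite -tensDl !addr0. Qed.

Lemma tens0r N X (n : N) : tens n (0 : X) = 0.
Proof. by apply: (addrI (tens n 0)); rewrite -tensDr !addr0. Qed.

Lemma tensBl N X (n n' : N) (x : X) : tens (n - n') x = tens n x - tens n' x.
Proof. by apply/eqP; rewrite -subr_eq opprK -tensDl subrK. Qed.

Lemma tensBr N X (n : N) (x x' : X) : tens n (x - x') = tens n x - tens n x'.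
Proof. by apply/eqP; rewrite -subr_eq opprK -tensDr subrK. Qed.

Definition tens_at N X (n : N) : {additive X -> tensor N X} :=
  to_additive (@tensBr N X n).

Lemma tensor_ext N X (A : zmodType) (f g : {additive tensor N X -> A}) :
  (forall n x, f (tens n x) = g (tens n x)) -> forall t, f t = g t.
Proof.
move=> fg; elim/tensor_ind => [|s t fs ft|//]; first by rewrite !raddf0.
by rewrite !raddfB fs ft.
Qed.

Lemma tensor_ext2 N X (A B C : zmodType) (f : {additive tensor N X -> A})
    (f' : {additive A -> B}) (g : {additive tensor N X -> C}) (g' : {additive C -> B}) :
  (forall n x, f' (f (tens n x)) = g' (g (tens n x))) -> forall t, f' (f t) = g' (g t).
Proof. exact: (tensor_ext (f := f' \o f) (g := g' \o g)). Qed.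

Definition tlift N X (A : zmodType) (b : N -> X -> A) (bP : balanced b) :
  {additive tensor N X -> A} :=
  to_additive (tensor_lift_is_zmod_morphism bP).

Lemma tliftE N X (A : zmodType) (b : N -> X -> A) (bP : balanced b) n x :
  tlift bP (tens n x) = b n x.
Proof. exact: tensor_liftE. Qed.

Lemma tmapE N N' X X' (g : {linear N -> N'}) (f : {linear X -> X'}) n x :
  tensor_map g f (tens n x) = tens (g n) (f x).
Proof. exact: (tensor_liftE (tensor_map_balanced g f)). Qed.

Lemma tmap_eq N N' X X' (g g' : {linear N -> N'}) (f f' : {linear X -> X'}) :
  g =1 g' -> f =1 f' -> tensor_map g f =1 tensor_map g' f'.
Proof. by move=> gg ff; apply: tensor_ext => n x; rewrite /= !tmapE gg ff. Qed.

Lemma tmap_comp N N' N'' X X' X'' (g : {linear N -> N'}) (f : {linear X -> X'})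
    (g' : {linear N' -> N''}) (f' : {linear X' -> X''}) t :
  tensor_map g' f' (tensor_map g f t) = tensor_map (g' \o g) (f' \o f) t.
Proof.
apply: (tensor_ext (f := tensor_map g' f' \o tensor_map g f)) => n x.
by rewrite /= !tmapE.
Qed.

Lemma tmap_id N X (t : tensor N X) :
  tensor_map (idfun : {linear N -> N}) (idfun : {linear X -> X}) t = t.
Proof.
by apply: (tensor_ext (g := idfun : {additive tensor N X -> _})) => n x; rewrite /= tmapE.
Qed.

Lemma tmap_surj N N' X X' (g : {linear N -> N'}) (f : {linear X -> X'}) :
  surj g -> surj f -> surj (tensor_map g f).
Proof.
move=> gS fS; elim/tensor_ind => [|s t [s' <-] [t' <-]|n x].
- by exists 0; rewrite raddf0.
- by exists (s' - t'); rewrite raddfB.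
- have [n' <-] := gS n; have [x' <-] := fS x.
  by exists (tens n' x'); rewrite tmapE.
Qed.

(** The quotient A / P: membership in P becomes an equation, which can be
    checked through maps out of a tensor product. *)
Lemma zmod_closed_quot (A : zmodType) (P : A -> Prop) :
  P 0 -> (forall s t, P s -> P t -> P (s - t)) ->
  exists (B : zmodType) (p : {additive A -> B}), surj p /\ forall a, p a = 0 <-> P a.
Proof.
move=> P0 PB; pose p : {pred A} := fun t => `[< P t >].
have pc : zmod_closed p.
  split=> [|s t]; rewrite !unfold_in; first exact/asboolP.
  by move=> /asboolP ? /asboolP ?; exact/asboolP/PB.
pose I : zmodClosed A := HB.pack p (GRing.isZmodClosed.Build _ p pc).
have pB : zmod_morphism (fun a => \pi_(Quotient.quot I) a)%qT.
  by move=> a b; rewrite raddfB.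
pose q : {additive A -> Quotient.quot I} :=
  to_additive pB.
exists (Quotient.quot I), q; split=> [y|a].
  by exists (repr y); exact: reprK.
have -> : P a <-> a - 0 \in I.
  by rewrite subr0; split=> /asboolP.
by rewrite Quotient.idealrBE raddf0; split=> /eqP.
Qed.

(** Right exactness of the tensor product, in both variables at once: modulo the
    elements killed for the two obvious reasons, an inverse of g (x) f is given
    by arbitrary choices of preimages. *)
Lemma tmap_ker N N' X X' (g : {linear N -> N'}) (f : {linear X -> X'})
    (P : tensor N X -> Prop) :
  surj g -> surj f ->
  P 0 -> (forall s t, P s -> P t -> P (s - t)) ->
  (forall n x, g n = 0 -> P (tens n x)) ->
  (forall n x, f x = 0 -> P (tens n x)) ->
  forall t, tensor_map g f t = 0 -> P t.
Proof.
move=> /choice[s sP] /choice[s' s'P] P0 PB Pg Pf.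
have [B [p [_ pP]]] := zmod_closed_quot P0 PB.
have wd n n2 x x2 : g n = g n2 -> f x = f x2 -> p (tens n x) = p (tens n2 x2).
  move=> nn xx; apply/eqP; rewrite -subr_eq0 -raddfB; apply/eqP/pP.
  have -> : tens n x - tens n2 x2 = tens (n - n2) x - tens n2 (x2 - x).
    by rewrite tensBl tensBr opprB addrA subrK.
  by apply: PB; [apply: Pg | apply: Pf]; rewrite linearB ?nn ?xx subrr.
pose b n' x' := p (tens (s n') (s' x')).
have bP : balanced b.
  split=> [x n n'|n x x'|r n x]; rewrite /b.
  - rewrite -raddfD -tensDl; apply: wd => //; by rewrite linearD !sP.
  - rewrite -raddfD -tensDr; apply: wd => //; by rewrite linearD !s'P.
  - have -> : p (tens (s n) (s' (r *: x))) = p (tens (s n) (r *: s' x)).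
      by apply: wd => //; rewrite linearZ /= !s'P.
    by rewrite -tensZ; apply: wd => //; rewrite linearZ /= !sP.
have bp t : tlift bP (tensor_map g f t) = p t.
  apply: (tensor_ext (f := tlift bP \o tensor_map g f)) => n x.
  by rewrite /= tmapE tensor_liftE // /b; apply: wd; rewrite ?sP ?s'P.
by move=> t t0; apply/pP; rewrite -bp t0 raddf0.
Qed.

Definition tl N N' (a : {linear N -> N'}) X : {additive tensor N X -> tensor N' X} :=
  tensor_map a (idfun : {linear X -> X}).
Definition tr N X X' (f : {linear X -> X'}) : {additive tensor N X -> tensor N X'} :=
  tensor_map (idfun : {linear N -> N}) f.

Lemma tlE N N' (a : {linear N -> N'}) X n (x : X) : tl a X (tens n x) = tens (a n) x.
Proof. exact: tmapE. Qed.
Lemma trE N X X' (f : {linear X -> X'}) (n : N) x : tr N f (tens n x) = tens n (f x).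
Proof. exact: tmapE. Qed.

Lemma tlr N N' X X' (a : {linear N -> N'}) (f : {linear X -> X'}) t :
  tl a X' (tr N f t) = tr N' f (tl a X t).
Proof. by rewrite /tl /tr /= !tmap_comp; apply: tmap_eq. Qed.

Lemma tl_comp N N' N'' X (a : {linear N -> N'}) (a' : {linear N' -> N''})
    (b : {linear N -> N''}) : (forall n, a' (a n) = b n) ->
  forall t, tl a' X (tl a X t) = tl b X t.
Proof. by move=> ab t; rewrite /tl /= tmap_comp; apply: tmap_eq. Qed.

Lemma tr_comp N X X' X'' (f : {linear X -> X'}) (f' : {linear X' -> X''})
    (h : {linear X -> X''}) : (forall x, f' (f x) = h x) ->
  forall t, tr N f' (tr N f t) = tr N h t.
Proof. by move=> fh t; rewrite /tr /= tmap_comp; apply: tmap_eq. Qed.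

Lemma tr_eq0 N X X' (f : {linear X -> X'}) t : (forall x, f x = 0) -> tr N f t = 0.
Proof.
move=> f0; apply: (tensor_ext (g := \0)) => n x.
by rewrite /tr /= tmapE f0 tens0r.
Qed.

Lemma tl_eq0 N N' X (f : {linear N -> N'}) t : (forall x, f x = 0) -> tl f X t = 0.
Proof.
move=> f0; apply: (tensor_ext (g := \0)) => n x.
by rewrite /tl /= tmapE f0 tens0l.
Qed.

Lemma tl_surj N N' (a : {linear N -> N'}) X : surj a -> surj (tl a X).
Proof. by move=> aS; apply: tmap_surj => // x; exists x. Qed.

Lemma tr_surj N X X' (f : {linear X -> X'}) : surj f -> surj (tr N f).
Proof. by move=> fS; apply: tmap_surj => // x; exists x. Qed.

Lemma tl_exact K L Y X (a : {linear K -> L}) (b : {linear L -> Y}) :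
  surj b -> (forall n, b n = 0 -> exists k, a k = n) ->
  forall t, tl b X t = 0 -> exists s, tl a X s = t.
Proof.
move=> bS ab; apply: tmap_ker => //.
- by move=> x; exists x.
- by exists 0; rewrite raddf0.
- by move=> _ _ [s <-] [t <-]; exists (s - t); rewrite raddfB.
- by move=> n x /ab[k <-]; exists (tens k x); rewrite tlE.
- by move=> n x /= ->; exists 0; rewrite raddf0 tens0r.
Qed.

Lemma tr_exact N X F Q (f : {linear X -> F}) (g : {linear F -> Q}) :
  surj g -> (forall y, g y = 0 -> exists x, f x = y) ->
  forall t, tr N g t = 0 -> exists s, tr N f s = t.
Proof.
move=> gS fg; apply: tmap_ker => //.
- by move=> x; exists x.
- by exists 0; rewrite raddf0.
- by move=> _ _ [s <-] [t <-]; exists (s - t); rewrite raddfB.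
- by move=> n x /= ->; exists 0; rewrite raddf0 tens0l.
- by move=> n x /fg[k <-]; exists (tens n k); rewrite trE.
Qed.

Lemma zinj (A B : zmodType) (f : {additive A -> B}) :
  (forall x, f x = 0 -> x = 0) -> injective f.
Proof.
move=> f0 x y /eqP; rewrite -subr_eq0 -raddfB => /eqP/f0/eqP.
by rewrite subr_eq0 => /eqP.
Qed.

Lemma zinj0 (A B : zmodType) (f : {additive A -> B}) x : injective f -> f x = 0 -> x = 0.
Proof. by move=> fI fx; apply: fI; rewrite fx raddf0. Qed.

Section FreeFlat.
Variable K : choiceType.

Fact comp_balanced N (k : K) :
  balanced (fun (n : N) (D : free R K) => (coeff k D : R^c) *: n).
Proof.
split=> [D n n'|n D D'|r n D] /=.
- exact: scalerDr.
- by rewrite coeffD; exact: scalerDl.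
- by rewrite coeffZ scalerA.
Qed.

(** A coordinate of N (x) R^(K) = N^(K). *)
Definition tcomp N (k : K) : {additive tensor N (free R K) -> N} :=
  tlift (comp_balanced N k).

Lemma tcomp_nat N N' (g : {linear N -> N'}) k t : tcomp N' k (tl g _ t) = g (tcomp N k t).
Proof.
apply: (tensor_ext (f := tcomp N' k \o tl g _) (g := g \o tcomp N k)) => n D.
by rewrite /= tmapE !tensor_liftE ?linearZ //; exact: comp_balanced.
Qed.

(** Allowing every list that is large enough, instead of a support, makes the
    statement stable under differences. *)
Lemma tcomp_sum N (t : tensor N (free R K)) : exists s : seq K,
  forall s', uniq s' -> {subset s <= s'} ->
    t = \sum_(k <- s') tens (tcomp N k t) (gen R k).
Proof.
elim/tensor_ind: t => [|u v [su uP] [sv vP]|n D].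
- by exists [::] => s' _ _; rewrite big1 // => k _; rewrite raddf0 tens0l.
- exists (su ++ sv) => s' us' ss'.
  rewrite [in LHS](uP s') 1?[in X in _ - X](vP s') //.
  + rewrite -sumrB; apply: eq_bigr => k _.
    by rewrite raddfB tensBl.
  + by move=> k kv; apply: ss'; rewrite mem_cat kv orbT.
  + by move=> k ku; apply: ss'; rewrite mem_cat ku.
- exists (dom D) => s' us' ss'.
  transitivity (tens n (\sum_(k <- s') coeff k D *: gen R k)).
    congr tens; rewrite [LHS]free_sumE.
    rewrite [RHS](bigID (mem (dom D))) /= [X in _ + X]big1 ?addr0; last first.
      by move=> k /coeff_outdom ->; rewrite scale0r.
    rewrite -[RHS]big_filter; apply: perm_big; apply: uniq_perm.
    - exact: uniq_dom.
    - exact: filter_uniq.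
    - by move=> k; rewrite mem_filter; case: (boolP (k \in dom D)) => //= /ss' ->.
  elim: s' {us' ss'} => [|k s IHs]; first by rewrite !big_nil tens0r.
  by rewrite !big_cons tensDr IHs /tcomp tliftE tensZ.
Qed.

Lemma free_flat : flat (free R K).
Proof.
move=> N N' g gI; apply: (zinj (f := tl g _)) => t t0.
have c0 k : tcomp N k t = 0.
  by apply: (inj_ker0 gI); rewrite -tcomp_nat t0 raddf0.
have [s sP] := tcomp_sum t.
rewrite (sP _ (undup_uniq s)); last by move=> k; rewrite mem_undup.
by rewrite big1 // => k _; rewrite c0 tens0l.
Qed.
End FreeFlat.

(** A projective module is a retract of its free cover, naturally after
    tensoring. *)
Lemma proj_flat X : projective X -> flat X.
Proof.
move=> Xpr; have [s sP] := Xpr _ _ (cover X) (idfun : {linear X -> X}) (@cover_surj _ X).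
move=> N N' g gI; apply: (zinj (f := tl g X)) => t t0.
have := @free_flat X _ _ g gI.
move=> /(@zinj0 _ _ (tl g _) (tr N s t)); rewrite tlr t0 raddf0 => /(_ erefl) st.
rewrite -[t]tmap_id -/(tr N idfun t) -(@tr_comp _ _ _ _ s (cover X)) ?st ?raddf0 //.
Qed.

(** Exactness on left R-modules of the functor given by L; [flat] over R^op
    tests L against modules over the double opposite instead. *)
Definition rflat L := forall X X' (f : {linear X -> X'}),
  injective f -> injective (tr L f).
End Tensors.
Arguments tlift : simpl never.
Arguments tl : simpl never.
Arguments tr : simpl never.
Arguments tl_surj {R N N' a} X.
Arguments tr_surj {R} N {X X' f}.

(** * Tor *)

Section RestrMap.
Variables (R S : nzRingType) (p : {rmorphism R -> S}).
Implicit Types A B C : lmodType S.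

Fact restr_map_linear A B (f : {linear A -> B}) :
  linear (f : restr p A -> restr p B).
Proof. by move=> a x y; exact: (linearP f (p a)). Qed.

Definition restr_map A B (f : {linear A -> B}) : {linear restr p A -> restr p B} :=
  to_linear (restr_map_linear f).

Lemma ses_restr A B C (f : {linear A -> B}) (g : {linear B -> C}) :
  ses f g -> ses (restr_map f) (restr_map g).
Proof. by case=> fI gS ex; split. Qed.
End RestrMap.

(** The symmetry N (x)_R X = X (x)_(R^op) N, over an isomorphic copy A of R^op. *)
Section Swap.
Variables (R A : nzRingType) (th : R -> A).
Hypothesis th_surj : surj th.
Variables (L : lmodType A) (N : lmodType R^c) (e : N -> L).
Hypotheses (eB : zmod_morphism e) (eZ : forall r n, e ((r : R^c) *: n) = th r *: e n).
Hypothesis e_bij : bijective e.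

Record op_copy (X : lmodType R) (X2 : lmodType A^c) (d : X -> X2) : Prop := OpCopy {
  op_copyB : zmod_morphism d;
  op_copyZ : forall r x, d (r *: x) = (th r : A^c) *: d x;
  op_copy_bij : bijective d }.

Lemma zmod_morphD (U V : zmodType) (f : U -> V) : zmod_morphism f -> {morph f : x y / x + y}.
Proof.
move=> fB; pose g : {additive U -> V} := to_additive fB.
exact: (raddfD g).
Qed.

Lemma swap_tensor (X : lmodType R) (X2 : lmodType A^c) (d : X -> X2) : op_copy d ->
  exists s : {additive tensor N X -> tensor X2 L},
    injective s /\ forall n x, s (tens n x) = tens (d x) (e n).
Proof.
move=> [dB dZ [d' dK d'K]]; have [e' eK e'K] := e_bij.
have dD := zmod_morphD dB; have eD := zmod_morphD eB.
have sb : balanced (fun n x => tens (d x) (e n)).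
  split=> [x n n'|n x x'|r n x]; first by rewrite eD tensDr.
    by rewrite dD tensDl.
  by rewrite eZ dZ tensZ.
have d'D : {morph d' : x y / x + y} by move=> x y; rewrite -[x]d'K -[y]d'K -dD !dK.
have e'D : {morph e' : x y / x + y} by move=> x y; rewrite -[x]e'K -[y]e'K -eD !eK.
have sb' : balanced (fun x2 l => tens (e' l) (d' x2)).
  split=> [l x x'|x l l'|r x l]; first by rewrite d'D tensDr.
    by rewrite e'D tensDl.
  have [r' <-] := th_surj r.
  have -> : d' ((th r' : A^c) *: x) = r' *: d' x by rewrite -{1}[x]d'K -dZ dK.
  have -> : e' (th r' *: l) = (r' : R^c) *: e' l by rewrite -{1}[l]e'K -eZ eK.
  exact: (esym (tensZ r' _ _)).
exists (tlift sb); split=> [|n x]; last exact: tliftE.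
apply: (can_inj (g := tlift sb')); apply: (tensor_ext2 (g' := idfun) (g := idfun)) => n x.
by rewrite !tliftE dK eK.
Qed.

Lemma swap_inj (X X' : lmodType R) (X2 X2' : lmodType A^c) (d : X -> X2) (d' : X' -> X2')
    (f : {linear X -> X'}) (f2 : {linear X2 -> X2'}) :
  op_copy d -> op_copy d' -> (forall x, f2 (d x) = d' (f x)) ->
  injective (tl f2 L) -> injective (tr N f).
Proof.
move=> /swap_tensor[s [sI sE]] /swap_tensor[s' [_ s'E]] fd f2I; apply: zinj => t t0.
apply: (zinj0 sI); apply: (zinj0 f2I); rewrite -[RHS](raddf0 s') -t0.
by apply: tensor_ext2 => n x; rewrite sE tlE fd trE s'E.
Qed.
End Swap.

Section OppositeTwice.
Variable R : nzRingType.

Definition conv2 (r : R^c^c) : R := r.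

Fact conv2_zmod_morphism : zmod_morphism conv2. Proof. by []. Qed.
Fact conv2_monoid_morphism : monoid_morphism conv2. Proof. by []. Qed.

Definition conv2_morph : {rmorphism R^c^c -> R} :=
  HB.pack conv2 (GRing.isZmodMorphism.Build _ _ conv2 conv2_zmod_morphism)
    (GRing.isMonoidMorphism.Build _ _ conv2 conv2_monoid_morphism).

(** The ring R^op^op is not convertible to R: a left R-module becomes a right
    R^op-module by restriction along R^op^op -> R. *)
Lemma flat_rflat (L : lmodType R^c) : flat L -> rflat L.
Proof.
move=> flL X X' f fI.
have cp (Y : lmodType R) :
    @op_copy R R^c (fun r => r) Y (restr conv2_morph Y) (fun y => y).
  by split=> //; exists (fun y => y).
apply: (@swap_inj R R^c (fun r => r) _ L L (fun l => l) _ _ _ X X' _ _ _ _ f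
  (restr_map conv2_morph f) (cp X) (cp X')) => //; first by move=> r; exists r.
  by exists (fun l => l).
exact: flL.
Qed.

Lemma proj_rflat (L : lmodType R^c) : projective L -> rflat L.
Proof. by move=> /proj_flat/flat_rflat. Qed.
End OppositeTwice.

Section Tor.
Variable R : nzRingType.
Implicit Types (N L Y K : lmodType R^c) (X F Q : lmodType R).

(** Vanishing of Tor_1(Y, X), read off from the sequences ending in X or, in
    [tor1l], from those ending in Y. *)
Definition tor1 Y X := forall X' Q (f : {linear X' -> Q}) (g : {linear Q -> X}),
  ses f g -> injective (tr Y f).

Definition tor1l Y X := forall K L (a : {linear K -> L}) (b : {linear L -> Y}),
  ses a b -> injective (tl a X).

(** Chase in the grid (K -> L -> Y) (x) (X' -> Q -> X). *)
Lemma tor1_of_rflat K L Y X (a : {linear K -> L}) (b : {linear L -> Y}) :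
  ses a b -> rflat L -> injective (tl a X) -> tor1 Y X.
Proof.
move=> ab flL aI X' Q f g fg; apply: zinj => y y0.
have [w wy] := tl_surj X' (ses_surj ab) y.
have [s sw] : exists s, tl a Q s = tr L f w.
  by apply: (tl_exact (ses_surj ab) (ses_ker ab)); rewrite tlr wy.
have [v vs] : exists v, tr K f v = s.
  apply: (tr_exact (ses_surj fg) (ses_ker fg)); apply: (zinj0 aI).
  rewrite tlr sw (tr_comp (h := \0)) ?tr_eq0 // => x.
  exact: ses_gf fg x.
have wv : tl a X' v = w by apply: (flL _ _ _ (ses_inj fg)); rewrite -tlr vs.
by rewrite -wy -wv (tl_comp (b := \0)) ?tl_eq0 // => n; exact: ses_gf ab n.
Qed.

Lemma tor1l_of_flat X' F X Y (f : {linear X' -> F}) (g : {linear F -> X}) :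
  ses f g -> flat F -> injective (tr Y f) -> tor1l Y X.
Proof.
move=> fg flF fI K L a b ab; apply: zinj => y y0.
have [w wy] := tr_surj K (ses_surj fg) y.
have [s sw] : exists s, tr L f s = tl a F w.
  by apply: (tr_exact (ses_surj fg) (ses_ker fg)); rewrite -tlr wy.
have [v vs] : exists v, tl a X' v = s.
  apply: (tl_exact (ses_surj ab) (ses_ker ab)); apply: (zinj0 fI).
  rewrite -tlr sw (tl_comp (b := \0)) ?tl_eq0 // => x.
  exact: ses_gf ab x.
have wv : tr K f v = w by apply: (flF _ _ _ (ses_inj ab)); rewrite -/(tl _ _ _) tlr vs.
by rewrite -wy -wv (tr_comp (h := \0)) ?tr_eq0 // => n; exact: ses_gf fg n.
Qed.

Lemma cover_rflat Y : rflat (free R^c Y).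
Proof. exact/proj_rflat/free_projective. Qed.

(** Balance of Tor, each variable being tested on its free cover. *)
Lemma tor1P Y X : tor1 Y X <-> tor1l Y X.
Proof.
split=> YX.
  exact: (tor1l_of_flat (ses_cover X) (@free_flat _ _) (YX _ _ _ _ (ses_cover X))).
apply: (tor1_of_rflat (ses_cover Y)); first exact: cover_rflat.
exact: YX (ses_cover Y).
Qed.

Lemma tor1_flat F : flat F <-> forall Y, tor1 Y F.
Proof.
split=> [flF Y|YF N N' g gI]; first by apply/tor1P => K L a b [aI _ _]; exact: flF.
have /tor1P/(_ _ _ _ _ (ses_cproj gI)) := YF (cokermod g); exact.
Qed.

Lemma tor1_0r Y X : (forall x : X, x = 0) -> tor1 Y X.
Proof.
move=> X0; apply/tor1P => K L a b _ t t' _; transitivity (0 : tensor K X).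
  rewrite -[t]tmap_id -/(tr _ _ _) tr_eq0 // => x; exact: X0.
by rewrite -[t']tmap_id -/(tr _ _ _) tr_eq0 // => x; exact: X0.
Qed.

Lemma tor1_0l Y X : (forall y : Y, y = 0) -> tor1 Y X.
Proof.
move=> Y0 X' Q f g _ t t' _; transitivity (0 : tensor Y X').
  rewrite -[t]tmap_id -/(tl _ _ _) tl_eq0 // => x; exact: Y0.
by rewrite -[t']tmap_id -/(tl _ _ _) tl_eq0 // => x; exact: Y0.
Qed.

(** Tor_1(K, X) and Tor_1(Y, X') both compute Tor_2(Y, X). *)
Lemma tor1_shift K L Y X' F X (a : {linear K -> L}) (b : {linear L -> Y})
    (f : {linear X' -> F}) (g : {linear F -> X}) :
  ses a b -> rflat L -> ses f g -> flat F -> tor1 K X <-> tor1 Y X'.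
Proof.
move=> ab flL fg flF; split=> [KX|/tor1P YX].
  apply: (tor1_of_rflat ab flL); apply: zinj => t t0.
  apply: (zinj0 (KX _ _ _ _ fg)); apply: (zinj0 (flF _ _ _ (ses_inj ab))).
  by rewrite -/(tl _ _ _) tlr t0 raddf0.
apply/tor1P; apply: (tor1l_of_flat fg flF); apply: zinj => t t0.
apply: (zinj0 (YX _ _ _ _ ab)); apply: (zinj0 (flL _ _ _ (ses_inj fg))).
by rewrite -tlr t0 raddf0.
Qed.

(** Exactness of Tor_2(Y, X) -> Tor_1(Y, X') -> Tor_1(Y, Q), the first group being
    Tor_1(K, X). *)
Lemma tor1_sub K L Y X' Q X (a : {linear K -> L}) (b : {linear L -> Y})
    (f : {linear X' -> Q}) (g : {linear Q -> X}) :
  ses a b -> rflat L -> ses f g -> tor1 Y Q -> tor1 K X -> tor1 Y X'.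
Proof.
move=> ab flL fg /tor1P YQ KX.
apply: (tor1_of_rflat ab flL); apply: zinj => t t0.
apply: (zinj0 (KX _ _ _ _ fg)); apply: (zinj0 (YQ _ _ _ _ ab)).
by rewrite tlr t0 raddf0.
Qed.

(** Vanishing of Tor_(n+1)(Y, X), shifted down to Tor_1. *)
Definition torn n Y X := tor1 (syzn n Y) X.

Lemma tornS n Y X' F X (f : {linear X' -> F}) (g : {linear F -> X}) :
  ses f g -> flat F -> torn n.+1 Y X <-> torn n Y X'.
Proof.
move=> fg flF; apply: (tor1_shift (ses_cover (syzn n Y)) _ fg flF).
exact: cover_rflat.
Qed.

Lemma torn_sub n Y X' Q X (f : {linear X' -> Q}) (g : {linear Q -> X}) :
  ses f g -> torn n Y Q -> torn n.+1 Y X -> torn n Y X'.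
Proof.
move=> fg; apply: (tor1_sub (ses_cover (syzn n Y)) _ fg).
exact: cover_rflat.
Qed.

Lemma torn_flat n Y F : flat F -> torn n Y F.
Proof. by move=> /tor1_flat; exact. Qed.

(** Tor_(n+1) vanishes in the left variable when that has flat dimension < n + 1;
    the induction moves the syzygies to the right variable, where they can be
    compared with those of K. *)
Lemma dim_lt_tornl n Y X : dim_lt (@flat R^c) n Y -> torn n Y X.
Proof.
elim: n Y X => [|n IHn] Y X; first exact: tor1_0l.
move=> [K [L [a [b [ab /flat_rflat flL /IHn YK]]]]].
have {IHn}: torn n K X by [].
elim: n X {YK} => [|n IHn] X.
  move/(tor1_shift ab flL (ses_cover X) (@free_flat _ _)).
  by move/(tornS 0 Y (ses_cover X) (@free_flat _ _)).
move/(tornS n K (ses_cover X) (@free_flat _ _))/IHn.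
by move/(tornS n.+1 Y (ses_cover X) (@free_flat _ _)).
Qed.

Lemma dim_lt_tornr n Y X : dim_lt (@flat R) n X -> torn n Y X.
Proof.
elim: n X => [|n IHn] X; first exact: tor1_0r.
by move=> [K [L [a [b [ab flL /IHn YK]]]]]; apply/(tornS n Y ab flL).
Qed.

(** Vanishing of Tor_(n+1)(L, X) along every projective resolution of L, so that
    resolutions by finitely presented modules can be used. *)
Fixpoint tor_at n L X : Prop :=
  if n is n'.+1 then forall (K P : lmodType R^c) (a : {linear K -> P}) (b : {linear P -> L}),
    ses a b -> projective P -> tor_at n' K X
  else tor1 L X.

Lemma dim_lt_tor_at n L X : dim_lt (@flat R) n X -> tor_at n L X.
Proof.
elim: n L X => [|n IHn] L X; first exact: tor1_0r.
move=> [X' [F [f [g [fg flF /(IHn L)]]]]].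
elim: n L {IHn} => [|n IHn] L LX' K P a b ab Ppr.
  exact: (iffRL (tor1_shift ab (proj_rflat Ppr) fg flF) LX').
exact: (IHn _ (LX' _ _ _ _ ab Ppr)).
Qed.

Lemma torn_Tor_zero n Y X : Tor_zero n.+1 Y X -> torn n Y X.
Proof.
move=> YX0.
have YX : exact_at (tl (res_d (free_res Y) n.+1) X) (tl (res_d (free_res Y) n) X).
  exact: YX0 (@free_res_proj _ Y).
apply: (tor1_of_rflat (ses_cover (syzn n Y))); first exact: cover_rflat.
apply: zinj => t t0; have [s st] := tl_surj X (@cover_surj _ (syzn n.+1 Y)) t.
have [|u us] := (YX s).1.
  by rewrite -(@tl_comp _ _ _ _ _ (cover (syzn n.+1 Y)) (kincl _)) ?st.
rewrite -st -us (tl_comp (b := \0)) ?tl_eq0 // => x.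
exact: (kincl0 (cover (syzn n.+1 Y))).
Qed.
End Tor.

Section TorExt.
Variable R : nzRingType.
Implicit Types (N L Y K : lmodType R^c) (X F Q : lmodType R).

(** Exactness of Tor_1(Y, X') -> Tor_1(Y, Q) -> Tor_1(Y, X). *)
Lemma tor1_ext Y X' Q X (f : {linear X' -> Q}) (g : {linear Q -> X}) :
  ses f g -> tor1 Y X' -> tor1 Y X -> tor1 Y Q.
Proof.
move=> fg /tor1P/(_ _ _ _ _ (ses_cover Y)) YX' /tor1P/(_ _ _ _ _ (ses_cover Y)) YX.
have flL := @cover_rflat _ Y.
apply: (tor1_of_rflat (ses_cover Y) flL); apply: zinj => t t0.
have [s st] : exists s, tr _ f s = t.
  apply: (tr_exact (ses_surj fg) (ses_ker fg)); apply: (zinj0 YX).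
  by rewrite tlr t0 raddf0.
rewrite -st (_ : s = 0) ?raddf0 //; apply: (zinj0 YX').
by apply: (zinj0 (flL _ _ _ (ses_inj fg))); rewrite -tlr st.
Qed.

(** Flat dimension < n + 1 in terms of Tor, hence finite resolutions by flat
    modules, hence no Ext^1 from Ding projectives. *)
Lemma dp_orth_torn n X : (forall Y, torn n Y X) -> dp_orth X.
Proof.
elim: n X => [|n IHn] X XY; first exact/dp_orth_flat/tor1_flat.
apply: (dp_orth_quot (ses_cover X)); last exact/dp_orth_flat/free_flat.
by apply: IHn => Y; apply/(tornS n Y (ses_cover X) (@free_flat _ _)).
Qed.

(** Exact sequences of modules with vanishing Tor against Y stay exact under
    Y (x) - once Y has finite flat dimension: go far enough to the right. *)
Lemma tor1_coresolved n Y (G : lmodType R -> Prop) :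
  dim_lt (@flat R^c) n Y ->
  (forall Z, G Z -> exists (Q Z' : lmodType R) (f : {linear Z -> Q}) (g : {linear Q -> Z'}),
    [/\ ses f g, forall j, torn j Y Q & G Z']) ->
  forall Z, G Z -> tor1 Y Z.
Proof.
move=> Yn next; have : forall Z, G Z -> torn n Y Z by move=> Z _; exact: dim_lt_tornl.
elim: n {Yn} => [//|n IHn] GZ; apply: IHn => Z /next[Q [Z' [f [g [fg QY GZ']]]]].
exact: (torn_sub fg (QY n) (GZ _ GZ')).
Qed.
End TorExt.

(** * Tensor products with a bimodule *)

Section TripleTensor.
Variables (R : nzRingType) (M : bimodType R).
Implicit Types (N L Y K : lmodType R^c) (X F Q : lmodType R).

Lemma btensZ X (a : R) (m : M) (x : X) :
  a *: (tens (m : rmod M) x : btensor M X) = tens (a *: m : rmod M) x.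
Proof. exact: btensor_scaleE. Qed.

Lemma btensor_linear X (V : lmodType R) (f : {additive btensor M X -> V}) :
  (forall a (m : M) x, f (tens (a *: m : rmod M) x) = a *: f (tens (m : rmod M) x)) ->
  linear f.
Proof.
move=> fZ a s t; rewrite raddfD; congr (_ + _).
elim/btensor_ind: s => [|u v IHu IHv|m x].
- by rewrite (@scaler0 _ (btensor M X)) !raddf0.
- by rewrite (@scalerBr _ (btensor M X)) !raddfB IHu IHv -scalerBr.
- by rewrite btensZ fZ.
Qed.

Definition btr_additive X Q (f : {linear X -> Q}) :
  {additive btensor M X -> btensor M Q} := tr (rmod M) f.

Fact btr_linear X Q (f : {linear X -> Q}) : linear (btr_additive f).
Proof.
apply: btensor_linear => a m x; rewrite -[LHS]/(tr _ _ _) -[X in _ = _ *: X]/(tr _ _ _).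
by rewrite !trE btensZ.
Qed.

Definition btr X Q (f : {linear X -> Q}) : {linear btensor M X -> btensor M Q} :=
  to_linear (btr_linear f).

Lemma btrE X Q (f : {linear X -> Q}) (m : rmod M) x : btr f (tens m x) = tens m (f x).
Proof. exact: trE. Qed.

Lemma btensor_ext X (A : zmodType) (f g : {additive btensor M X -> A}) :
  (forall (m : rmod M) x, f (tens m x) = g (tens m x)) -> forall t, f t = g t.
Proof. exact: tensor_ext. Qed.

(** N (x)_R M as a right R-module. *)
Definition rbtensor N : Type := tensor N (M : lmodType R).

Section RBTensor.
Variable N : lmodType R^c.
HB.instance Definition _ := GRing.Zmodule.copy (rbtensor N) (tensor N (M : lmodType R)).

Fact rbtensor_scale_balanced (a : R^c) :
  balanced (fun (n : N) (m : M) => tens n (rscale m a)).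
Proof.
split=> [m n n'|n m m'|r n m].
- exact: tensDl.
- by rewrite rscaleDl tensDr.
- by rewrite tensZ rscaleAl.
Qed.

Definition rbtensor_scale (a : R^c) : rbtensor N -> rbtensor N :=
  tlift (rbtensor_scale_balanced a).

Fact rbtensor_scaleE a n m : rbtensor_scale a (tens n m) = tens n (rscale m a).
Proof. exact: tliftE. Qed.

Fact rbtensor_scaleA a b t :
  rbtensor_scale a (rbtensor_scale b t) = rbtensor_scale (a * b) t.
Proof.
apply: (tensor_ext2 (g := tlift (rbtensor_scale_balanced (a * b))) (g' := idfun)) => n m.
by rewrite !tliftE rscaleA.
Qed.

Fact rbtensor_scale1 : left_id 1 rbtensor_scale.
Proof.
move=> t; apply: (tensor_ext (f := tlift (rbtensor_scale_balanced 1)) (g := idfun)) => n m.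
by rewrite tliftE rscale1.
Qed.

Fact rbtensor_scaleDr : right_distributive rbtensor_scale +%R.
Proof. by move=> a s t; exact: raddfD. Qed.

Fact rbtensor_scaleDl t : {morph rbtensor_scale^~ t : a b / a + b}.
Proof.
move=> a b; apply: (tensor_ext (f := tlift (rbtensor_scale_balanced (a + b)))
  (g := tlift (rbtensor_scale_balanced a) \+ tlift (rbtensor_scale_balanced b))) => n m.
by rewrite /= !tensor_liftE ?rscaleDr ?tensDr //; exact: rbtensor_scale_balanced.
Qed.

HB.instance Definition _ := GRing.Zmodule_isLmodule.Build R^c (rbtensor N)
  rbtensor_scaleA rbtensor_scale1 rbtensor_scaleDr rbtensor_scaleDl.
End RBTensor.

Lemma rbtensZ N (a : R^c) (n : N) (m : M) :
  a *: (tens n m : rbtensor N) = tens n (rscale m a).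
Proof. exact: rbtensor_scaleE. Qed.

Lemma rbtensor_ind N (P : rbtensor N -> Prop) :
  P 0 -> (forall s t, P s -> P t -> P (s - t)) ->
  (forall n (m : M), P (tens n m)) -> forall t, P t.
Proof. exact: tensor_ind. Qed.

Lemma rbtensor_linear N (V : lmodType R^c) (f : {additive rbtensor N -> V}) :
  (forall (a : R^c) n (m : M), f (tens n (rscale m a)) = a *: f (tens n m)) -> linear f.
Proof.
move=> fZ a s t; rewrite raddfD; congr (_ + _).
elim/rbtensor_ind: s => [|u v IHu IHv|n m].
- by rewrite (@scaler0 _ (rbtensor N)) !raddf0.
- by rewrite (@scalerBr _ (rbtensor N)) !raddfB IHu IHv -scalerBr.
- by rewrite rbtensZ fZ.
Qed.

Definition rbtl_additive N L (f : {linear N -> L}) :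
  {additive rbtensor N -> rbtensor L} := tl f M.

Fact rbtl_linear N L (f : {linear N -> L}) : linear (rbtl_additive f).
Proof.
apply: rbtensor_linear => a n m; rewrite -[LHS]/(tl _ _ _) -[X in _ = _ *: X]/(tl _ _ _).
by rewrite !tlE rbtensZ.
Qed.

Definition rbtl N L (f : {linear N -> L}) : {linear rbtensor N -> rbtensor L} :=
  to_linear (rbtl_linear f).

(** The isomorphism K (x) (M (x) N) = (K (x) M) (x) N. *)
Section Assoc.
Variables (K : lmodType R^c) (N : lmodType R).

Fact assoc_in_balanced (k : K) :
  balanced (fun (m : rmod M) (n : N) => @tens R (rbtensor K) N (tens k (m : M)) n).
Proof.
split=> [n m m'|m n n'|r m n].
- by rewrite -tensDl -tensDr.
- exact: tensDr.
- by rewrite -tensZ rbtensZ.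
Qed.

Fact assoc_balanced :
  balanced (fun (k : K) (t : btensor M N) => tlift (assoc_in_balanced k) t).
Proof.
split=> [t k k'|k t t'|r k t].
- apply: (tensor_ext (g := tlift (assoc_in_balanced k) \+ tlift (assoc_in_balanced k'))).
  move=> m n; rewrite /= !tensor_liftE; do ?exact: assoc_in_balanced.
  by rewrite -tensDl -tensDl.
- exact: raddfD.
- elim/btensor_ind: t => [|u v IHu IHv|m n].
  + by rewrite scaler0 !raddf0.
  + by rewrite scalerBr !raddfB IHu IHv.
  + by rewrite btensZ !tliftE tensZ.
Qed.

Fact unassoc_in_balanced (n : N) :
  balanced (fun (k : K) (m : M) => tens k (tens (m : rmod M) n : btensor M N)).
Proof.
split=> [m k k'|k m m'|r k m].
- exact: tensDl.
- by rewrite -tensDr; congr tens; exact: tensDl.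
- by rewrite tensZ btensZ.
Qed.

Fact unassoc_balanced :
  balanced (fun (q : rbtensor K) (n : N) => tlift (unassoc_in_balanced n) q).
Proof.
split=> [n q q'|q n n'|r q n].
- exact: raddfD.
- apply: (tensor_ext (g := tlift (unassoc_in_balanced n) \+ tlift (unassoc_in_balanced n'))).
  move=> k m; rewrite /= !tensor_liftE; do ?exact: unassoc_in_balanced.
  by rewrite -tensDr; congr tens; exact: tensDr.
- elim/rbtensor_ind: q => [|u v IHu IHv|k m].
  + by rewrite scaler0 !raddf0.
  + by rewrite scalerBr !raddfB IHu IHv.
  + rewrite rbtensZ !tliftE; congr tens.
    exact: (@tensZ R (rmod M) N r m n).
Qed.

Definition assoc : {additive tensor K (btensor M N) -> tensor (rbtensor K) N} :=
  tlift assoc_balanced.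

Lemma assocE (k : K) (m : rmod M) (n : N) :
  assoc (tens k (tens m n : btensor M N)) = tens (tens k (m : M) : rbtensor K) n.
Proof. by rewrite [LHS]tliftE tliftE. Qed.

Lemma assoc_inj : injective assoc.
Proof.
apply: (can_inj (g := tlift unassoc_balanced)).
apply: (tensor_ext2 (g := idfun) (g' := idfun)) => k t.
have -> : assoc (tens k t) = tlift (assoc_in_balanced k) t by exact: tliftE.
apply: (tensor_ext2 (g := tens_at (btensor M N) k) (g' := idfun)) => m n.
by rewrite !tliftE.
Qed.
End Assoc.

(** (K (x) M) (x) N -> (L (x) M) (x) N stays injective when K (x) M -> L (x) M is and
    N is flat. *)
Lemma tor1_btensor Y (N : lmodType R) : tor1 Y (M : lmodType R) -> flat N -> tor1 Y (btensor M N).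
Proof.
move=> /tor1P/(_ _ _ _ _ (ses_cover Y)) YM flN.
apply: (tor1_of_rflat (ses_cover Y)); first exact: cover_rflat.
have YM' : injective (rbtl (kincl (cover Y))) by exact: YM.
apply: zinj => t t0; apply: (zinj0 (assoc_inj (N := N))).
apply: (zinj0 (flN _ _ _ YM')); rewrite -[RHS](raddf0 (assoc _ N)) -t0.
apply: (tensor_ext2 (f' := tl (rbtl (kincl (cover Y))) N)) => k s.
rewrite tlE; apply: (tensor_ext2
  (f := assoc _ N \o tens_at (btensor M N) k) (f' := tl (rbtl (kincl (cover Y))) N)
  (g := tens_at (btensor M N) (kincl (cover Y) k)) (g' := assoc _ N)) => m n.
rewrite -[X in tl _ _ X]/(assoc _ N (tens k (tens m n : btensor M N))) assocE tlE.
by rewrite [RHS]assocE; congr tens; exact: tlE.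
Qed.

(** Flat dimension does not increase from M to M (x) N when N is flat. *)
Lemma dp_orth_btensor n (N : lmodType R) : dim_lt (@flat R) n (M : lmodType R) -> flat N ->
  (forall Y, torn n Y (btensor M N)) /\ dp_orth (btensor M N).
Proof.
move=> Mn flN; have YN Y : torn n Y (btensor M N).
  by apply: tor1_btensor => //; exact: dim_lt_tornr.
by split=> //; exact: dp_orth_torn YN.
Qed.
End TripleTensor.

(** * Left modules over the trivial extension *)

Section LeftModules.
Variables (R : nzRingType) (M : bimodType R).
Local Notation T := (trivext M).
Implicit Types (W F : lmodType T) (X Y N : lmodType R).

Lemma trivext_split (s : T) : s = triv_inl M s.1 + triv_inr s.2.
Proof. by case: s => a m; congr pair; rewrite /= ?addr0 ?add0r. Qed.

Lemma rscale0r (m : M) : rscale m 0 = 0.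
Proof. by apply: (addrI (rscale m 0)); rewrite -rscaleDr !addr0. Qed.

Lemma triv_inr_inr (m m' : M) : triv_inr m * triv_inr m' = 0.
Proof. by congr pair; rewrite /= ?mul0r // scale0r rscale0r addr0. Qed.

Lemma trivext_scale W (s : T) (w : W) :
  s *: w = triv_inl M s.1 *: w + triv_inr s.2 *: w.
Proof. by rewrite -scalerDl -trivext_split. Qed.

Lemma lactionD W m (w w' : lbase W) : laction m (w + w') = laction m w + laction m w'.
Proof. exact: (scalerDr _ (w : W)). Qed.

Lemma lactionB W m (w w' : lbase W) : laction m (w - w') = laction m w - laction m w'.
Proof. exact: (scalerBr _ (w : W)). Qed.

Lemma laction_laction W m m' (w : lbase W) : laction m (laction m' w) = 0.
Proof. by rewrite /laction (scalerA _ _ (w : W)) triv_inr_inr (scale0r (w : W)). Qed.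

Definition lb W W' (f : {linear W -> W'}) : {linear lbase W -> lbase W'} :=
  restr_map (triv_inl M) f.

Lemma lb_act W W' (f : {linear W -> W'}) m w :
  lb f (laction m w) = laction m (lb f w).
Proof. exact: (linearZZ f). Qed.

Definition act W : {linear btensor M (lbase W) -> lbase W} := @lpair_map R M W.

Lemma actE W (m : rmod M) (w : lbase W) : act W (tens m w) = laction m w.
Proof. exact: lpair_map_tens. Qed.

Lemma lb_lact W W' (f : {linear W -> W'}) t : lb f (act W t) = act W' (btr M (lb f) t).
Proof.
apply: (btensor_ext (f := lb f \o act W) (g := act W' \o btr M (lb f))) => m w.
rewrite -[LHS]/(lb f (act W (tens m w))) -[RHS]/(act W' (btr M (lb f) (tens m w))).
by rewrite btrE !actE lb_act.
Qed.
Arguments act : simpl never.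

(** Additively T = R + M, so T-linear means R-linear and compatible with M. *)
Lemma linear_of_lb W W' (h : {linear lbase W -> lbase W'}) :
  (forall m w, h (laction m w) = laction m (h w)) -> linear (h : W -> W').
Proof.
move=> hm s x y; rewrite trivext_scale [RHS in _ = RHS + _]trivext_scale.
have hD (u v : W) : h (u + v) = (h u : W') + h v by exact: (linearD h).
rewrite !hD; congr (_ + _ + _); [exact: (linearZZ h s.1 x) | exact: hm].
Qed.

(** R-modules as modules over the trivial extension on which M acts as zero. *)
Definition triv_pr (s : T) : R := s.1.
Fact triv_pr_zmod : zmod_morphism triv_pr. Proof. by []. Qed.
Fact triv_pr_monoid : monoid_morphism triv_pr. Proof. by []. Qed.
HB.instance Definition _ := GRing.isZmodMorphism.Build T R triv_pr triv_pr_zmod.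
HB.instance Definition _ := GRing.isMonoidMorphism.Build T R triv_pr triv_pr_monoid.

Definition triv X : lmodType T := restr triv_pr X.

Fact to_triv_linear X : linear (id : X -> lbase (triv X)).
Proof. by []. Qed.
Definition to_triv X : {linear X -> lbase (triv X)} := to_linear (@to_triv_linear X).

Lemma triv_act X m (x : lbase (triv X)) : laction m x = 0.
Proof. exact: (scale0r (x : X)). Qed.

Lemma linear_to_triv W X (h : {linear lbase W -> X}) :
  (forall m w, h (laction m w) = 0) -> linear (h : W -> triv X).
Proof.
move=> h0; apply: (@linear_of_lb W (triv X) (to_triv X \o h)) => m w.
by rewrite triv_act; exact: h0.
Qed.

Lemma linear_of_triv W X (h : {linear X -> lbase W}) :
  (forall m x, laction m (h x) = 0) -> linear (h : triv X -> W).
Proof.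
move=> h0 s x y; rewrite [X in _ = X + _]trivext_scale.
have -> : triv_inr s.2 *: (h x : W) = 0 by exact: h0.
rewrite addr0; exact: (linearP h s.1 x y).
Qed.

(** The induced module T (x)_R X, as X + M (x)_R X. *)
Definition ind X : Type := (X * btensor M X)%type.

Section Ind.
Variable X : lmodType R.
HB.instance Definition _ := GRing.Zmodule.copy (ind X) (X * btensor M X)%type.

Definition ind_scale (s : T) (p : ind X) : ind X :=
  (s.1 *: p.1, s.1 *: p.2 + (tens (s.2 : rmod M) p.1 : btensor M X)).

Fact ind_scaleA a b v : ind_scale a (ind_scale b v) = ind_scale (a * b) v.
Proof.
case: a b v => [a m] [b n] [x t]; congr pair; rewrite /= ?scalerA //.
rewrite scalerDr scalerA -addrA btensZ; congr (_ + _).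
by rewrite -tensZ -tensDl.
Qed.
Fact ind_scale1 : left_id 1 ind_scale.
Proof. by case=> x t; congr pair; rewrite /= scale1r // tens0l addr0. Qed.
Fact ind_scaleDr : right_distributive ind_scale +%R.
Proof.
move=> s [x t] [x' t']; congr pair; rewrite /= scalerDr //.
by rewrite tensDr addrACA.
Qed.
Fact ind_scaleDl v : {morph ind_scale^~ v : a b / a + b}.
Proof.
move=> a b; congr pair; rewrite /= scalerDl //.
by rewrite (tensDl (a.2 : rmod M)) addrACA.
Qed.
HB.instance Definition _ := GRing.Zmodule_isLmodule.Build T (ind X)
  ind_scaleA ind_scale1 ind_scaleDr ind_scaleDl.
End Ind.

Lemma ind_act X (m : rmod M) (p : lbase (ind X)) :
  laction m p = (0, tens m p.1 : btensor M X).
Proof.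
rewrite /laction -[LHS]/(ind_scale _ _) /ind_scale /=.
by rewrite !scale0r add0r.
Qed.

Lemma ind_lscale X a (p : lbase (ind X)) : a *: p = (a *: p.1, a *: p.2).
Proof.
rewrite -[LHS]/(ind_scale (triv_inl M a) p) /ind_scale /=; congr pair.
by rewrite -[X in _ + X]/(tens (0 : rmod M) p.1) tens0l addr0.
Qed.

Fact ind_in_linear X : linear (fun x : X => (x, 0) : lbase (ind X)).
Proof. by move=> a x y; rewrite ind_lscale; congr pair; rewrite /= raddf0 addr0. Qed.
Definition ind_in X : {linear X -> lbase (ind X)} := to_linear (@ind_in_linear X).

Fact ind_out_linear X : linear (fun p : lbase (ind X) => p.1).
Proof. by []. Qed.
Definition ind_out X : {linear lbase (ind X) -> X} := to_linear (@ind_out_linear X).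

Fact ind_snd_linear X : linear (fun p : lbase (ind X) => p.2).
Proof. by move=> a x y; rewrite ind_lscale. Qed.
Definition ind_snd X : {linear lbase (ind X) -> btensor M X} := to_linear (@ind_snd_linear X).

Lemma lact_act W m (t : btensor M (lbase W)) : laction m (act W t) = 0.
Proof.
pose la : {additive lbase W -> lbase W} :=
  to_additive (@lactionB W m).
apply: (btensor_ext (f := la \o act W) (g := \0)) => m' w.
by rewrite -[LHS]/(laction m (act W (tens m' w))) actE laction_laction.
Qed.

Definition ind_adj_lb W X (e : {linear X -> lbase W}) : {linear lbase (ind X) -> lbase W} :=
  (e \o ind_out X) \+ (act W \o (btr M e \o ind_snd X)).

Fact ind_adj_linear W X (e : {linear X -> lbase W}) : linear (ind_adj_lb e : ind X -> W).
Proof.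
have E p : ind_adj_lb e p = e p.1 + act W (btr M e p.2) by [].
apply: linear_of_lb => m p; rewrite ind_act !E lactionD lact_act addr0.
rewrite -[LHS]/(e 0 + act W (btr M e (tens m p.1))).
by rewrite linear0 add0r btrE actE.
Qed.
(** Frobenius reciprocity: the T-linear extension of e. *)
Definition ind_adj W X (e : {linear X -> lbase W}) : {linear ind X -> W} :=
  to_linear (ind_adj_linear e).

Lemma ind_adjE W X (e : {linear X -> lbase W}) p :
  ind_adj e p = e p.1 + act W (btr M e p.2).
Proof. by []. Qed.

Lemma ind_adj_pair W X (e : {linear X -> lbase W}) x t :
  ind_adj e (x, t) = e x + act W (btr M e t).
Proof. by []. Qed.

Lemma ind_adj_in W X (e : {linear X -> lbase W}) x : ind_adj e (x, 0) = e x.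
Proof. by rewrite ind_adjE !linear0 addr0. Qed.

Lemma act_ind X (t : btensor M (lbase (ind X))) :
  act (ind X) t = (0, btr M (ind_out X) t).
Proof.
have b0 : zmod_morphism (fun t : btensor M X => (0, t) : lbase (ind X)).
  by move=> u v; congr pair; rewrite subr0.
pose in2 : {additive btensor M X -> lbase (ind X)} :=
  to_additive b0.
apply: (btensor_ext (f := act (ind X)) (g := in2 \o btr M (ind_out X))) => m p.
rewrite -[LHS]/(act (ind X) (tens m p)) actE ind_act -[RHS]/(0, btr M (ind_out X) (tens m p)) btrE.
by [].
Qed.

Lemma ind_ext W X (f g : {linear ind X -> W}) :
  (forall x, f (x, 0) = g (x, 0)) -> forall p, f p = g p.
Proof.
move=> fg p.
have h2 t : f (0, t) = g (0, t).
  elim/btensor_ind: t => [|u v IHu IHv|m x].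
  - exact: fg.
  - have -> : (0, u - v) = (0, u) - (0, v) :> ind X by congr pair; rewrite subr0.
    by rewrite !linearB IHu IHv.
  - have -> : (0, tens m x : btensor M X) = triv_inr (m : M) *: ((x, 0) : ind X).
      by rewrite -[RHS]/(laction m ((x, 0) : lbase (ind X))) ind_act.
    by rewrite !linearZ fg.
have -> : p = (p.1, 0) + (0, p.2) by case: p => x t; congr pair; rewrite ?addr0 ?add0r.
by rewrite !linearD fg h2.
Qed.

(** Induction is left adjoint to restriction, which preserves surjections. *)
Lemma ind_proj X : projective X -> projective (ind X : lmodType T).
Proof.
move=> Xpr A B g h gS.
have [k kP] := Xpr _ _ (lb g) (lb h \o ind_in X) gS.
exists (ind_adj k) => p; apply: (ind_ext (f := h) (g := g \o ind_adj k)) => x.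
by rewrite -[RHS]/(g (ind_adj k (x, 0))) ind_adj_in -kP.
Qed.

(** The data of [Phi]: p is a cokernel of the action M (x)_R W -> W. *)
Record coker_act W X (p : {linear lbase W -> X}) : Prop := CokerAct {
  coker_surj : surj p;
  coker_exact : exact_at (act W) p }.

Lemma coker_laction W X (p : {linear lbase W -> X}) m w :
  coker_act p -> p (laction m w) = 0.
Proof. by case=> _ ex; apply/ex; exists (tens m w); exact: actE. Qed.

Lemma coker_cproj W : coker_act (cproj (act W)).
Proof. by split; [exact: cproj_surj | exact: cprojP]. Qed.

(** A T-linear map to a module killed by M factors through W / MW. *)
Lemma triv_factor W X (p : {linear lbase W -> X}) Y (k : {linear W -> triv Y}) :
  coker_act p -> exists k1 : {linear X -> Y}, forall w, k w = k1 (p w).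
Proof.
move=> cp; apply: (lin_factor (h := (lb k : {linear lbase W -> Y})) (coker_surj cp)).
move=> w /(coker_exact cp)[t <-]; rewrite lb_lact.
apply: (btensor_ext (f := act (triv Y) \o btr M (lb k)) (g := \0)) => m v.
rewrite -[LHS]/(act (triv Y) (btr M (lb k) (tens m v))) btrE actE.
exact: triv_act.
Qed.

Lemma ind_coker X : coker_act (ind_out X).
Proof.
split=> [x|p]; first by exists (x, 0).
split=> [p0|[t <-]]; last by rewrite act_ind.
have [t tp] : exists t, btr M (ind_out X) t = p.2.
  by apply: tr_surj => x; exists (x, 0).
by exists t; rewrite act_ind tp -[0]p0; case: p {tp p0}.
Qed.

Lemma act_ind_inj_base X (t : btensor M (lbase (ind X))) :
  act (ind X) t = 0 -> btr M (ind_out X) t = 0.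
Proof. by rewrite act_ind => -[]. Qed.
End LeftModules.

(** * The action of a bimodule with M (x) M = 0 *)

Section ConversePr.
Variables (R : nzRingType) (M : bimodType R).
Definition triv_prc (s : (trivext M)^c) : R^c := (s : trivext M).1.
Fact triv_prc_zmod : zmod_morphism triv_prc. Proof. by []. Qed.
Fact triv_prc_monoid : monoid_morphism triv_prc. Proof. by []. Qed.
HB.instance Definition _ :=
  GRing.isZmodMorphism.Build (trivext M)^c R^c triv_prc triv_prc_zmod.
HB.instance Definition _ :=
  GRing.isMonoidMorphism.Build (trivext M)^c R^c triv_prc triv_prc_monoid.

Definition rtriv (N : lmodType R^c) : lmodType (trivext M)^c := restr triv_prc N.
Definition rtriv_map (N N' : lmodType R^c) (a : {linear N -> N'}) :
  {linear rtriv N -> rtriv N'} :=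
  restr_map (triv_prc : {rmorphism (trivext M)^c -> R^c}) a.
End ConversePr.

Section SquareZero.
Variables (R : nzRingType) (M : bimodType R).
Hypothesis MM0 : forall t : btensor M M, t = 0.
Local Notation T := (trivext M).
Implicit Types (W F : lmodType T) (X Y : lmodType R) (N L : lmodType R^c).

(** The element is the image of m (x) m' under the map M (x) M -> M (x) W given
    by the action on w. *)
Lemma tens_laction W (m m' : rmod M) (w : lbase W) : tens m (laction m' w) = 0.
Proof.
have b : balanced (fun (m : rmod M) (m' : M) => tens m (laction (m' : rmod M) w)).
  have [Dl Dr Z] := laction_balanced W.
  split=> [n k k'|k n n'|r k n]; first exact: tensDl.
    by rewrite -tensDr; congr tens; exact: Dl.
  rewrite tensZ; congr tens.
  rewrite -[LHS]/(triv_inl M r *: (triv_inr n *: (w : W))) (scalerA _ _ (w : W)).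
  by rewrite triv_inrZl.
rewrite -[LHS](tliftE b m (m' : M)); move: (tens m _) => t.
by rewrite (MM0 t : t = 0) raddf0.
Qed.

Lemma tens_act W (m : rmod M) t : tens m (act W t) = 0.
Proof.
apply: (btensor_ext (f := tens_at (lbase W) m \o act W) (g := \0)) => m' w.
by rewrite -[LHS]/(tens m (act W (tens m' w))) actE tens_laction.
Qed.

(** M (x) W -> M (x) (W / MW) is an isomorphism, the image of M (x) MW in
    M (x) W being zero. *)
Lemma btr_coker_inj W X (p : {linear lbase W -> X}) :
  coker_act p -> injective (btr M p).
Proof.
move=> [pS pex]; apply: ker0_inj.
apply: (tmap_ker (g := idfun) (f := p)) => //.
- by move=> x; exists x.
- by move=> s t -> ->; rewrite subr0.
- by move=> m w /= ->; rewrite tens0l.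
- by move=> m w /pex[t <-]; exact: tens_act.
Qed.

Lemma btr_surj X Y (f : {linear X -> Y}) : surj f -> surj (btr M f).
Proof. by move=> fS; exact: tr_surj. Qed.

(** The action identifies MW with M (x) W = M (x) (W / MW). *)
Lemma coker_ses W X (p : {linear lbase W -> X}) :
  coker_act p -> injective (act W) ->
  exists j : {linear btensor M X -> lbase W},
    (forall t, j (btr M p t) = act W t) /\ ses j p.
Proof.
move=> cp uI; have pI := btr_coker_inj cp; case: cp => pS pex.
have pMS := btr_surj pS.
have [j jP] : exists j : {linear btensor M X -> lbase W},
    forall t, act W t = j (btr M p t).
  by apply: lin_factor => // t /(inj_ker0 pI) ->; rewrite linear0.
exists j; split=> //; split=> // [|w].
  apply: ker0_inj => s; have [t <-] := pMS s.
  by rewrite -jP => /(inj_ker0 uI) ->; rewrite linear0.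
rewrite pex; split=> [[t <-]|[s <-]]; first by exists (btr M p t); rewrite jP.
by have [t <-] := pMS s; exists t; rewrite jP.
Qed.

Lemma ind_act_inj X : injective (act (ind M X)).
Proof.
by apply: ker0_inj => t /act_ind_inj_base/(inj_ker0 (btr_coker_inj (ind_coker M X))).
Qed.

(** * Flat modules over the trivial extension *)

Section Base.
Variable F : lmodType T.

Fact triv_tens_balanced N :
  balanced (fun (n : N) (w : lbase F) => @tens T (rtriv M N) F n w).
Proof.
split=> [w n n'|n w w'|r n w].
- exact: (@tensDl T (rtriv M N) F).
- exact: (@tensDr T (rtriv M N) F).
- exact: (@tensZ T (rtriv M N) F (triv_inl M r) n w).
Qed.

(** Over T, a module N killed by M does not see MF: the kernel of this
    surjection is generated by N (x) MF, as the next lemmas make precise. *)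
Definition triv_tens N : {additive tensor N (lbase F) -> tensor (rtriv M N) F} :=
  tlift (triv_tens_balanced N).

Lemma triv_tensE N n w : triv_tens N (tens n w) = @tens T (rtriv M N) F n w.
Proof. exact: tliftE. Qed.

(** A map out of N (x)_R F descends to N (x)_T F once it kills the action of M. *)
Lemma triv_tens_back N X (p : {linear lbase F -> X}) :
  (forall (n : N) m w, tens n (p (laction m w)) = 0) ->
  exists q : {additive tensor (rtriv M N) F -> tensor N X},
    forall t, q (triv_tens N t) = tr N p t.
Proof.
move=> p0; have b : balanced (fun (n : rtriv M N) (w : F) => tens (n : N) (p w)).
  split=> [w n n'|n w w'|s n w]; first exact: tensDl.
    by rewrite -tensDr; congr tens; exact: (linearD p).
  rewrite trivext_scale.
  have -> : p (triv_inl M s.1 *: w + triv_inr s.2 *: w) =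
      s.1 *: p w + p (laction s.2 w).
    rewrite -(linearZZ p); exact: (linearD p).
  by rewrite tensDr p0 addr0 -tensZ.
exists (tlift b) => t; apply: (tensor_ext2 (g := tr N p) (g' := idfun)) => n w.
by rewrite triv_tensE tliftE trE.
Qed.

Lemma triv_tens_act N (t : tensor N (btensor M (lbase F))) :
  triv_tens N (tr N (act F) t) = 0.
Proof.
apply: (tensor_ext2 (g := \0) (g' := idfun)) => n s.
rewrite trE triv_tensE.
pose h := tens_at F (n : rtriv M N).
apply: (btensor_ext (f := h \o act F) (g := \0)) => m w.
rewrite -[LHS]/(tens (n : rtriv M N) (act F (tens m w) : F)) actE.
rewrite -[LHS](@tensZ T (rtriv M N) F (triv_inr m) n w).
have -> : (triv_inr m : T^c) *: (n : rtriv M N) = 0 by exact: (scale0r n).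
exact: tens0l.
Qed.

(** Tensoring M -> T with F makes M (x)_T F -> F injective, and M (x)_T F is M
    (x)_R F because M (x)_R MF vanishes there. *)
Lemma flat_act_inj : flat F -> injective (act F).
Proof.
move=> flF.
have incl_lin : linear (fun m : rtriv M (rmod M) => triv_inr (m : M) : T^c^o).
  move=> s m n; rewrite triv_inrD; congr (_ + _).
  rewrite -[RHS]/(triv_inr (m : M) * (s : T)).
  rewrite [s]trivext_split mulrDr triv_inr_inr addr0 triv_inrZr.
  congr triv_inr; rewrite -[LHS]/(rscale (m : M) (triv_inl M s.1 + triv_inr s.2 : T).1).
  by rewrite /= addr0.
pose incl := to_linear incl_lin.
have inclI : injective incl by move=> m n [].
have evb : balanced (fun (s : T^c^o) (w : F) => (s : T) *: w).
  split=> [w s s'|s w w'|r s w]; first exact: scalerDl.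
    exact: scalerDr.
  by rewrite scalerA.
have evI : injective (tlift evb).
  apply: (can_inj (g := tens_at F (1 : T^c^o))); apply: (tensor_ext2 (g := idfun) (g' := idfun)) => s w.
  rewrite tliftE -[LHS]/(tens (1 : T^c^o) ((s : T) *: w)) -tensZ.
  by congr tens; exact: (mul1r (s : T)).
apply: ker0_inj => t t0.
have [q qP] := @triv_tens_back (rmod M) _ (idfun : {linear lbase F -> lbase F})
  (@tens_laction F).
have h : triv_tens (rmod M) t = 0.
  apply: (zinj0 (flF _ _ _ inclI)); apply: (zinj0 evI).
  rewrite -t0 -[RHS]/((act F : {additive btensor M (lbase F) -> lbase F}) t).
  apply: (btensor_ext (f := tlift evb \o (tl incl F \o triv_tens (rmod M)))
    (g := act F)) => m w.
  rewrite -[RHS]/(act F (tens m w)) actE -[LHS]/(tlift evb (tl incl F (triv_tens (rmod M) (tens m w)))).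
  by rewrite triv_tensE tlE tliftE.
by rewrite -[t]tmap_id -[LHS]/(tr _ _ _) -qP h raddf0.
Qed.

(** For N killed by M, the functors N (x)_T F and N (x)_R (F / MF) agree. *)
Lemma flat_coker X (p : {linear lbase F -> X}) : flat F -> coker_act p -> flat X.
Proof.
move=> flF cp N N' a aI; apply: (zinj (f := tl a X)) => t t0.
have [pS pex] := cp.
have p0 (K : lmodType R^c) (k : K) m w : tens k (p (laction m w)) = 0 :> tensor K X.
  by rewrite (coker_laction m w cp) tens0r.
have [q qP] := triv_tens_back (p0 N).
have [s st] := tr_surj N pS t.
have aI' : injective (rtriv_map M a) by exact: aI.
have [v vs] : exists v, tr N' (act F) v = tl a (lbase F) s.
  apply: (tr_exact pS) => [w /pex//|]; by rewrite -tlr st t0.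
rewrite -st -qP; rewrite (_ : triv_tens N s = 0) ?raddf0 //.
apply: (zinj0 (flF _ _ _ aI')).
transitivity (triv_tens N' (tl a (lbase F) s)); last by rewrite -vs triv_tens_act.
apply: (tensor_ext2 (f := triv_tens N) (f' := tl (rtriv_map M a) F)) => n w.
by rewrite triv_tensE !tlE triv_tensE.
Qed.
End Base.
End SquareZero.

(** * Flatness of induced modules *)

Section Retract.
Variable S : nzRingType.

Lemma ext1_retract (Z N N' : lmodType S) (i : {linear N -> N'}) (r : {linear N' -> N}) :
  (forall x, r (i x) = x) -> ext1 Z N' -> ext1 Z N.
Proof.
move=> ri ZN' A B f g fg h; have [k kP] := ZN' _ _ _ _ fg (i \o h).
by exists (r \o k) => a; rewrite /= -kP /= ri.
Qed.
End Retract.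

Section IndFlat.
Variables (R : nzRingType) (M : bimodType R).
Local Notation T := (trivext M).

Section Right.
Variable Y : lmodType T^c.

Lemma ractionD (y y' : rbase Y) (m : rmod M) :
  raction (y + y') m = raction y m + raction y' m.
Proof. exact: (scalerDr _ (y : Y)). Qed.

Lemma raction_scale (s : T^c) (y : Y) (m : rmod M) :
  raction (s *: y : rbase Y) m = raction (y : rbase Y) ((s : T).1 *: (m : M)).
Proof.
rewrite /raction scalerA; congr (_ *: y).
rewrite -[LHS]/((s : T) * triv_inr (m : M)) [s in LHS]trivext_split mulrDl.
by rewrite triv_inr_inr addr0 triv_inrZl.
Qed.

Lemma trivextc_scale (s : T^c) (y : Y) :
  s *: y = (triv_inlc M (s : T).1 *: y) + raction (y : rbase Y) ((s : T).2 : rmod M).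
Proof. by rewrite -scalerDl -trivext_split. Qed.

Variable N : lmodType R.

Fact raction_tens_balanced (y : rbase Y) :
  balanced (fun (m : rmod M) (x : N) => tens (raction y m) x).
Proof.
split=> [x m m'|m x x'|r m x].
- by rewrite -tensDl; congr tens; have := raction_linear y 1 m m'; rewrite !scale1r.
- exact: tensDr.
- rewrite -tensZ; congr tens.
  by have := raction_linear y r m 0; rewrite !addr0 => ->; rewrite [raction y 0](scale0r (y : Y)) addr0.
Qed.

Definition raction_tens (y : rbase Y) : {additive btensor M N -> tensor (rbase Y) N} :=
  tlift (raction_tens_balanced y).

Lemma raction_tensE y (m : rmod M) (x : N) :
  raction_tens y (tens m x) = tens (raction y m) x.
Proof. exact: tliftE. Qed.

(** The map Y (x)_T (T (x)_R N) -> Y (x)_R N, sending y (x) (n + m (x) n') to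
    y (x) n + ym (x) n'. *)
Fact ind_tens_balanced :
  balanced (fun (y : Y) (p : ind M N) => tens (y : rbase Y) p.1 + raction_tens y p.2).
Proof.
split=> [p y y'|y p p'|s y p].
- have -> : raction_tens (y + y') p.2 = raction_tens y p.2 + raction_tens y' p.2.
    apply: (btensor_ext (f := raction_tens (y + y'))
      (g := raction_tens y \+ raction_tens y')) => m x.
    rewrite raction_tensE ractionD tensDl.
    by rewrite -[RHS]/(raction_tens y (tens m x) + raction_tens y' (tens m x)) !raction_tensE.
  by rewrite (tensDl (y : rbase Y)) addrACA.
- by rewrite tensDr raddfD addrACA.
- have -> : raction_tens ((s : T^c) *: y : rbase Y) p.2 = raction_tens y (s.1 *: p.2).
    have scB : zmod_morphism (fun t : btensor M N => s.1 *: t) by exact: scalerBr.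
    pose sc : {additive btensor M N -> btensor M N} :=
      to_additive scB.
    apply: (btensor_ext (f := raction_tens ((s : T^c) *: y : rbase Y))
      (g := raction_tens y \o sc)) => m x.
    rewrite raction_tensE -[RHS]/(raction_tens y (s.1 *: (tens m x : btensor M N))).
    by rewrite btensZ raction_tensE raction_scale.
  rewrite -[(s *: p).1]/(s.1 *: p.1).
  rewrite -[(s *: p).2]/(s.1 *: p.2 + tens (s.2 : rmod M) p.1).
  have -> : tens ((s : T^c) *: y : rbase Y) p.1 =
      tens (y : rbase Y) (s.1 *: p.1) + tens (raction (y : rbase Y) s.2) p.1.
    by rewrite -(@tensZ R (rbase Y)) -tensDl; congr tens; exact: trivextc_scale.
  by rewrite raddfD raction_tensE addrAC addrA.
Qed.

Definition ind_tens : {additive tensor Y (ind M N : lmodType T) -> tensor (rbase Y) N} :=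
  tlift ind_tens_balanced.

Lemma ind_tensE y (p : ind M N) :
  ind_tens (tens y p) = tens (y : rbase Y) p.1 + raction_tens y p.2.
Proof. exact: tliftE. Qed.

Fact ind_tens_back_balanced :
  balanced (fun (y : rbase Y) (x : N) => tens (y : Y) ((x, 0) : ind M N)).
Proof.
split=> [x y y'|y x x'|r y x].
- exact: (@tensDl T Y).
- rewrite -(@tensDr T Y); congr tens; congr pair; exact/esym/addr0.
- rewrite [LHS](@tensZ T Y _ (triv_inl M r)); congr tens.
  rewrite -[LHS]/(r *: ((x, 0) : lbase (ind M N))) ind_lscale.
  by congr pair; exact: scaler0.
Qed.

Lemma ind_tens_inj : injective ind_tens.
Proof.
apply: (can_inj (g := tlift ind_tens_back_balanced)).
apply: (tensor_ext2 (g := idfun) (g' := idfun)) => y p; rewrite ind_tensE raddfD.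
have -> : tlift ind_tens_back_balanced (raction_tens y p.2) = tens y ((0, p.2) : ind M N).
  have bB : zmod_morphism (fun t : btensor M N => tens y ((0, t) : ind M N)).
    by move=> u v; rewrite -(@tensBr T Y); congr tens; congr pair; exact/esym/subr0.
  pose bt : {additive btensor M N -> tensor Y (ind M N : lmodType T)} := to_additive bB.
  apply: (btensor_ext (f := tlift ind_tens_back_balanced \o raction_tens y) (g := bt)) => m x.
  rewrite -[LHS]/(tlift ind_tens_back_balanced (raction_tens y (tens m x))).
  rewrite raction_tensE tliftE [LHS](@tensZ T Y _ (triv_inr (m : M))).
  rewrite -[RHS]/(tens y ((0, tens m x) : ind M N)); congr tens.
  exact: (@ind_act R M N m (x, 0)).
rewrite tliftE -(@tensDr T Y); congr tens.
by case: p => x t; congr pair; rewrite /= ?addr0 ?add0r.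
Qed.
End Right.

(** Induction turns Y (x)_T - into Y (x)_R -. *)
Lemma ind_flat N : flat N -> flat (ind M N : lmodType T).
Proof.
move=> flN Y Y' a aI; apply: (zinj (f := tl a _)) => t t0.
pose a' : {linear rbase Y -> rbase Y'} :=
  restr_map (@triv_inlc R M : {rmorphism R^c -> T^c}) a.
apply: (zinj0 (@ind_tens_inj Y N)); apply: (zinj0 (flN _ _ a' aI)).
rewrite -[RHS](raddf0 (ind_tens Y' N)) -t0.
apply: (tensor_ext2 (f' := tl a' N)) => y p; rewrite tlE !ind_tensE raddfD tlE.
congr (_ + _).
apply: (btensor_ext (f := tl a' N \o raction_tens N (y : rbase Y))
  (g := raction_tens N (a y : rbase Y'))) => m x.
rewrite -[LHS]/(tl a' N (raction_tens N (y : rbase Y) (tens m x))).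
rewrite -[RHS]/(raction_tens N (a y : rbase Y') (tens m x)).
rewrite !raction_tensE tlE; congr tens; exact: (linearZZ a).
Qed.
End IndFlat.

(** * Ding projective modules over the trivial extension *)

Section DingProjectives.
Variables (R : nzRingType) (M : bimodType R).
Hypothesis MM0 : forall t : btensor M M, t = 0.
Local Notation T := (trivext M).
Implicit Types (W F : lmodType T) (X Y Z N : lmodType R).

(** The action of M on the module induced by X is the inclusion of M (x) X, to
    which the vanishing of M (x) MW applies. *)
Lemma btensor2_eq0 X (t : btensor M (btensor M X)) : t = 0.
Proof.
apply: (btensor_ext (f := idfun) (g := \0)) => m s.
rewrite -[LHS]/(tens m s) -[RHS]/(0 : btensor M (btensor M X)).
apply: (btensor_ext (f := tens_at (btensor M X) m) (g := \0)) => m' x.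
rewrite -[LHS]/(tens m (tens m' x : btensor M X)) -[RHS]/(0 : btensor M (btensor M X)).
have := congr1 (tr (rmod M) (ind_snd M X)) (tens_laction MM0 m m' ((x, 0) : lbase (ind M X))).
by rewrite trE ind_act raddf0.
Qed.

Section IndMap.
Variables (X Y : lmodType R) (f : {linear X -> Y}).

Definition ind_map : {linear ind M X -> ind M Y} := ind_adj (ind_in M Y \o f).

Lemma ind_mapE p : ind_map p = (f p.1, btr M f p.2).
Proof.
rewrite /ind_map ind_adjE act_ind.
have -> : btr M (ind_out M Y) (btr M (ind_in M Y \o f) p.2) = btr M f p.2.
  exact: tr_comp.
by congr pair; rewrite /= ?addr0 ?add0r.
Qed.
End IndMap.

Lemma ses_ind_map X Y Z (f : {linear X -> Y}) (g : {linear Y -> Z}) :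
  ses f g -> tor1 (rmod M) Z -> ses (ind_map f) (ind_map g).
Proof.
move=> fg MZ; have fMI : injective (btr M f) by exact: (MZ _ _ _ _ fg).
split.
- apply: ker0_inj => -[x t]; rewrite ind_mapE => -[/(inj_ker0 (ses_inj fg)) -> ].
  by move=> /(inj_ker0 fMI) ->.
- move=> [z t]; have [y yz] := ses_surj fg z.
  have [s st] := tr_surj (rmod M) (ses_surj fg) t.
  by exists (y, s); rewrite ind_mapE /= yz; congr pair.
- move=> [y s]; rewrite ind_mapE; split=> [[y0 s0]|[[x t]]]; last first.
    rewrite ind_mapE => -[<- <-] /=; rewrite (ses_gf fg); congr pair.
    rewrite -[LHS]/(tr _ g (tr _ f t)) (tr_comp (h := \0)); first exact: tr_eq0.
    by move=> w; exact: ses_gf fg w.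
  have [x xy] := ses_ker fg y0.
  have [t ts] := tr_exact (ses_surj fg) (ses_ker fg) s0.
  by exists (x, t); rewrite ind_mapE /= xy; congr pair.
Qed.

(** If Tor_j(M, X) = 0 for all j > 0, induction preserves flat resolutions of X. *)
Lemma ind_orth n X : (forall j, torn j (rmod M) X) -> (forall L : lmodType R^c, torn n L X) ->
  dp_orth (ind M X : lmodType T).
Proof.
elim: n X => [|n IHn] X MX XY; first exact/dp_orth_flat/ind_flat/tor1_flat.
apply: (dp_orth_quot (ses_ind_map (ses_cover X) (MX 0%N))); last first.
  exact/dp_orth_flat/ind_flat/free_flat.
apply: IHn => [j|Y].
  by apply/(tornS j (rmod M) (ses_cover X) (@free_flat _ _)); exact: MX.
by apply/(tornS n Y (ses_cover X) (@free_flat _ _)); exact: XY.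
Qed.

Variables (n n' : nat).
Hypothesis Mn : dim_lt (@flat R) n (M : lmodType R).
Hypothesis Mn' : dim_lt (@flat R^c) n' (rmod M).
Hypothesis MF : forall F : lmodType R, flat F ->
  forall j, torn j (rmod M) (btensor M F).

(** Killed by M, the T-module M (x) N is the one induced by M (x) N, since
    M (x) M (x) N = 0, so that it has finite flat dimension; and N is the quotient
    by M (x) N of the flat module induced by N. *)
Lemma dp_orth_triv N : flat N -> dp_orth (triv M N).
Proof.
move=> flN; set Q : lmodType R := btensor M N.
have QO : dp_orth (triv M Q).
  move=> Z DZ; have [NY _] := dp_orth_btensor Mn flN.
  have i0 m x : laction m (ind_in M Q x) = 0.
    by rewrite ind_act; congr pair; exact: btensor2_eq0.
  have r0 m (w : lbase (ind M Q)) : ind_out M Q (laction m w) = 0 by rewrite ind_act.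
  apply: (@ext1_retract _ _ (triv M Q) (ind M Q) (to_linear (linear_of_triv i0))
    (to_linear (linear_to_triv r0))) => //.
  exact: ind_orth (MF flN) NY _ DZ.
have s0 m (w : btensor M N) : laction m ((0, w) : lbase (ind M N)) = 0.
  by rewrite ind_act; congr pair; exact: tens0r.
have inB : linear (fun t : btensor M N => (0, t) : lbase (ind M N)).
  by move=> a x y; rewrite ind_lscale; congr pair; rewrite /= scaler0 addr0.
have r0 m (w : lbase (ind M N)) : ind_out M N (laction m w) = 0 by rewrite ind_act.
apply: (@dp_orth_quot _ _ _ _ (to_linear (@linear_of_triv _ _ (ind M N) _ (to_linear inB) s0))
    (to_linear (linear_to_triv r0))) => //; last exact/dp_orth_flat/ind_flat.
split=> [x y []|x|[x t]] //=; first by exists (x, 0).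
by split=> [->|[s [<- _]]] //; exists t.
Qed.

(** * Phi of Ding projectives consists of Ding projectives *)

(** Membership in [Phi], for any cokernel of the action in place of the chosen
    one. *)
Definition PhiDP W := exists X (p : {linear lbase W -> X}),
  [/\ coker_act p, injective (act W) & ding_projective X].

(** A Ding projective has a coresolution by projectives with Ding projective
    cosyzygies. *)
Lemma tor1_ding X : ding_projective X -> tor1 (rmod M) X.
Proof.
apply: (@tor1_coresolved _ _ _ (@ding_projective R) Mn') => Z DZ.
have [Z' [[l] DZ']] := ts_next (ding_proj_self R).1 DZ.
exists (link_mod l), Z', (link_in l), (link_out l); split=> //; first exact: link_ses.
by move=> j; apply: torn_flat; apply: proj_flat; exact: link_Pr.
Qed.

Section Cover.
Variables (W : lmodType T) (X : lmodType R) (p : {linear lbase W -> X}).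
Hypotheses (cp : coker_act p) (uI : injective (act W)) (MX : tor1 (rmod M) X).
Variables (X' P : lmodType R) (a : {linear X' -> P}) (b : {linear P -> X}).
Hypotheses (ab : ses a b) (Ppr : projective P).

(** Lifting b through p and extending by Frobenius reciprocity gives a cover of W
    by an induced module; its kernel is an extension of X' by M (x) X'. *)
Lemma Phi_cover : exists phi : {linear ind M P -> W}, surj phi /\
  exists p' : {linear lbase (kermod phi) -> X'},
    [/\ coker_act p', injective (act (kermod phi)) &
        forall w, a (p' w) = (kincl phi w).1].
Proof.
have [l lP] := @Ppr _ _ p b (coker_surj cp).
pose phi := ind_adj l; exists phi.
have pI := btr_coker_inj MM0 cp.
have Ml t : btr M p (btr M l t) = btr M b t.
  by apply: tr_comp => x; rewrite -lP.
have MlS s : exists t, btr M l t = s.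
  have [t ts] := tr_surj (rmod M) (ses_surj ab) (btr M p s).
  by exists t; apply: pI; rewrite Ml.
have aMI : injective (btr M a) by exact: (MX ab).
split.
  move=> w; have [x xw] := ses_surj ab (p w).
  have /(coker_exact cp)[s sw] : p (w - l x) = 0.
    by rewrite linearB -lP xw subrr.
  by have [t ts] := MlS s; exists (x, t); rewrite ind_adj_pair ts sw addrC subrK.
have phi_p q : p (phi q) = b q.1.
  rewrite /phi ind_adjE linearD -lP.
  have -> : p (act W (btr M l q.2)) = 0 by apply/(coker_exact cp); eexists.
  by rewrite addr0.
pose k := lb (kincl phi).
have kI : injective k by exact: kincl_inj.
have k0 w : phi (k w) = 0 by exact: kincl0.
have [p' p'P] : exists p' : {linear lbase (kermod phi) -> X'},
    forall w, a (p' w) = (ind_out M P \o k) w.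
  by apply: (lift_ker ab) => w /=; rewrite -phi_p k0 linear0.
have kS q : phi q = 0 -> exists w, k w = q by move=> /kinclP.
have p'S : surj p'.
  move=> x; have /(coker_exact cp)[s sx] : p (l (a x)) = 0.
    by rewrite -lP (ses_gf ab).
  have [t ts] := MlS (- s).
  have [|w wx] := kS (a x, t).
    by rewrite /phi ind_adj_pair ts linearN sx subrr.
  by exists w; apply: (ses_inj ab); rewrite p'P -[LHS]/(k w).1 wx.
have k_act s : k (act (kermod phi) s) = (0, btr M a (btr M p' s)).
  rewrite /k lb_lact act_ind; congr pair.
  rewrite -[LHS]/(tr _ (ind_out M P) (tr _ k s)) -[RHS]/(tr _ a (tr _ p' s)).
  rewrite (tr_comp (h := ind_out M P \o k)) //.
  by rewrite (tr_comp (h := ind_out M P \o k)).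
have cp' : coker_act p'.
  split=> // w; split=> [w0|[s <-]]; last first.
    by apply: (ses_inj ab); rewrite p'P -[LHS]/(k _).1 k_act linear0.
  have kw1 : (k w).1 = 0 by rewrite -[LHS]/((ind_out M P \o k) w) -p'P w0 linear0.
  have t0 : btr M b (k w).2 = 0.
    rewrite -Ml; have -> : btr M l (k w).2 = 0; last exact: linear0.
    by apply: (inj_ker0 uI); rewrite -(k0 w) /phi ind_adjE kw1 linear0 add0r.
  have [t' tt'] := tr_exact (ses_surj ab) (ses_ker ab) t0.
  have [s ss] := tr_surj (rmod M) p'S t'.
  exists s; apply: kI; rewrite k_act.
  rewrite -[btr M p' s]/(tr _ p' s) ss -[btr M a t']/(tr _ a t') tt' -kw1.
  by case: (k w).
exists p'; split=> //; apply: ker0_inj => s s0.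
apply: (inj_ker0 (btr_coker_inj MM0 cp')); apply: (inj_ker0 aMI).
by have := k_act s; rewrite s0 linear0 => -[].
Qed.
End Cover.

Lemma Phi_prev W : PhiDP W ->
  exists W', inhabited (link (@projective T) W' W) /\ PhiDP W'.
Proof.
move=> [X [p [cp uI DX]]].
have [X' [[l] DX']] := ts_prev (ding_proj_self R).1 DX.
have [phi [phiS [p' [cp' uI' _]]]] :=
  Phi_cover cp uI (tor1_ding DX) (link_ses l) (link_Pr l).
exists (kermod phi); split; last by exists X', p'.
by constructor; apply: Link (ses_kincl phiS) _; apply: ind_proj; exact: link_Pr.
Qed.

(** A map from the kernel of a cover by P + M (x) P into a flat F is extended in
    two steps, along 0 -> M (x) CF -> F -> CF -> 0 where CF = F / MF is flat. *)
Lemma Phi_ext W F : PhiDP W -> flat F -> ext1 W F.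
Proof.
move=> [X [p [cp uI DX]]] flF.
have [X' [[l] DX']] := ts_prev (ding_proj_self R).1 DX.
have [phi [phiS [p' [cp' uI' p'P]]]] :=
  Phi_cover cp uI (tor1_ding DX) (link_ses l) (link_Pr l).
apply: (ext1_of_proj (ses_kincl phiS)) => [|h].
  by apply: ind_proj; exact: link_Pr.
pose q := cproj (act F); have cq : coker_act q := coker_cproj F.
have flC : flat (cokermod (act F)) := flat_coker flF cq.
have [j [jP jq]] := coker_ses MM0 cq (flat_act_inj MM0 flF).
have j0 m t : laction m (j t) = 0.
  have [s <-] := @btr_surj R M _ _ q (coker_surj cq) t.
  by rewrite jP lact_act.
set K := kermod phi in h p' cp' uI' p'P *.
have [h1 h1P] : exists h1 : {linear X' -> cokermod (act F)}, forall w, q (lb h w) = h1 (p' w).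
  apply: (lin_factor (h := q \o lb h) (coker_surj cp')) => w /(coker_exact cp')[s <-] /=.
  by rewrite lb_lact; apply/(coker_exact cq); eexists.
have [k1 k1P] := dp_orth_flat flC DX (link_ses l) h1.
have Ppr : projective (link_mod l) := link_Pr l.
have [e eP] := Ppr _ _ q k1 (coker_surj cq).
pose h2 : {linear lbase K -> lbase F} := lb (h \- (ind_adj e \o kincl phi)).
have h2P w : h2 w = lb h w - ind_adj e (kincl phi w) by [].
have [d dP] : exists d : {linear lbase K -> btensor M (cokermod (act F))},
    forall w, j (d w) = h2 w.
  apply: (lift_ker jq) => w; rewrite h2P linearB h1P k1P p'P.
  rewrite ind_adjE linearD -eP.
  have -> : q (act F (btr M e (kincl phi w).2)) = 0 by apply/(coker_exact cq); eexists.
  by rewrite addr0 subrr.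
have [d1 d1P] : exists d1 : {linear X' -> btensor M (cokermod (act F))},
    forall w, d w = d1 (p' w).
  apply: (lin_factor (coker_surj cp')) => w /(coker_exact cp')[s <-].
  apply: (ses_inj jq); rewrite dP linear0 lb_lact -[s]tmap_id.
  have : forall s', btr M h2 s' = btr M (j \o d) s'.
    by move=> s'; apply: tmap_eq => // x; rewrite -dP.
  move=> ->; apply: (btensor_ext (f := act F \o btr M (j \o d)) (g := \0)) => m x.
  rewrite -[LHS]/(act F (btr M (j \o d) (tens m x))) btrE actE.
  exact: j0.
have [_ CO] := dp_orth_btensor Mn flC.
have [k2 k2P] := CO _ DX _ _ _ _ (link_ses l) d1.
exists (ind_adj e \+ ind_adj (j \o k2)) => w.
rewrite -[RHS]/(ind_adj e (kincl phi w) + ind_adj (j \o k2) (kincl phi w)).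
rewrite [in X in _ + X]ind_adjE.
have -> : act F (btr M (j \o k2) (kincl phi w).2) = 0.
  apply: (btensor_ext (f := act F \o btr M (j \o k2)) (g := \0)) => m x.
  rewrite -[LHS]/(act F (btr M (j \o k2) (tens m x))) btrE actE.
  exact: j0.
rewrite addr0; transitivity (ind_adj e (kincl phi w) + h2 w).
  by rewrite h2P [RHS]addrC subrK.
by congr (_ + _); rewrite -dP d1P k2P p'P.
Qed.

(** Since Ext^1(X, M (x) P) = 0, the map M (x) X -> M (x) P extends along
    M (x) X -> W; together with W -> X -> P it embeds W into the module induced
    by P. *)
Lemma Phi_next W : PhiDP W ->
  exists W', inhabited (link (@projective T) W W') /\ PhiDP W'.
Proof.
move=> [X [p [cp uI DX]]].
have [X' [[l] DX']] := ts_next (ding_proj_self R).1 DX.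
have [j [jP jp]] := coker_ses MM0 cp uI.
have Ppr : projective (link_mod l) := link_Pr l.
have ab := link_ses l; set P := link_mod l in ab Ppr *.
set a := link_in l in ab *; set b := link_out l in ab *.
have [_ MPO] := dp_orth_btensor Mn (proj_flat Ppr).
have [al alP] := MPO _ DX _ _ _ _ jp (btr M a).
have phi_lin : linear (fun w : lbase W => (a (p w), al w) : lbase (ind M P)).
  by move=> r x y; rewrite ind_lscale !linearP.
have al_act m (w : lbase W) : al (laction m w) = tens m (a (p w)).
  by rewrite -actE -jP -alP btrE; exact: btrE.
have phi_act m w : to_linear phi_lin (laction m w) = laction m (to_linear phi_lin w).
  by rewrite ind_act /= (coker_laction m w cp) linear0 al_act.
pose phi : {linear W -> ind M P} := to_linear (linear_of_lb phi_act).
have phiE w : phi w = (a (p w), al w) by [].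
have aMI : injective (btr M a) by exact: (tor1_ding DX' ab).
have phiI : injective phi.
  apply: ker0_inj => w; rewrite phiE => -[/(inj_ker0 (ses_inj ab))/(ses_ker jp)[s <-]].
  by rewrite -alP => /(inj_ker0 aMI) ->; rewrite linear0.
pose c := cproj phi; have cS : surj c := @cproj_surj _ _ _ phi.
have cphi w : c (phi w) = 0 := ses_gf (ses_cproj phiI) w.
have cker q : c q = 0 -> exists w, phi w = q := @ses_ker _ _ _ _ _ _ (ses_cproj phiI) q.
have [p' p'P] : exists p' : {linear lbase (cokermod phi) -> X'},
    forall q, (b \o ind_out M P) q = p' (lb c q).
  apply: (@lin_factor _ _ _ _ (lb c)) => // q /cker[w <-].
  by rewrite -[LHS]/(b (phi w).1) phiE /= (ses_gf ab).
have p'c q : p' (lb c q) = b q.1 by rewrite -p'P.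
have cMS : surj (btr M (lb c)) by apply: btr_surj.
exists (cokermod phi); split.
  by constructor; apply: Link (ses_cproj phiI) _; exact: ind_proj.
exists X', p'; split=> //.
  split=> [x'|w'].
    have [x xx'] := ses_surj ab x'.
    by exists (lb c (ind_in M P x)); rewrite p'c.
  have [q <-] := cS w'; rewrite -[c q]/(lb c q) p'c; split=> [q0|[s' ss']].
    have [x xq] := ses_ker ab q0; have [w wx] := coker_surj cp x.
    have /(coker_exact (ind_coker M P))[s sq] : ind_out M P (q - phi w) = 0.
      by rewrite -[LHS]/(q.1 - (phi w).1) phiE /= wx xq subrr.
    exists (btr M (lb c) s); rewrite -lb_lact sq.
    by rewrite -[LHS]/(c (q - phi w)) linearB cphi subr0.
  have [s sE] := cMS s'; rewrite -p'c -ss' -sE -lb_lact p'c act_ind; exact: linear0.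
apply: ker0_inj => s' s'0; have [s sE] := cMS s'.
have /cker[w wq] : c (act (ind M P) s) = 0.
  by rewrite -[LHS]/(lb c _) lb_lact sE.
have : phi w = (0, btr M (ind_out M P) s) by rewrite wq act_ind.
rewrite phiE => -[/(inj_ker0 (ses_inj ab))/(coker_exact cp)[s2 s2w] _].
have ss2 : s = btr M (lb phi) s2.
  by apply: (@ind_act_inj _ _ MM0 P); rewrite -lb_lact s2w -wq.
rewrite -sE ss2 -[LHS]/(tr _ (lb c) (tr _ (lb phi) s2)) (tr_comp (h := \0)).
  exact: tr_eq0.
by move=> w2; exact: cphi.
Qed.

Lemma Phi_ding W : PhiDP W -> ding_projective W.
Proof.
apply: (@ding_projective_coind _ PhiDP); split; last exact: Phi_ext.
by split; [exact: Phi_next | exact: Phi_prev].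
Qed.

(** * Ding projectives lie in Phi of Ding projectives *)

(** W |-> W / MW is left adjoint to an exact functor. *)
Lemma proj_coker (Q : lmodType T) X (p : {linear lbase Q -> X}) :
  projective Q -> coker_act p -> projective X.
Proof.
move=> Qpr cp A B g h gS.
have h0 m w : (h \o p) (laction m w) = 0.
  by rewrite /= (coker_laction m w cp) linear0.
have [k kP] := Qpr _ _ (restr_map (@triv_pr R M : {rmorphism T -> R}) g)
  (to_linear (linear_to_triv h0)) gS.
have [k1 k1P] := triv_factor k cp.
exists k1 => x; have [w <-] := coker_surj cp x.
by rewrite -k1P; exact: kP.
Qed.

(** Q is an extension of the projective C = Q / MQ by M (x) C. *)
Lemma torn_base_proj (Q : lmodType T) : projective Q ->
  forall j, torn j (rmod M) (lbase Q).
Proof.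
move=> Qpr j; have cq := coker_cproj Q.
have Cfl := proj_flat (proj_coker Qpr cq).
have [i [_ iq]] := coker_ses MM0 cq (flat_act_inj MM0 (proj_flat Qpr)).
by apply: (tor1_ext iq); [exact: MF | exact: torn_flat].
Qed.

Lemma tor1_base_ding W : ding_projective W -> tor1 (rmod M) (lbase W).
Proof.
move=> DW; apply: (@tor1_coresolved _ _ _
  (fun Z => exists W, ding_projective W /\ Z = lbase W) Mn' _ (lbase W)); last by exists W.
move=> _ [V [DV ->]]; have [V' [[l] DV']] := ts_next (ding_proj_self T).1 DV.
exists (lbase (link_mod l)), (lbase V'), (lb (link_in l)), (lb (link_out l)).
split; [exact/ses_restr/link_ses | by apply: torn_base_proj; exact: link_Pr | by exists V'].
Qed.

(** An embedding of W into a projective Q stays injective under M (x) -, and the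
    action on Q is injective. *)
Lemma ding_act_inj W : ding_projective W -> injective (act W).
Proof.
move=> DW; have [W' [[l] DW']] := ts_next (ding_proj_self T).1 DW.
have lI : injective (btr M (lb (link_in l))).
  exact: (tor1_base_ding DW' (ses_restr (triv_inl M) (link_ses l))).
have Ppr : projective (link_mod l) := link_Pr l.
apply: ker0_inj => t t0; apply: (inj_ker0 lI).
apply: (inj_ker0 (flat_act_inj MM0 (proj_flat Ppr))).
by rewrite -lb_lact t0 linear0.
Qed.

(** The snake lemma for the actions of M on W1, Q and W2; injectivity on W2 makes
    the sequence of cokernels exact on the left. *)
Lemma coker_ses3 W1 (Q : lmodType T) W2 (i : {linear W1 -> Q}) (o : {linear Q -> W2})
    (X1 Y X2 : lmodType R) (p1 : {linear lbase W1 -> X1}) (q : {linear lbase Q -> Y})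
    (p2 : {linear lbase W2 -> X2}) :
  ses i o -> coker_act p1 -> coker_act q -> coker_act p2 -> injective (act W2) ->
  exists (a : {linear X1 -> Y}) (b : {linear Y -> X2}),
    [/\ forall w, a (p1 w) = q (i w), forall v, b (q v) = p2 (o v) & ses a b].
Proof.
move=> io c1 cq c2 u2.
have oS : surj (lb o) := ses_surj io.
have oMS : surj (btr M (lb o)) by exact: btr_surj.
have [a aP] : exists a : {linear X1 -> Y}, forall w, (q \o lb i) w = a (p1 w).
  apply: (lin_factor (coker_surj c1)) => w /(coker_exact c1)[t <-] /=.
  by rewrite lb_lact; apply/(coker_exact cq); eexists.
have [b bP] : exists b : {linear Y -> X2}, forall w, (p2 \o lb o) w = b (q w).
  apply: (lin_factor (coker_surj cq)) => w /(coker_exact cq)[t <-] /=.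
  by rewrite lb_lact; apply/(coker_exact c2); eexists.
have aE w : a (p1 w) = q (i w) by rewrite -aP.
have bE v : b (q v) = p2 (o v) by rewrite -bP.
exists a, b; split=> //; split.
- apply: ker0_inj => x; have [w <-] := coker_surj c1 x.
  rewrite aE => /(coker_exact cq)[t tw].
  have [s st] : exists s, tr (rmod M) (lb i) s = t.
    apply: (@tr_exact _ _ _ _ _ (lb i) (lb o)) => [//|y /(ses_ker io)//|].
    apply: (inj_ker0 (f := act W2) u2); rewrite -[tr _ _ _]/(btr M (lb o) t) -lb_lact tw.
    exact: ses_gf io w.
  apply/(coker_exact c1); exists s; apply: (ses_inj io).
  by rewrite -[LHS]/(lb i _) lb_lact -[btr _ _ _]/(tr _ _ _) st.
- move=> x; have [w <-] := coker_surj c2 x; have [v <-] := oS w.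
  by exists (q v); rewrite bE.
- move=> y; have [v <-] := coker_surj cq y; split=> [|[x <-]]; last first.
    by have [w <-] := coker_surj c1 x; rewrite aE bE (ses_gf io) linear0.
  rewrite bE => /(coker_exact c2)[s' s'v]; have [t tE] := oMS s'.
  have [w wv] : exists w, i w = v - act Q t.
    apply: (ses_ker io); rewrite linearB -[o (act Q t)]/(lb o _) lb_lact tE s'v.
    exact: subrr.
  exists (p1 w); rewrite aE wv linearB.
  have -> : q (act Q t) = 0 by apply/(coker_exact cq); eexists.
  exact: subr0.
Qed.

Definition coker_ding X := exists W (p : {linear lbase W -> X}),
  coker_act p /\ ding_projective W.

(** Complete resolutions over T induce complete resolutions of the cokernels of
    the action. Maps from these cokernels to F are T-linear maps to F killed by
    M, and extend because Ding projective T-modules have no Ext^1 into that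
    module. *)
Lemma coker_ding_class : ding_proj_class coker_ding.
Proof.
split=> [|X F [W [p [cp DW]]] flF].
  split=> X [W [p [cp DW]]].
    have [W' [[l] DW']] := ts_next (ding_proj_self T).1 DW.
    have [a [b [_ _ ab]]] := coker_ses3 (link_ses l) cp (coker_cproj _) (coker_cproj W')
      (ding_act_inj DW').
    exists (cokermod (act W')); split; last by exists W', (cproj _); split=> //; exact: coker_cproj.
    by constructor; apply: Link ab (proj_coker (link_Pr l) (coker_cproj _)).
  have [W' [[l] DW']] := ts_prev (ding_proj_self T).1 DW.
  have [a [b [_ _ ab]]] := coker_ses3 (link_ses l) (coker_cproj W') (coker_cproj _) cp
    (ding_act_inj DW).
  exists (cokermod (act W')); split; last by exists W', (cproj _); split=> //; exact: coker_cproj.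
  by constructor; apply: Link ab (proj_coker (link_Pr l) (coker_cproj _)).
have [W' [[l] DW']] := ts_prev (ding_proj_self T).1 DW.
have cq := coker_cproj (link_mod l); have cp' := coker_cproj W'.
have [a [b [aE _ ab]]] := coker_ses3 (link_ses l) cp' cq cp (ding_act_inj DW).
apply: (ext1_of_proj ab (proj_coker (link_Pr l) cq)) => h.
have h0 m w : (h \o cproj (act W')) (laction m w) = 0.
  exact: (etrans (congr1 h (coker_laction m w cp')) (linear0 h)).
have [k kP] := dp_orth_triv flF DW (link_ses l) (to_linear (linear_to_triv h0)).
have [k1 k1P] := triv_factor k cq.
exists k1 => x; have [w <-] := coker_surj cp' x.
by rewrite aE -k1P; exact: kP.
Qed.

Theorem ding_projective_Phi W : ding_projective W <-> Phi (@ding_projective R) W.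
Proof.
split=> [DW|[uI DC]].
  split; first exact: ding_act_inj.
  apply: (ding_projective_coind coker_ding_class).
  by exists W, (cproj (act W)); split=> //; exact: coker_cproj.
apply: Phi_ding; exists (cokermod (act W)), (cproj (act W)); split=> //.
exact: coker_cproj.
Qed.
End DingProjectives.

(** * Enough injectives *)

Section Injectives.

(** Zorn's lemma for inclusion. A chain may be empty, so that P has to hold for
    the empty predicate. *)
Lemma zorn_pred (T : Type) (P : (T -> Prop) -> Prop) :
  (forall F : (T -> Prop) -> Prop, (forall X, F X -> P X) ->
    (forall X Y, F X -> F Y -> (forall t, X t -> Y t) \/ (forall t, Y t -> X t)) ->
    P (fun t => exists2 X, F X & X t)) ->
  exists A, P A /\ forall B, P B -> (forall t, A t -> B t) -> forall t, B t -> A t.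
Proof.
move=> chain; have [F FP tF|A [PA Amax]] := @classical_sets.Zorn_bigcup T P.
  exact: chain F FP tF.
exists A; split=> // B PB AB t Bt; apply: contrapT => At.
by apply: (Amax B) => //; split=> // BA; exact/At/BA.
Qed.

Definition divisible (D : zmodType) := forall n (d : D), exists d', d' *+ n.+1 = d.

Section Baer.
Variables (A B D : zmodType) (f : {additive A -> B}) (h : {additive A -> D}).
Hypotheses (fI : injective f) (Ddiv : divisible D).

(* A partial extension of h is the graph of an additive relation; the second
   condition makes it single-valued (take a = 0) and compatible with h, and,
   unlike containing the graph of h, it holds for the empty relation. *)
Let partial (G : B * D -> Prop) :=
  (forall p q, G p -> G q -> G (p - q)) /\ forall a d, G (f a, d) -> d = h a.

Let partial_chain (F : (B * D -> Prop) -> Prop) :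
  (forall X, F X -> partial X) ->
  (forall X Y, F X -> F Y -> (forall t, X t -> Y t) \/ (forall t, Y t -> X t)) ->
  partial (fun t => exists2 X, F X & X t).
Proof.
move=> FP tF; split=> [p q [X FX Xp] [Y FY Yq]|a d [X FX Xd]]; last exact: (FP _ FX).2.
have [XY|YX] := tF _ _ FX FY.
  by exists Y => //; apply: (FP _ FY).1 => //; exact: XY.
by exists X => //; apply: (FP _ FX).1 => //; exact: YX.
Qed.

(** Baer's criterion over Z: a maximal partial extension is total. *)
Lemma divisible_extend : exists k : {additive B -> D}, forall a, k (f a) = h a.
Proof.
have [G [[GB Gh] Gmax]] := zorn_pred partial_chain.
have G0 : G 0.
  apply: (Gmax (fun p => G p \/ p = 0)); [split|by left|by right].
    move=> p q [Gp|->] [Gq|->]; rewrite ?subr0; [left; exact: GB|by left| |by right].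
    have G0 : G (q - q) by exact: GB.
    by left; rewrite -(subrr q); exact: GB.
  by move=> a d [/Gh //|[fa ->]]; rewrite (zinj0 fI fa) raddf0.
have GN p : G p -> G (- p) by move=> Gp; rewrite -sub0r; exact: GB.
have GD p q : G p -> G q -> G (p + q) by move=> Gp /GN; rewrite -{2}[q]opprK; exact: GB.
have GM p (k : int) : G p -> G (p *~ k).
  have GM' q n : G q -> G (q *+ n).
    by move=> Gq; elim: n => [|n IHn]; rewrite ?mulr0n // mulrS; exact: GD.
  by case: k => n Gp; [exact: GM' | rewrite NegzE mulrNz; exact/GN/GM'].
have pairM (b : B) (d : D) (k : int) : (b, d) *~ k = (b *~ k, d *~ k).
  have pM n : (b, d) *+ n = (b *+ n, d *+ n).
    by elim: n => [|n IHn]; rewrite ?mulr0n // !mulrS IHn.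
  case: k => n; first exact: pM.
  by rewrite NegzE !mulrNz -[LHS]/(- ((b, d) *+ n.+1)) pM.
(* By maximality, G contains (b0, d0) if adjoining its multiples is consistent
   with h. *)
have ext (b0 : B) (d0 : D) :
    (forall a b d k, G (b, d) -> f a = b + b0 *~ k -> h a = d + d0 *~ k) -> G (b0, d0).
  move=> ok; apply: (Gmax (fun p => exists q k, G q /\ p = q + (b0, d0) *~ k)).
  - split=> [_ _ [q [k [Gq ->]]] [q' [k' [Gq' ->]]]|a d [[b' d'] [k [Gq]]]].
      exists (q - q'), (k - k'); split; first exact: GB.
      by rewrite mulrzBr opprD addrACA.
    by rewrite pairM => -[fa ->]; rewrite (ok _ _ _ _ Gq fa).
  - by move=> t Gt; exists t, 0; rewrite mulr0z addr0.
  - by exists 0, 1; rewrite add0r.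
have Gf a : G (f a, h a).
  apply: ext => a' b d k Gbd fa'.
  have /Gh -> : G (f (a' - a *~ k), d) by rewrite raddfB raddfMz fa' addrK.
  by rewrite raddfB raddfMz subrK.
have dom b0 : exists d0, G (b0, d0).
  suff [d0 d0P] : exists d0, forall k e, G (b0 *~ k, e) -> d0 *~ k = e.
    exists d0; apply: ext => a b d k Gbd fa.
    have -> : d0 *~ k = h a - d; last by rewrite addrC subrK.
    apply: d0P; have -> : (b0 *~ k, h a - d) = (f a, h a) - (b, d); last exact: GB.
    by congr pair; rewrite /= fa addrAC subrr add0r.
  have G0e e : G (0, e) -> e = 0.
    by rewrite -(raddf0 f) => /Gh ->; rewrite raddf0.
  have [[n [e Ge]]|none] := pselect (exists n, exists e, G (b0 *+ n.+1, e)); last first.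
    exists 0 => k e; rewrite mul0rz; case: k => [[|n]|n] Ge; first by rewrite (G0e e).
      by case: none; exists n, e.
    case: none; exists n, (- e).
    have -> : (b0 *+ n.+1, - e) = - (b0 *~ Negz n, e); last exact: GN.
    by congr pair; rewrite NegzE mulrNz opprK.
  (* Divide at the least positive multiple of b0 lying in the domain. *)
  pose Q n := `[< exists e, G (b0 *+ n.+1, e) >].
  have exQ : exists n, Q n by exists n; apply/asboolP; exists e.
  move: (ex_minnP exQ) => [{}n /asboolP[{}e {}Ge] nmin].
  have [d0 d0e] := Ddiv n e; exists d0 => k e' Ge'.
  have [q [r [kE r_ge0 r_lt]]] : exists q r : int,
      [/\ k = q * n.+1%:Z + r, 0 <= r & r < n.+1%:Z]%R.
    exists (k %/ n.+1%:Z)%Z, (k %% n.+1%:Z)%Z; split; first exact: divz_eq.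
      exact: modz_ge0.
    exact: ltz_pmod.
  have kM (V : zmodType) (v : V) : v *~ k = (v *+ n.+1) *~ q + v *~ r.
    by rewrite kE mulrzDr mulrC mulrzA.
  have Gr : G (b0 *~ r, e' - e *~ q).
    have -> : (b0 *~ r, e' - e *~ q) = (b0 *~ k, e') - (b0 *+ n.+1, e) *~ q.
      by rewrite pairM; congr pair; rewrite /= kM addrAC subrr add0r.
    by apply: GB => //; exact: GM.
  have r0 : r = 0.
    move: Gr r_ge0 r_lt; case: r {kE kM} => [[|m]|m] // Gr _ mn.
    have := nmin m; rewrite leqNgt -ltnS => /(_ _)/negP; case=> //.
    by apply/asboolP; exists (e' - e *~ q).
  move: Gr; rewrite r0 => /G0e/eqP; rewrite subr_eq0 => /eqP ->.
  by rewrite kM r0 addr0 d0e.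
have [k kP] := choice dom.
have Gfun b d d' : G (b, d) -> G (b, d') -> d = d'.
  move=> Gd Gd'; apply/eqP; rewrite -subr_eq0; apply/eqP.
  have : G (f 0, d - d').
    have -> : (f 0, d - d') = (b, d) - (b, d'); last exact: GB.
    by congr pair; rewrite raddf0 subrr.
  by move=> /Gh ->; rewrite raddf0.
have kB : zmod_morphism k.
  move=> x y; apply: (Gfun (x - y)) => //.
  have -> : (x - y, k x - k y) = (x, k x) - (y, k y) by []; exact: GB.
pose ka : {additive B -> D} := to_additive kB.
exists ka => a.
exact: (Gfun (f a)).
Qed.
End Baer.

Lemma int_free_ext (A : choiceType) (V : zmodType) (f g : {additive {freeg A / int} -> V}) :
  (forall a, f << a >> = g << a >>) -> forall e, f e = g e.
Proof.
move=> fg e; rewrite -[e]freeg_sumE !raddf_sum; apply: eq_bigr => z _.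
set k := coeff _ _; have -> : << k *g z >> = << z >> *~ k :> {freeg A}.
  by rewrite freeg_mulz intz.
by rewrite !raddfMz fg.
Qed.

(** A is Z^(A) modulo relations, and the same relations cut out a divisible group
    containing A from Q^(A). *)
Lemma divisible_embedding (A : zmodType) :
  exists (D : zmodType) (i : {additive A -> D}), injective i /\ divisible D.
Proof.
pose G := {freeg A / rat}; pose E := {freeg A / int}.
pose Iz (e : E) : G := fglift (fun a => << a >> : zmodule G) e.
have IzB : zmod_morphism Iz.
  have := @lift_is_additive _ _ _ (fun a => << a >> : zmodule G); exact.
pose I : {additive E -> G} := to_additive IzB.
pose evz (e : E) : A := fglift (id : A -> zmodule A) e.
have evB : zmod_morphism evz.
  have := @lift_is_additive _ _ _ (id : A -> zmodule A); exact.
pose ev : {additive E -> A} := to_additive evB.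
have IU a : I << a >> = << a >> by rewrite /I /= /Iz liftU scale1r.
have evU a : ev << a >> = a by rewrite /ev /= /evz liftU scale1r.
have coI x (e : E) : coeff x (I e) = (coeff x e)%:~R.
  pose cx : {additive G -> rat} := coeff x; pose cz : {additive E -> int} := coeff x.
  apply: (int_free_ext (f := cx \o I) (g := (intr : {additive int -> rat}) \o cz)) => a.
  rewrite -[LHS]/(coeff x (I << a >>)) IU -[RHS]/((coeff x (<< a >> : E))%:~R).
  by rewrite !coeffU !mul1r; case: eqP.
have II : injective I.
  move=> e e' ee; apply/eqP/freeg_eqP => x; apply: (@intr_inj rat).
  by rewrite -!coI ee.
have [|s t|D [p [pS pP]]] := @zmod_closed_quot G (fun d => exists2 e, I e = d & ev e = 0).
- by exists 0; rewrite raddf0.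
- by move=> [e <- e0] [e' <- e'0]; exists (e - e'); rewrite raddfB ?e0 ?e'0 ?subr0.
have iB : zmod_morphism (fun a : A => p << a >>).
  move=> a b; apply/eqP; rewrite -subr_eq0 -!raddfB; apply/eqP/pP.
  exists (<< a - b >> - (<< a >> - << b >>)); first by rewrite !raddfB !IU.
  by rewrite 2!raddfB !evU subrr.
pose i : {additive A -> D} :=
  to_additive iB.
exists D, i; split.
  apply: zinj => a /pP[e]; rewrite -IU => /II -> .
  by rewrite evU.
move=> n d; have [g <-] := pS d; exists (p (n.+1%:R^-1 *: g)).
rewrite -raddfMn -scaler_nat scalerA divff ?scale1r //.
by rewrite Num.Theory.pnatr_eq0.
Qed.

Section Coinduced.
Variables (S : nzRingType) (D : zmodType).

Definition additive_pred : {pred S -> D} := fun h => `[< zmod_morphism h >].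

Fact additive_pred_closed : zmod_closed additive_pred.
Proof.
split=> [|h k]; rewrite !unfold_in.
  by apply/asboolP => x y; exact/esym/subr0.
move=> /asboolP hP /asboolP kP; apply/asboolP => x y.
have E z : (h - k) z = h z - k z by [].
by rewrite !E hP kP !opprB addrACA [RHS]addrACA [X in _ + X = _]addrC.
Qed.
HB.instance Definition _ := GRing.isZmodClosed.Build _ additive_pred
  additive_pred_closed.

(** The S-module Hom_Z(S, D), coinduced from D. *)
Definition zhom : Type := {h : S -> D | h \in additive_pred}.
HB.instance Definition _ := SubChoice.on zhom.
HB.instance Definition _ := [SubChoice_isSubZmodule of zhom by <:].

Lemma zhomB (h : zhom) : zmod_morphism (val h).
Proof. by have /asboolP := valP h. Qed.

Definition to_zhom (h : S -> D) (hP : zmod_morphism h) : zhom :=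
  exist _ h (asboolT hP : h \in additive_pred).

Lemma zhomP (h k : zhom) : val h =1 val k -> h = k.
Proof. by move=> hk; apply: val_inj; exact/funext. Qed.

Fact zhom_scale_subproof (a : S) (h : zhom) : zmod_morphism (fun r => val h (r * a)).
Proof. by move=> x y; rewrite mulrBl zhomB. Qed.
Definition zhom_scale a h : zhom := to_zhom (zhom_scale_subproof a h).

Fact zhom_scaleA a b h : zhom_scale a (zhom_scale b h) = zhom_scale (a * b) h.
Proof. by apply: zhomP => r; rewrite /= mulrA. Qed.
Fact zhom_scale1 : left_id 1 zhom_scale.
Proof. by move=> h; apply: zhomP => r; rewrite /= mulr1. Qed.
Fact zhom_scaleDr : right_distributive zhom_scale +%R.
Proof. by move=> a h k; apply: zhomP. Qed.
Fact zhom_scaleDl h : {morph zhom_scale^~ h : a b / a + b}.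
Proof.
move=> a b; apply: zhomP => r; rewrite /= mulrDr.
exact: zmod_morphD (@zhomB h) _ _.
Qed.
HB.instance Definition _ := GRing.Zmodule_isLmodule.Build S zhom
  zhom_scaleA zhom_scale1 zhom_scaleDr zhom_scaleDl.

Lemma zhom_inj : divisible D -> injective_mod (zhom : lmodType S).
Proof.
move=> Ddiv A B f h fI.
have h1B : zmod_morphism (fun a => val (h a) 1).
  by move=> a b; rewrite linearB.
pose h1 : {additive A -> D} :=
  to_additive h1B.
have [k kP] := divisible_extend h1 fI Ddiv.
have KB b : zmod_morphism (fun r : S => k (r *: b)).
  by move=> x y; rewrite scalerBl raddfB.
have Kl : linear (fun b => to_zhom (KB b)).
  move=> s x y; apply: zhomP => r /=.
  rewrite scalerDr raddfD scalerA; exact: erefl.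
exists (to_linear Kl) => a; apply: zhomP => r /=.
rewrite -linearZ /= kP /h1 /= linearZ /=.
by rewrite -[LHS]/(val (h a) r) mul1r.
Qed.
End Coinduced.

(** X embeds into Hom_Z(S, D) once it embeds into D as a group. *)
Lemma enough_injectives (S : nzRingType) (X : lmodType S) :
  exists (J C : lmodType S) (f : {linear X -> J}) (g : {linear J -> C}),
    ses f g /\ injective_mod J.
Proof.
have [D [i [iI Ddiv]]] := divisible_embedding X.
have eB x : zmod_morphism (fun r : S => i (r *: x)).
  by move=> a b; rewrite scalerBl raddfB.
have el : linear (fun x => to_zhom (eB x)).
  move=> s x y; apply: zhomP => r /=.
  rewrite scalerDr raddfD scalerA; exact: erefl.
have eI : injective (to_linear el).
  move=> x y /(congr1 (fun h => val h 1)) /=.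
  by rewrite !scale1r => /iI.
exists (zhom S D), (cokermod (to_linear el)), (to_linear el), (cproj _).
by split; [exact: ses_cproj | exact: zhom_inj].
Qed.
End Injectives.

(** * Finitely generated and finitely presented modules *)

Lemma cmpE (U V T : Type) (g : V -> T) (f : U -> V) x : (g \o f) x = g (f x).
Proof. by []. Qed.

Section FinitePresentation.
Variable S : nzRingType.
Implicit Types A B C K L X : lmodType S.

Lemma rV_projective n : projective 'rV[S]_n.
Proof.
move=> A B g h gS.
have /choice[s sP] : forall i : 'I_n, exists a, g a = h (delta_mx 0 i) by move=> i; apply: gS.
have kl : linear (fun x : 'rV[S]_n => \sum_i x 0 i *: s i).
  move=> a x y; rewrite scaler_sumr -big_split; apply: eq_bigr => i _.
  by rewrite !mxE scalerDl scalerA.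
exists (to_linear kl) => x; rewrite /= [x in LHS]row_sum_delta !linear_sum.
by apply: eq_bigr => i _; rewrite !linearZ /= sP.
Qed.

Lemma fg_quot B C (g : {linear B -> C}) :
  surj g -> finitely_generated B -> finitely_generated C.
Proof.
move=> gS [n [p pS]]; exists n, (g \o p) => c.
by have [b <-] := gS c; have [x <-] := pS b; exists x.
Qed.

Section RowSplit.
Variables (m n : nat).
Fact lsub_linear : linear (lsubmx : 'rV[S]_(m + n) -> 'rV[S]_m).
Proof. by move=> a x y; apply/rowP => i; rewrite !mxE. Qed.
Fact rsub_linear : linear (rsubmx : 'rV[S]_(m + n) -> 'rV[S]_n).
Proof. by move=> a x y; apply/rowP => i; rewrite !mxE. Qed.
Fact row0_linear : linear (fun x : 'rV[S]_m => row_mx x (0 : 'rV[S]_n)).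
Proof. by move=> a x y; rewrite scale_row_mx add_row_mx scaler0 addr0. Qed.
Definition lsub : {linear 'rV[S]_(m + n) -> 'rV[S]_m} := to_linear lsub_linear.
Definition rsub : {linear 'rV[S]_(m + n) -> 'rV[S]_n} := to_linear rsub_linear.
Definition row0 : {linear 'rV[S]_m -> 'rV[S]_(m + n)} := to_linear row0_linear.

Lemma ses_row : ses row0 rsub.
Proof.
split=> [x y /eq_row_mx[]//|z|y].
  by exists (row_mx 0 z); exact: row_mxKr.
split=> [y0|[x <-]]; last exact: row_mxKr.
by exists (lsubmx y); rewrite /= -[RHS]hsubmxK -[rsubmx y]/(rsub y) y0.
Qed.
End RowSplit.

(** Generators of B from generators of A and lifted generators of C. *)
Lemma fg_cover A B C (f : {linear A -> B}) (g : {linear B -> C}) m n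
    (pA : {linear 'rV[S]_m -> A}) (pC : {linear 'rV[S]_n -> C}) :
  surj g -> (forall b, g b = 0 -> exists a, f a = b) -> surj pA -> surj pC ->
  exists p : {linear 'rV[S]_(m + n) -> B}, surj p /\
    ((forall a, g (f a) = 0) -> forall x, g (p x) = pC (rsubmx x)) /\
    forall x, p (row_mx x 0) = f (pA x).
Proof.
move=> gS fg pAS pCS; have [l lP] := rV_projective pC gS.
exists ((f \o (pA \o lsub m n)) \+ (l \o rsub m n)); split; last split.
- move=> b; have [y yb] := pCS (g b).
  have [a ab] : exists a, f a = b - l y by apply: fg; rewrite linearB -lP yb subrr.
  have [x xa] := pAS a; exists (row_mx x y).
  by rewrite /= row_mxKl row_mxKr xa ab subrK.
- by move=> gf x; rewrite /= linearD gf add0r -lP.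
- by move=> x; rewrite /= row_mxKl row_mxKr linear0 addr0.
Qed.

Lemma fg_ext A B C (f : {linear A -> B}) (g : {linear B -> C}) :
  surj g -> (forall b, g b = 0 -> exists a, f a = b) ->
  finitely_generated A -> finitely_generated C -> finitely_generated B.
Proof.
move=> gS fg [m [pA pAS]] [n [pC pCS]].
by have [p [pS _]] := fg_cover gS fg pAS pCS; exists (m + n)%N, p.
Qed.

Lemma fpP C : finitely_presented C <->
  exists n (p : {linear 'rV[S]_n -> C}), surj p /\ finitely_generated (kermod p).
Proof.
split=> [[m [n [q [p [pS qp]]]]]|[n [p [pS [m [q qS]]]]]].
  exists n, p; split=> //.
  have [k kP] : exists k : {linear 'rV[S]_m -> kermod p}, forall x, kincl p (k x) = q x.
    by apply: lin_lift (kincl_inj (f := p)) _ => x; apply/kinclP/qp; exists x.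
  exists m, k => y; have [x xy] : exists x, q x = kincl p y by apply/qp/kinclP; exists y.
  by exists x; apply: (kincl_inj (f := p)); rewrite kP.
exists m, n, (kincl p \o q), p; split=> // y; rewrite kinclP.
by split=> [[z <-]|[x <-]]; [have [x <-] := qS z; exists x | exists (q x)].
Qed.

Lemma fp_fg C : finitely_presented C -> finitely_generated C.
Proof. by move=> [m [n [q [p [pS _]]]]]; exists n, p. Qed.

Lemma fg_0 A : (forall a : A, a = 0) -> finitely_generated A.
Proof. by move=> A0; exists 0%N, \0 => a; exists 0; rewrite [RHS]A0. Qed.

Lemma fp_0 A : (forall a : A, a = 0) -> finitely_presented A.
Proof.
move=> A0; apply/fpP; exists 0%N, \0; split=> [a|]; first by exists 0; rewrite [RHS]A0.
by apply: fg_0 => x; apply: (kincl_inj (f := \0)); rewrite [LHS]thinmx0 linear0.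
Qed.

(** With l : S^n -> B lifting a cover p of C, the kernel of g is an extension of
    B / im l by a quotient of ker p. *)
Lemma fg_ker B C (g : {linear B -> C}) :
  surj g -> finitely_generated B -> finitely_presented C -> finitely_generated (kermod g).
Proof.
move=> gS Bfg /fpP[n [p [pS Kfg]]]; have [l lP] := rV_projective p gS.
have [u uP] : exists u : {linear kermod p -> kermod g},
    forall x, kincl g (u x) = (l \o kincl p) x.
  apply: lin_lift (kincl_inj (f := g)) _ => x; apply/kinclP.
  by rewrite -[LHS]/(g (l (kincl p x))) -lP kincl0.
apply: (@fg_ext _ _ _ u (cproj l \o kincl g)) Kfg (fg_quot (@cproj_surj _ _ _ l) Bfg).
  move=> c; have [b <-] := @cproj_surj _ _ _ l c; have [x xb] := pS (g b).
  have /kinclP[k kb] : g (b - l x) = 0 by rewrite linearB -lP xb subrr.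
  exists k; rewrite -[LHS]/(cproj l (kincl g k)) kb linearB.
  have -> : cproj l (l x) = 0 by apply/cprojP; exists x.
  exact: subr0.
move=> k k0; have /cprojP[x xk] : cproj l (kincl g k) = 0 by exact: k0.
have /kinclP[z zx] : p x = 0 by rewrite lP xk kincl0.
by exists z; apply: (kincl_inj (f := g)); rewrite uP cmpE zx.
Qed.

(** The horseshoe lemma: the kernel of S^(m+n) -> B is an extension of the two
    given kernels. *)
Lemma fp_ext A B C (f : {linear A -> B}) (g : {linear B -> C}) :
  ses f g -> finitely_presented A -> finitely_presented C -> finitely_presented B.
Proof.
move=> fg /fpP[m [pA [pAS KA]]] /fpP[n [pC [pCS KC]]]; apply/fpP.
have [p [pS [gp pf]]] := fg_cover (ses_surj fg) (ses_ker fg) pAS pCS.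
have {}gp := gp (ses_gf fg).
exists (m + n)%N, p; split=> //.
have [u uP] : exists u : {linear kermod pA -> kermod p},
    forall x, kincl p (u x) = (row0 m n \o kincl pA) x.
  apply: lin_lift (kincl_inj (f := p)) _ => x; apply/kinclP.
  by rewrite -[LHS]/(p (row_mx (kincl pA x) 0)) pf kincl0 linear0.
have [v vP] : exists v : {linear kermod p -> kermod pC},
    forall x, kincl pC (v x) = (rsub m n \o kincl p) x.
  apply: lin_lift (kincl_inj (f := pC)) _ => x; apply/kinclP.
  by rewrite -[LHS]/(pC (rsubmx (kincl p x))) -gp kincl0 linear0.
apply: (@fg_ext _ _ _ u v) KA KC => [z|y].
  have [b bz] := pS (p (row_mx 0 (kincl pC z))).
  have [a ab] : exists a, f a = p (row_mx 0 (kincl pC z)).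
    by apply: (ses_ker fg); rewrite gp row_mxKr kincl0.
  have [x xa] := pAS a.
  have /kinclP[y yE] : p (row_mx (- x) (kincl pC z)) = 0.
    have -> : row_mx (- x) (kincl pC z) = row_mx 0 (kincl pC z) - row_mx x 0.
      by rewrite opp_row_mx add_row_mx add0r oppr0 addr0.
    by rewrite linearB pf xa ab subrr.
  by exists y; apply: (kincl_inj (f := pC)); rewrite vP cmpE yE -[LHS]/(rsubmx _) row_mxKr.
move=> y0; have r0 : rsubmx (kincl p y) = 0.
  by rewrite -[LHS]/((rsub m n \o kincl p) y) -vP y0 linear0.
have yE : kincl p y = row_mx (lsubmx (kincl p y)) 0 by rewrite -r0 hsubmxK.
have /kinclP[x xE] : pA (lsubmx (kincl p y)) = 0.
  apply: (inj_ker0 (ses_inj fg)); rewrite -pf -[RHS](kincl0 p y); congr (p _).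
  exact/esym.
exists x; apply: (kincl_inj (f := p)); rewrite uP -[LHS]/(row_mx (kincl pA x) 0) xE.
exact/esym.
Qed.

Lemma fp_coker A B C (f : {linear A -> B}) (g : {linear B -> C}) :
  surj g -> exact_at f g -> finitely_generated A -> finitely_presented B ->
  finitely_presented C.
Proof.
move=> gS fg Afg /fpP[n [p [pS KB]]]; apply/fpP; exists n, (g \o p); split.
  by move=> c; have [b <-] := gS c; have [x <-] := pS b; exists x.
have [u uP] : exists u : {linear kermod p -> kermod (g \o p)},
    forall x, kincl (g \o p) (u x) = kincl p x.
  apply: lin_lift (kincl_inj (f := g \o p)) _ => x; apply/kinclP.
  by rewrite -[LHS]/(g (p (kincl p x))) kincl0 linear0.
have [v vP] : exists v : {linear kermod (g \o p) -> immod f},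
    forall x, iincl f (v x) = (p \o kincl (g \o p)) x.
  apply: lin_lift (iincl_inj (f := f)) _ => x; apply/iinclP/fg.
  exact: (kincl0 (g \o p)).
have [w wP] : exists w : {linear A -> immod f}, forall x, iincl f (w x) = f x.
  by apply: lin_lift (iincl_inj (f := f)) _ => x; apply/iinclP; exists x.
apply: (@fg_ext _ _ _ u v) KB _ => [y|y y0|].
- have [x xy] := pS (iincl f y).
  have /kinclP[z zx] : (g \o p) x = 0 by rewrite /= xy; apply/fg/iinclP; exists y.
  by exists z; apply: (iincl_inj (f := f)); rewrite vP cmpE zx.
- have /kinclP[x xE] : p (kincl (g \o p) y) = 0.
    by rewrite -[LHS]/((p \o kincl (g \o p)) y) -vP y0 linear0.
  by exists x; apply: (kincl_inj (f := g \o p)); rewrite uP.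
- apply: (fg_quot (g := w)) => // y.
  have [a aE] : exists a, f a = iincl f y by apply/iinclP; exists y.
  by exists a; apply: (iincl_inj (f := f)); rewrite wP.
Qed.

Lemma fp_isom B C (g : {linear B -> C}) :
  injective g -> surj g -> finitely_presented B -> finitely_presented C.
Proof.
move=> gI gS; apply: (@fp_coker 'rV[S]_0 _ _ \0) => //; last by exists 0%N, idfun => x; exists x.
move=> y; split=> [/(inj_ker0 gI) ->|[x <-]]; last exact: linear0.
by exists 0.
Qed.

Lemma fg_rV n : finitely_generated 'rV[S]_n.
Proof. by exists n, idfun => x; exists x. Qed.

Lemma fp_rV n : finitely_presented 'rV[S]_n.
Proof.
apply/fpP; exists n, idfun; split=> [x|]; first by exists x.
apply: fg_0 => x; apply: (kincl_inj (f := idfun)); rewrite linear0.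
exact: (kincl0 idfun).
Qed.

(** Additive functors keep sequences split by a retraction exact, so a property
    that they are to preserve need only be checked on the ring itself. *)
Lemma rV_ind (Pr : lmodType S -> Prop) :
  (forall A, (forall a : A, a = 0) -> Pr A) -> Pr 'rV[S]_1 ->
  (forall A B C (f : {linear A -> B}) (g : {linear B -> C}) (r : {linear B -> A}),
    ses f g -> (forall a, r (f a) = a) -> Pr A -> Pr C -> Pr B) ->
  forall n, Pr 'rV[S]_n.
Proof.
move=> P0 P1 Pext; elim=> [|n IHn]; first by apply: P0 => x; exact: thinmx0.
apply: (Pext _ _ _ _ _ (lsub 1 n) (ses_row 1 n)) => // x; exact: row_mxKl.
Qed.

(** Split off the first coordinate, whose values form a finitely generated left
    ideal. *)
Lemma coherent_sub m A (i : {linear A -> 'rV[S]_m}) : left_coherent S ->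
  injective i -> finitely_generated A -> finitely_presented A.
Proof.
move=> Scoh; elim: m A i => [|m IHm] A i iI Afg.
  by apply: fp_0 => a; apply: iI; rewrite [LHS]thinmx0 [RHS]thinmx0.
have ll : linear (fun a : A => (i a : 'rV_(1 + m)) 0 (lshift m 0) : S^o).
  by move=> s x y; rewrite linearP !mxE.
pose la : {linear A -> S^o} := to_linear ll.
have [p pP] : exists p : {linear A -> immod la}, forall x, iincl la (p x) = la x.
  by apply: lin_lift (iincl_inj (f := la)) _ => x; apply/iinclP; exists x.
have pS : surj p.
  move=> y; have [a aE] : exists a, la a = iincl la y by apply/iinclP; exists y.
  by exists a; apply: (iincl_inj (f := la)); rewrite pP.
have Ifp : finitely_presented (immod la) by apply/Scoh/(fg_quot pS).
apply: (fp_ext (ses_kincl pS)) => //.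
apply: (IHm _ (rsub 1 m \o (i \o kincl p))); last exact: fg_ker.
apply: ker0_inj => x r0; apply: (inj_ker0 (f := i \o kincl p)).
  by move=> y z /iI/kincl_inj.
pose y : 'rV[S]_(1 + m) := i (kincl p x).
have l0 : lsubmx y = 0.
  apply/rowP => j; rewrite [j]ord1 !mxE -[LHS]/(la (kincl p x)) -pP kincl0.
  exact: linear0.
by rewrite -[LHS]/y -[y]hsubmxK l0 (r0 : rsubmx y = 0) row_mx0.
Qed.
End FinitePresentation.

(** * Right modules over the trivial extension *)

Section RHomFunctor.
Variables (R : nzRingType) (M : bimodType R).
Implicit Types X Y Z : lmodType R^c.

Definition rhom_lin Y (h : rhom M Y) : {linear rmod M -> Y} := to_linear (rhom_linear h).

Lemma to_rhomE Y (h : rmod M -> Y) (hP : linear h) m : rhom_fun (to_rhom hP) m = h m.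
Proof. by []. Qed.

Lemma rhomD Y (h k : rhom M Y) m : rhom_fun (h + k) m = rhom_fun h m + rhom_fun k m.
Proof. by []. Qed.

Lemma rhomZ Y (a : R^c) (h : rhom M Y) m :
  rhom_fun (a *: h) m = rhom_fun h ((a : R) *: (m : M)).
Proof. by []. Qed.

Lemma rhom_comp_linear Y Y' (f : {linear Y -> Y'}) (h : rhom M Y) :
  linear (fun m => f (rhom_fun h m)).
Proof. by move=> a m n; rewrite rhom_linear linearP. Qed.

Lemma rhom_fun0 Y (h : rhom M Y) : rhom_fun h 0 = 0.
Proof. exact: (linear0 (rhom_lin h)). Qed.

Lemma rhom_funD Y (h : rhom M Y) m n : rhom_fun h (m + n) = rhom_fun h m + rhom_fun h n.
Proof. exact: (linearD (rhom_lin h)). Qed.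

Lemma rhom_funZ Y (h : rhom M Y) (a : R^c) m : rhom_fun h (a *: m) = a *: rhom_fun h m.
Proof. exact: (linearZZ (rhom_lin h)). Qed.

Fact rhmap_linear Y Y' (f : {linear Y -> Y'}) :
  linear (fun h : rhom M Y => to_rhom (rhom_comp_linear f h)).
Proof. by move=> a h k; apply: rhomP => m; rewrite rhomD rhomZ !to_rhomE rhomD linearD. Qed.

Definition rhmap Y Y' (f : {linear Y -> Y'}) : {linear rhom M Y -> rhom M Y'} :=
  to_linear (rhmap_linear f).

Lemma rhmapE Y Y' (f : {linear Y -> Y'}) h m : rhom_fun (rhmap f h) m = f (rhom_fun h m).
Proof. by []. Qed.

Lemma rhmap_inj Y Y' (f : {linear Y -> Y'}) : injective f -> injective (rhmap f).
Proof.
move=> fI h k hk; apply: rhomP => m; apply: fI.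
by rewrite -!rhmapE hk.
Qed.

Lemma rhmap_lift X Y (f : {linear X -> Y}) (h : rhom M Y) :
  injective f -> (forall m, exists x, f x = rhom_fun h m) -> exists k, rhmap f k = h.
Proof.
move=> fI hf; have [l lP] := lin_lift (h := rhom_lin h) fI hf.
by exists (to_rhom (linearP l)); apply: rhomP => m; exact: lP.
Qed.

Lemma rhmap_ker X Y Z (f : {linear X -> Y}) (g : {linear Y -> Z}) (h : rhom M Y) :
  ses f g -> rhmap g h = 0 -> exists k, rhmap f k = h.
Proof.
move=> fg gh; apply: (rhmap_lift (ses_inj fg)) => m; apply: (ses_ker fg).
by rewrite -rhmapE gh.
Qed.

Lemma rhmap_surj X Y Z (f : {linear X -> Y}) (g : {linear Y -> Z}) :
  ses f g -> ext1 (rmod M : lmodType R^c) X -> surj (rhmap g).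
Proof.
move=> fg MX h; have [l lP] := ext1_lift MX fg (rhom_lin h).
by exists (to_rhom (linearP l)); apply: rhomP => m; exact: lP.
Qed.

Lemma rhom0 Y m : rhom_fun (0 : rhom M Y) m = 0.
Proof. by []. Qed.
End RHomFunctor.

Section RightModules.
Variables (R : nzRingType) (M : bimodType R).
Local Notation T := (trivext M).
Implicit Types (A B C W E : lmodType T^c) (X Y Z : lmodType R^c).

Definition rb W W' (f : {linear W -> W'}) : {linear rbase W -> rbase W'} :=
  restr_map (@triv_inlc R M : {rmorphism R^c -> T^c}) f.

Lemma ses_rb A B C (f : {linear A -> B}) (g : {linear B -> C}) :
  ses f g -> ses (rb f) (rb g).
Proof. exact: ses_restr. Qed.

Lemma rb_act W W' (f : {linear W -> W'}) y m : rb f (raction y m) = raction (rb f y) m.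
Proof. exact: (linearZZ f). Qed.

Lemma ractionB W (y y' : rbase W) (m : rmod M) :
  raction (y - y') m = raction y m - raction y' m.
Proof. exact: (scalerBr _ (y : W)). Qed.

Lemma raction_raction W (y : rbase W) (m m' : rmod M) : raction (raction y m) m' = 0.
Proof.
rewrite /raction (scalerA _ _ (y : W)) -[X in X *: _]/(triv_inr (m : M) * triv_inr (m' : M)).
by rewrite triv_inr_inr (scale0r (y : W)).
Qed.

Lemma linear_of_rb W W' (h : {linear rbase W -> rbase W'}) :
  (forall y m, h (raction y m) = raction (h y) m) -> linear (h : W -> W').
Proof.
move=> hm s x y; rewrite trivextc_scale [X in _ = X + _]trivextc_scale.
have hD (u v : W) : h (u + v) = (h u : W') + h v by exact: (linearD h).
by rewrite !hD; congr (_ + _ + _); [exact: (linearZZ h (s : T).1 x) | exact: hm].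
Qed.

Lemma rtriv_act X (x : rbase (rtriv M X)) (m : rmod M) : raction x m = 0.
Proof. exact: (scale0r (x : X)). Qed.

Lemma linear_to_rtriv W X (h : {linear rbase W -> X}) :
  (forall y m, h (raction y m) = 0) -> linear (h : W -> rtriv M X).
Proof.
move=> h0; have h' : linear (h : rbase W -> rbase (rtriv M X)) by move=> a x y; exact: (linearP h a x y).
apply: (@linear_of_rb W (rtriv M X) (to_linear h')) => y m.
by rewrite rtriv_act; exact: h0.
Qed.

Lemma linear_of_rtriv W X (h : {linear X -> rbase W}) :
  (forall x m, raction (h x) m = 0) -> linear (h : rtriv M X -> W).
Proof.
move=> h0; have h' : linear (h : rbase (rtriv M X) -> rbase W) by move=> a x y; exact: (linearP h a x y).
apply: (@linear_of_rb (rtriv M X) W (to_linear h')) => x m.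
by rewrite rtriv_act linear0; exact/esym/h0.
Qed.

(** The coinduced module Hom_(R^op)(T, X), as X + Hom_(R^op)(M, X). *)
Definition coind X : Type := (X * rhom M X)%type.

Section Coind.
Variable X : lmodType R^c.
HB.instance Definition _ := GRing.Zmodule.copy (coind X) (X * rhom M X)%type.

Definition coind_scale (s : T^c) (p : coind X) : coind X :=
  (((s : T).1 : R^c) *: p.1 + rhom_fun p.2 (s : T).2, ((s : T).1 : R^c) *: p.2).

Fact coind_scaleA a b v : coind_scale a (coind_scale b v) = coind_scale (a * b) v.
Proof.
case: a b v => [a m] [b n] [x h]; congr pair; rewrite /= ?scalerA //.
rewrite scalerDr scalerA rhomZ -addrA -rhom_funZ; congr (_ + _).
by rewrite addrC -rhom_funD.
Qed.
Fact coind_scale1 : left_id 1 coind_scale.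
Proof.
case=> x h; congr pair; rewrite /= ?scale1r //.
by rewrite -[X in _ + X]/(rhom_fun h (0 : rmod M)) rhom_fun0 addr0.
Qed.
Fact coind_scaleDr : right_distributive coind_scale +%R.
Proof.
move=> s [x h] [x' h']; congr pair; rewrite /= scalerDr //.
by rewrite rhomD addrACA.
Qed.
Fact coind_scaleDl v : {morph coind_scale^~ v : a b / a + b}.
Proof.
move=> a b; congr pair; rewrite /= scalerDl //.
by rewrite -[X in _ + X]/(rhom_fun v.2 ((a.2 : rmod M) + b.2)) rhom_funD addrACA.
Qed.
HB.instance Definition _ := GRing.Zmodule_isLmodule.Build T^c (coind X)
  coind_scaleA coind_scale1 coind_scaleDr coind_scaleDl.
End Coind.

Lemma coind_act X (p : rbase (coind X)) (m : rmod M) :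
  raction p m = (rhom_fun p.2 m, 0).
Proof.
rewrite /raction -[LHS]/(coind_scale _ _) /coind_scale /=.
by rewrite !scale0r add0r.
Qed.

Lemma coind_lscale X (a : R^c) (p : rbase (coind X)) : a *: p = (a *: p.1, a *: p.2).
Proof.
rewrite -[LHS]/(coind_scale (triv_inlc M a) p) /coind_scale /=; congr pair.
by rewrite -[X in _ + X]/(rhom_fun p.2 (0 : rmod M)) rhom_fun0 addr0.
Qed.

Fact coind_in_linear X : linear (fun x : X => (x, 0) : rbase (coind X)).
Proof. by move=> a x y; rewrite coind_lscale; congr pair; rewrite /= raddf0 addr0. Qed.
Definition coind_in X : {linear X -> rbase (coind X)} := to_linear (@coind_in_linear X).

Fact coind_out_linear X : linear (fun p : rbase (coind X) => p.1).
Proof. by move=> a x y; rewrite coind_lscale. Qed.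
Definition coind_out X : {linear rbase (coind X) -> X} := to_linear (@coind_out_linear X).

Fact coind_snd_linear X : linear (fun p : rbase (coind X) => p.2).
Proof. by move=> a x y; rewrite coind_lscale. Qed.
Definition coind_snd X : {linear rbase (coind X) -> rhom M X} := to_linear (@coind_snd_linear X).

Definition ract W : {linear rbase W -> rhom M (rbase W)} := @rpair_map R M W.

Lemma ractE W (y : rbase W) m : rhom_fun (ract W y) m = raction y m.
Proof. by []. Qed.

Fact coind_adj_lb_linear W X (e : {linear rbase W -> X}) :
  linear (fun y : rbase W => (e y, rhmap M e (ract W y)) : rbase (coind X)).
Proof. by move=> a x y; rewrite coind_lscale !linearP. Qed.

Fact coind_adj_linear W X (e : {linear rbase W -> X}) :
  linear (fun y : W => (e y, rhmap M e (ract W y)) : coind X).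
Proof.
apply: (@linear_of_rb W (coind X) (to_linear (coind_adj_lb_linear e))) => y m.
rewrite coind_act; congr pair.
apply: rhomP => m'; rewrite rhmapE ractE raction_raction; exact: linear0.
Qed.

(** Coinduction is right adjoint to restriction. *)
Definition coind_adj W X (e : {linear rbase W -> X}) : {linear W -> coind X} :=
  to_linear (coind_adj_linear e).

Lemma coind_adjE W X (e : {linear rbase W -> X}) y :
  coind_adj e y = (e y, rhmap M e (ract W y)).
Proof. by []. Qed.

Lemma coind_ext W X (f g : {linear W -> coind X}) :
  (forall y, (f y).1 = (g y).1) -> forall y, f y = g y.
Proof.
move=> fg y; have E (h : {linear W -> coind X}) m :
    rhom_fun (h y).2 m = (h (raction (y : rbase W) m)).1.
  by have := rb_act h y m; rewrite coind_act => /(congr1 (fun p => p.1)).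
rewrite [LHS]surjective_pairing [RHS]surjective_pairing fg; congr pair.
by apply: rhomP => m; rewrite !E fg.
Qed.

Lemma coind_inj X : injective_mod X -> injective_mod (coind X : lmodType T^c).
Proof.
move=> Xinj A B f h fI.
have [k kP] := Xinj _ _ (rb f) (coind_out X \o rb h) fI.
exists (coind_adj k) => a.
apply: (coind_ext (f := h) (g := coind_adj k \o f)) => y.
exact: kP.
Qed.

(** The data of [Psi]: k is a kernel of W -> Hom(M, W). *)
Record ker_act W Z (k : {linear Z -> rbase W}) : Prop := KerAct {
  keract_inj : injective k;
  keract_exact : exact_at k (ract W) }.

Lemma ker_act_kincl W : ker_act (kincl (ract W)).
Proof. by split; [exact: kincl_inj | exact: kinclP]. Qed.

Lemma ract0P W (y : rbase W) : ract W y = 0 <-> forall m, raction y m = 0.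
Proof.
split=> [y0 m|y0]; first by rewrite -ractE y0.
by apply: rhomP => m; exact: y0.
Qed.

Lemma keract_raction W Z (k : {linear Z -> rbase W}) z m : ker_act k -> raction (k z) m = 0.
Proof. by case=> _ kx; move: m; apply/ract0P/kx; exists z. Qed.

Lemma keract_lift W Z (k : {linear Z -> rbase W}) y :
  ker_act k -> (forall m, raction y m = 0) -> exists z, k z = y.
Proof. by case=> _ kx /ract0P/kx. Qed.

(** A T-linear map from a module killed by M lands in the kernel of the action. *)
Lemma rtriv_lift W Z (k : {linear Z -> rbase W}) X (l : {linear rtriv M X -> W}) :
  ker_act k -> exists k' : {linear X -> Z}, forall x, k (k' x) = l x.
Proof.
move=> kk; have ll : linear (l : X -> rbase W).
  by move=> a x y; exact: (linearP l (triv_inlc M a)).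
apply: (lin_lift (h := to_linear ll) (keract_inj kk)) => x; apply: (keract_lift kk) => m.
by rewrite -[to_linear ll x]/(rb l x) -rb_act rtriv_act linear0.
Qed.

Hypothesis MM0 : forall t : btensor M M, t = 0.

(** The map m (x) m' |-> h(m)m' is defined on M (x) M = 0. *)
Lemma rhom_raction W (h : rhom M (rbase W)) m m' : raction (rhom_fun h m) m' = 0.
Proof.
have b : balanced (fun (m : rmod M) (m' : M) => raction (rhom_fun h m) m').
  split=> [n k k'|k n n'|r k n].
  - by rewrite rhom_funD ractionD.
  - by have := raction_linear (rhom_fun h k) 1 n n'; rewrite !scale1r.
  - rewrite rhom_funZ.
    exact: (@raction_scale R M W (triv_inlc M r) (rhom_fun h k) n).
rewrite -[LHS](tliftE b m (m' : M)); move: (tens m _) => t.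
by rewrite (MM0 t : t = 0) raddf0.
Qed.

(** Every R-linear map M -> W takes values in the elements killed by M. *)
Lemma keract_rhom W Z (k : {linear Z -> rbase W}) (h : rhom M (rbase W)) :
  ker_act k -> exists h', rhmap M k h' = h.
Proof.
move=> kk; apply: (rhmap_lift (keract_inj kk)) => m.
by apply: (keract_lift kk) => m'; exact: rhom_raction.
Qed.

(** Hom(M, W) = Hom(M, Z) for the submodule Z killed by M, so W is an extension
    of Hom(M, Z) by Z. *)
Lemma keract_ses W Z (k : {linear Z -> rbase W}) : ker_act k -> surj (ract W) ->
  exists p : {linear rbase W -> rhom M Z},
    (forall y, rhmap M k (p y) = ract W y) /\ ses k p.
Proof.
move=> kk rS; have kMI := rhmap_inj (M := M) (keract_inj kk).
have [p pP] : exists p : {linear rbase W -> rhom M Z}, forall y, rhmap M k (p y) = ract W y.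
  by apply: lin_lift => // y; apply: keract_rhom.
exists p; split=> //; split=> [|h|y]; first exact: keract_inj kk.
  by have [y yh] := rS (rhmap M k h); exists y; apply: kMI; rewrite pP.
rewrite -(keract_exact kk) -pP; split=> [->|]; first exact: linear0.
exact: (inj_ker0 kMI).
Qed.

(** Seen as a map from M to the module coinduced from X, where M acts by
    evaluation, h satisfies h(m)m' = 0. *)
Lemma rhom2_eq0 X (h : rhom M (rhom M X)) : h = 0.
Proof.
apply: rhomP => m; rewrite rhom0; apply: rhomP => m'.
have sl : linear (fun h : rhom M X => (0, h) : rbase (coind X)).
  by move=> a x y; rewrite coind_lscale; congr pair; rewrite /= scaler0 addr0.
have := @rhom_raction (coind X) (rhmap M (to_linear sl) h) m m'.
by rewrite coind_act rhmapE => -[].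
Qed.
End RightModules.

(** * Ext and FP-injective dimension *)

Section ExtDimension.
Variable S : nzRingType.
Implicit Types A B C K L N X Y Z E J P : lmodType S.

Lemma extnS n Y X J C (f : {linear X -> J}) (g : {linear J -> C}) :
  ses f g -> injective_mod J -> extn n.+1 Y X <-> extn n Y C.
Proof.
move=> fg Jinj; apply: (ext1_shift (ses_cover (syzn n Y)) _ fg Jinj).
exact: free_projective.
Qed.

Lemma extn_quot n Y A B C (f : {linear A -> B}) (g : {linear B -> C}) :
  ses f g -> extn n Y B -> extn n.+1 Y A -> extn n Y C.
Proof.
move=> fg; apply: (ext1_quot (ses_cover (syzn n Y)) _ fg).
exact: free_projective.
Qed.

(** Exactness of Ext^1(Y, A) -> Ext^1(Y, B) -> Ext^1(Y, C). *)
Lemma ext1_ext Y A B C (f : {linear A -> B}) (g : {linear B -> C}) :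
  ses f g -> ext1 Y A -> ext1 Y C -> ext1 Y B.
Proof.
move=> fg YA YC; have cP := @free_projective S Y.
apply: (ext1_of_proj (ses_cover Y) cP) => h.
have [u uP] := YC _ _ _ _ (ses_cover Y) (g \o h).
have [u' u'P] := cP _ _ g u (ses_surj fg).
have [v vP] : exists v : {linear kermod (cover Y) -> A},
    forall x, f (v x) = (h \- (u' \o kincl (cover Y))) x.
  apply: (lift_ker fg) => x.
  by rewrite -[LHS]/(g (h x - u' (kincl (cover Y) x))) linearB -u'P -uP subrr.
have [w wP] := YA _ _ _ _ (ses_cover Y) v.
exists (u' \+ (f \o w)) => x.
rewrite -[RHS]/(u' (kincl (cover Y) x) + f (w (kincl (cover Y) x))) -wP vP.
by rewrite -[X in _ + X]/(h x - u' (kincl (cover Y) x)) addrC subrK.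
Qed.

Lemma extn_ext n Y A B C (f : {linear A -> B}) (g : {linear B -> C}) :
  ses f g -> extn n Y A -> extn n Y C -> extn n Y B.
Proof. exact: ext1_ext. Qed.

Lemma ext1_retractl N N' Z (i : {linear N -> N'}) (r : {linear N' -> N}) :
  (forall x, r (i x) = x) -> ext1 N' Z -> ext1 N Z.
Proof.
move=> ri N'Z; have [J [C [f [g [fg Jinj]]]]] := enough_injectives Z.
apply: (ext1_of_inj fg Jinj) => h.
have [l lP] := ext1_lift N'Z fg (h \o r).
by exists (l \o i) => x; rewrite /= lP /= ri.
Qed.

(** Projective dimension < n + 1 in terms of Ext; the induction moves the syzygies
    to cosyzygies in the other variable. *)
Lemma dim_lt_extn n Y X : dim_lt (@projective S) n Y -> extn n Y X.
Proof.
elim: n Y X => [|n IHn] Y X; first exact: ext1_0l.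
move=> [K [P [a [b [ab Ppr /IHn KX]]]]].
have {IHn}: extn n K X by [].
elim: n X {KX} => [|n IHn] X; have [J [C [f [g [fg Jinj]]]]] := enough_injectives X.
  by move=> /(ext1_shift ab Ppr fg Jinj) YC; apply/(extnS 0 Y fg Jinj).
by move=> /(extnS n K fg Jinj)/IHn YC; apply/(extnS n.+1 Y fg Jinj).
Qed.

(** Exact sequences of modules with vanishing Ext from Y stay exact under
    Hom(Y, -) once Y has finite projective dimension: go far enough to the left. *)
Lemma ext1_resolved n Y (G : lmodType S -> Prop) :
  dim_lt (@projective S) n Y ->
  (forall Z, G Z -> exists (Z' Q : lmodType S) (f : {linear Z' -> Q}) (g : {linear Q -> Z}),
    [/\ ses f g, forall j, extn j Y Q & G Z']) ->
  forall Z, G Z -> ext1 Y Z.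
Proof.
move=> Yn prev; have : forall Z, G Z -> extn n Y Z by move=> Z _; exact: dim_lt_extn.
elim: n {Yn} => [//|n IHn] GZ; apply: IHn => Z /prev[Z' [Q [f [g [fg QY GZ']]]]].
exact: (extn_quot fg (QY n) (GZ _ GZ')).
Qed.

(** Vanishing of Ext^(n+1)(L, X), along resolutions by finitely presented modules. *)
Fixpoint ext_at n L X : Prop :=
  if n is n'.+1 then forall (K P : lmodType S) (a : {linear K -> P}) (b : {linear P -> L}),
    ses a b -> projective P -> finitely_presented K -> ext_at n' K X
  else ext1 L X.

(** Finitely presented modules then have projective resolutions all of whose
    syzygies are finitely presented; coherent rings have this property. *)
Definition fp_kernels := forall L, finitely_presented L ->
  exists (K P : lmodType S) (a : {linear K -> P}) (b : {linear P -> L}),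
    [/\ ses a b, projective P & finitely_presented K].

Lemma ext_at_cosyz n L X J C (f : {linear X -> J}) (g : {linear J -> C}) :
  fp_kernels -> ses f g -> injective_mod J -> finitely_presented L ->
  ext_at n.+1 L X -> ext_at n L C.
Proof.
move=> coh fg Jinj; elim: n L => [|n IHn] L Lfp LX.
  have [K [P [a [b [ab Ppr Kfp]]]]] := coh _ Lfp.
  by apply/(ext1_shift ab Ppr fg Jinj); exact: LX ab Ppr Kfp.
by move=> K P a b ab Ppr Kfp; apply: IHn => //; exact: LX ab Ppr Kfp.
Qed.

(** Finite FP-injective dimension: all but the last term of an injective
    coresolution are injective, and the last one is FP-injective. *)
Lemma di_orth_ext_at n X : fp_kernels ->
  (forall L, finitely_presented L -> ext_at n L X) -> di_orth X.
Proof.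
move=> coh; elim: n X => [|n IHn] X LX; first exact/di_orth_FP/FP_injectiveP.
have [J [C [f [g [fg Jinj]]]]] := enough_injectives X.
apply: (di_orth_sub fg).
  by apply/di_orth_FP/FP_injectiveP => L _; exact: ext1_inj.
by apply: IHn => L Lfp; apply: (ext_at_cosyz coh fg) => //; exact: LX.
Qed.
End ExtDimension.

Section TensorFP.
Variables (R : nzRingType) (M : bimodType R).
Implicit Types (K L P E X : lmodType R^c).

(** [hat] and [unhat] are the adjunction Hom(K (x) M, E) = Hom(K, Hom(M, E)). *)
Fact hat_balanced K E (h : {linear K -> rhom M E}) :
  balanced (fun (k : K) (m : M) => rhom_fun (h k) (m : rmod M)).
Proof.
split=> [m k k'|k m m'|r k m].
- by rewrite linearD.
- exact: (rhom_funD (h k)).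
- by rewrite linearZ.
Qed.

Definition hat_additive K E (h : {linear K -> rhom M E}) : {additive rbtensor M K -> E} :=
  tlift (hat_balanced h).

Fact hat_linear K E (h : {linear K -> rhom M E}) : linear (hat_additive h).
Proof.
apply: rbtensor_linear => a k m; rewrite [LHS]tliftE.
by rewrite -[X in _ = _ *: X]/(tlift (hat_balanced h) _) tliftE -rhom_funZ.
Qed.

Definition hat K E (h : {linear K -> rhom M E}) : {linear rbtensor M K -> E} :=
  to_linear (hat_linear h).

Lemma hatE K E (h : {linear K -> rhom M E}) (k : K) (m : M) :
  hat h (tens k m) = rhom_fun (h k) m.
Proof. exact: (tliftE (hat_balanced h)). Qed.

Fact unhat_fun_linear P E (l : {linear rbtensor M P -> E}) (p : P) :
  linear (fun m : rmod M => l (tens p (m : M))).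
Proof.
move=> a m n; rewrite -linearZZ rbtensZ -linearD; congr (l _).
exact: (@tensDr R P M).
Qed.

Fact unhat_linear P E (l : {linear rbtensor M P -> E}) :
  linear (fun p => to_rhom (unhat_fun_linear l p)).
Proof.
move=> a p q; apply: rhomP => m; rewrite rhomD rhomZ !to_rhomE -linearD.
by congr (l _); rewrite -tensZ; exact: (@tensDl R P M).
Qed.

Definition unhat P E (l : {linear rbtensor M P -> E}) : {linear P -> rhom M E} :=
  to_linear (unhat_linear l).

Lemma rbtl_exact K L X (f : {linear K -> L}) (g : {linear L -> X}) :
  surj g -> exact_at f g -> exact_at (rbtl M f) (rbtl M g).
Proof.
move=> gS fg t; split=> [|[s <-]]; first by apply: (tl_exact gS) => y /fg.
rewrite -[LHS]/(tl _ _ (tl _ _ s)) (tl_comp (b := \0)); first exact: tl_eq0.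
by move=> k; apply/fg; exists k.
Qed.

(** If Tor_1(L, M) = 0 then an extension problem for Hom(M, E) along K -> P is one
    for E along K (x) M -> P (x) M, whose cokernel is L (x) M. *)
Lemma ext1_rhom L E : tor1 L (M : lmodType R) -> ext1 (rbtensor M L : lmodType R^c) E ->
  ext1 L (rhom M E).
Proof.
move=> LM LE; have sc := ses_cover L.
apply: (ext1_of_proj sc); first exact: free_projective.
move=> h.
have st : ses (rbtl M (kincl (cover L))) (rbtl M (cover L)).
  split.
  - by have /tor1P/(_ _ _ _ _ sc) := LM; exact.
  - exact: tl_surj (ses_surj sc).
  - exact: rbtl_exact (ses_surj sc) (ses_exact sc).
have [l lP] := LE _ _ _ _ st (hat h).
exists (unhat l) => k; apply: rhomP => m.
rewrite -hatE lP to_rhomE; congr (l _); exact: tlE.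
Qed.

Lemma fp_rbtensor_rV n : finitely_presented (rmod M : lmodType R^c) ->
  finitely_presented (rbtensor M 'rV[R^c]_n : lmodType R^c).
Proof.
move=> Mfp; apply: (rV_ind (Pr := fun L => finitely_presented (rbtensor M L : lmodType R^c)))
  => [A A0||A B C f g r fg rf Afp Cfp].
- apply: fp_0 => t; apply: (tensor_ext (f := idfun) (g := \0)) => a m.
  by rewrite -[LHS]/(tens a m) [a]A0 tens0l.
- have gl : linear (fun m : rmod M => tens (const_mx 1 : 'rV[R^c]_1) (m : M) : rbtensor M 'rV[R^c]_1).
    move=> a m m'; rewrite rbtensZ; exact: (@tensDr R 'rV[R^c]_1 M).
  have bb : balanced (fun (x : 'rV[R^c]_1) (m : M) => (x 0 0 : R) *: m).
    split=> [m x y|x m m'|r x m].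
    + by rewrite mxE scalerDl.
    + exact: scalerDr.
    + by rewrite mxE scalerA.
  apply: (fp_isom (g := to_linear gl)) => //.
    apply: (can_inj (g := (tlift bb : rbtensor M 'rV[R^c]_1 -> rmod M))) => m.
    by rewrite [LHS]tliftE mxE; exact: (scale1r (m : M)).
  elim/rbtensor_ind => [|s t [m <-] [m' <-]|x m].
  + by exists 0; rewrite linear0.
  + by exists (m - m'); rewrite linearB.
  + exists ((x 0 0 : R) *: m); rewrite -[LHS]/(tens _ _) -tensZ; congr tens.
    by apply/rowP => j; rewrite [j]ord1 !mxE; exact: (mul1r (x 0 0 : R)).
- apply: (@fp_ext _ _ _ _ (rbtl M f) (rbtl M g)) => //; split.
  + apply: (can_inj (g := rbtl M r)) => t.
    rewrite -[LHS]/(tl r M (tl f M t)) (tl_comp (b := idfun)) //; exact: tmap_id.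
  + exact: tl_surj (ses_surj fg).
  + exact: rbtl_exact (ses_surj fg) (ses_exact fg).
Qed.

(** - (x) M is right exact and takes R to M. *)
Lemma fp_rbtensor L : finitely_presented (rmod M : lmodType R^c) ->
  finitely_presented L -> finitely_presented (rbtensor M L : lmodType R^c).
Proof.
move=> Mfp [m [n [q [p [pS qp]]]]].
apply: (@fp_coker _ _ _ _ (rbtl M q) (rbtl M p)).
- exact: tl_surj pS.
- exact: rbtl_exact.
- exact/fp_fg/fp_rbtensor_rV.
- exact: fp_rbtensor_rV.
Qed.

(** Syzygies of L shift Tor(L, M) down to Tor_1, where the adjunction
    applies. *)
Lemma ext_at_rhom n L E : finitely_presented (rmod M : lmodType R^c) ->
  FP_injective E -> finitely_presented L -> tor_at n L (M : lmodType R) ->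
  ext_at n L (rhom M E).
Proof.
move=> Mfp /FP_injectiveP EP; elim: n L => [|n IHn] L Lfp LM.
  by apply: ext1_rhom => //; apply/EP/fp_rbtensor.
by move=> K P a b ab Ppr Kfp; apply: IHn => //; exact: LM ab Ppr.
Qed.
End TensorFP.

(** * Finiteness over R and over the trivial extension *)

Section Transfer.
Variables (R : nzRingType) (M : bimodType R).
Hypothesis MM0 : forall t : btensor M M, t = 0.
Local Notation T := (trivext M).
Implicit Types (W V E : lmodType T^c) (X Y Z L : lmodType R^c).

Fact pr_row_linear n :
  linear (fun y : rbase 'rV[T^c]_n => \row_i ((y : 'rV[T^c]_n) 0 i : T).1 : 'rV[R^c]_n).
Proof.
move=> a x y; apply/rowP => i; rewrite !mxE.
by rewrite -[LHS]/((x 0 i : T).1 * a + (y 0 i : T).1).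
Qed.
Definition pr_row n : {linear rbase 'rV[T^c]_n -> 'rV[R^c]_n} := to_linear (@pr_row_linear n).

Definition in_row n (x : 'rV[R^c]_n) : 'rV[T^c]_n := \row_i triv_inlc M (x 0 i).

Lemma pr_in_row n (x : 'rV[R^c]_n) : pr_row n (in_row x) = x.
Proof. by apply/rowP => i; rewrite !mxE. Qed.

Lemma pr_row_surj n : surj (pr_row n).
Proof. by move=> x; exists (in_row x); exact: pr_in_row. Qed.

Lemma pr_row_act n (y : rbase 'rV[T^c]_n) m : pr_row n (raction y m) = 0.
Proof. by apply/rowP => i; rewrite !mxE -[LHS]/((y 0 i : T).1 * 0) mulr0. Qed.

Lemma pr_row_scale n (s : T^c) (y : 'rV[T^c]_n) :
  pr_row n (s *: y) = ((s : T).1 : R^c) *: pr_row n y.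
Proof. by apply/rowP => i; rewrite !mxE. Qed.

Lemma pr_row_ker n (y : rbase 'rV[T^c]_n) : pr_row n y = 0 ->
  y = \sum_i raction (delta_mx 0 i : rbase 'rV[T^c]_n) (((y : 'rV[T^c]_n) 0 i : T).2 : rmod M).
Proof.
move=> y0; rewrite [LHS](row_sum_delta (y : 'rV[T^c]_n)).
apply: eq_bigr => i _; set m := ((y : 'rV[T^c]_n) 0 i : T).2.
have yi : (y : 'rV[T^c]_n) 0 i = triv_inr m.
  rewrite [LHS](trivext_split ((y : 'rV[T^c]_n) 0 i : T)).
  have /rowP/(_ i) := y0; rewrite !mxE => ->.
  by rewrite -[RHS]add0r; congr (_ + _).
by rewrite [in LHS]yi.
Qed.

Lemma raction_sum_kill V X (q : {linear rbase V -> X}) n (v : 'I_n -> rbase V)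
    (m : 'I_n -> rmod M) :
  (forall y m, q (raction y m) = 0) -> q (\sum_i raction (v i) (m i)) = 0.
Proof. by move=> q0; rewrite linear_sum big1. Qed.

(** Maps killing the action of M do not see the summand M^n of T^n. *)
Lemma factor_pr_row n V X (p : {linear 'rV[T^c]_n -> V}) (q : {linear rbase V -> X}) :
  (forall y m, q (raction y m) = 0) ->
  exists k : {linear 'rV[R^c]_n -> X}, forall y, q (p y) = k (pr_row n y).
Proof.
move=> q0; apply: (lin_factor (h := q \o rb p) (@pr_row_surj n)) => y /pr_row_ker ->.
rewrite /= linear_sum linear_sum big1 // => i _.
by rewrite rb_act q0.
Qed.

Lemma fg_descend V X (q : {linear rbase V -> X}) :
  surj q -> (forall y m, q (raction y m) = 0) ->
  finitely_generated V -> finitely_generated X.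
Proof.
move=> qS q0 [n [p pS]]; have [k kP] := factor_pr_row p q0.
exists n, k => x; have [v <-] := qS x; have [y <-] := pS v.
by exists (pr_row n y); rewrite -kP.
Qed.

(** V / VM is finitely presented over R when V is so over T: this is the functor
    - (x)_T R, which is right exact and takes T to R. *)
Lemma fp_descend V X (q : {linear rbase V -> X}) :
  surj q -> (forall y m, q (raction y m) = 0) ->
  (forall y, q y = 0 -> exists n (v : 'I_n -> rbase V) m, y = \sum_i raction (v i) (m i)) ->
  finitely_presented V -> finitely_presented X.
Proof.
move=> qS q0 qker /fpP[n [p [pS Kfg]]]; have [k kP] := factor_pr_row p q0.
apply/fpP; exists n, k; split.
  by move=> x; have [v <-] := qS x; have [y <-] := pS v; exists (pr_row n y); rewrite -kP.
have [u uP] : exists u : {linear rbase (kermod p) -> kermod k},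
    forall y, kincl k (u y) = (pr_row n \o rb (kincl p)) y.
  apply: lin_lift (kincl_inj (f := k)) _ => y; apply/kinclP.
  rewrite -[LHS]/(k (pr_row n (kincl p y))) -kP kincl0; exact: linear0.
apply: (fg_descend (q := u)) Kfg => [x|y m]; last first.
  apply: (kincl_inj (f := k)); rewrite uP linear0.
  by rewrite -[LHS]/(pr_row n (rb (kincl p) (raction y m))) rb_act pr_row_act.
have [y yx] := @pr_row_surj n (kincl k x).
have [|N [v [m vm]]] := qker (p y); first by rewrite kP yx kincl0.
have /choice[w wP] : forall i, exists y, p y = v i by move=> i; exact: pS.
pose z : rbase 'rV[T^c]_n := \sum_i raction (w i : rbase 'rV[T^c]_n) (m i).
have /kinclP[s sE] : p (y - z) = 0.
  rewrite linearB vm -[p z]/(rb p z) linear_sum.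
  apply/eqP; rewrite subr_eq0; apply/eqP/eq_bigr => i _.
  by rewrite rb_act -[rb p (w i)]/(p (w i)) wP.
exists s; apply: (kincl_inj (f := k)); rewrite uP -[LHS]/(pr_row n (kincl p s)) sE.
rewrite -[LHS]/(pr_row n ((y : rbase _) - z)) linearB yx.
by rewrite (raction_sum_kill _ _ (@pr_row_act n)) subr0.
Qed.

(** The sequence 0 -> M -> T -> R -> 0 of right T-modules. *)
Fact trivext_in_linear : linear (fun m : rtriv M (rmod M) => const_mx (triv_inr (m : M)) : 'rV[T^c]_1).
Proof.
move=> s m n; apply/rowP => i; rewrite !mxE triv_inrD; congr (_ + _).
rewrite -[RHS]/(triv_inr (m : M) * (s : T)) [s in RHS]trivext_split mulrDr.
by rewrite triv_inr_inr addr0 triv_inrZr.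
Qed.
Definition trivext_in : {linear rtriv M (rmod M) -> 'rV[T^c]_1} := to_linear trivext_in_linear.

Fact trivext_out_linear : linear (pr_row 1 : 'rV[T^c]_1 -> rtriv M 'rV[R^c]_1).
Proof. by apply: linear_to_rtriv => y m; exact: pr_row_act. Qed.
Definition trivext_out : {linear 'rV[T^c]_1 -> rtriv M 'rV[R^c]_1} := to_linear trivext_out_linear.

Lemma ses_trivext : ses trivext_in trivext_out.
Proof.
split=> [m n /rowP/(_ 0)||y]; first by rewrite !mxE => -[].
  exact: pr_row_surj.
split=> [y0|[m <-]]; last by apply/rowP => i; rewrite !mxE.
exists ((y 0 0 : T).2 : M); apply/rowP => i; rewrite [i]ord1 !mxE [RHS](trivext_split (y 0 0 : T)).
have /rowP/(_ 0) := y0; rewrite !mxE => ->.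
by rewrite -[LHS]add0r; congr (_ + _).
Qed.

Lemma ses_rtriv X Y Z (f : {linear X -> Y}) (g : {linear Y -> Z}) :
  ses f g -> ses (rtriv_map M f) (rtriv_map M g).
Proof. exact: ses_restr. Qed.

Lemma fg_rtriv X : finitely_generated X -> finitely_generated (rtriv M X).
Proof.
move=> [n [p pS]].
have l : linear (p \o pr_row n : 'rV[T^c]_n -> rtriv M X).
  apply: (linear_to_rtriv (h := p \o pr_row n)) => y m.
  exact: (etrans (congr1 p (pr_row_act y m)) (linear0 p)).
exists n, (to_linear l) => x; have [z <-] := pS x.
by have [y <-] := pr_row_surj z; exists y.
Qed.

Lemma fp_rtriv_rV1 : finitely_generated (rmod M : lmodType R^c) ->
  finitely_presented (rtriv M 'rV[R^c]_1).
Proof.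
move=> Mfg; apply: (@fp_coker _ _ _ _ trivext_in trivext_out).
- exact: ses_surj ses_trivext.
- exact: ses_exact ses_trivext.
- exact: fg_rtriv.
- exact: fp_rV.
Qed.

Lemma fp_rtriv L : finitely_generated (rmod M : lmodType R^c) ->
  finitely_presented L -> finitely_presented (rtriv M L).
Proof.
move=> Mfg [m [n [q [p [pS qp]]]]].
have frV k : finitely_presented (rtriv M 'rV[R^c]_k).
  apply: (rV_ind (Pr := fun L => finitely_presented (rtriv M L))) => [A A0||A B C f g r fg _].
  - exact: fp_0.
  - exact: fp_rtriv_rV1.
  - exact: fp_ext (ses_rtriv fg).
apply: (@fp_coker _ _ _ _ (rtriv_map M q) (rtriv_map M p)).
- exact: pS.
- exact: qp.
- exact/fp_fg/frV.
- exact: frV.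
Qed.

(** The elements killed by M represent maps from R-modules, and a finitely
    presented R-module stays so over T because T / M is finitely presented. *)
Lemma FP_injective_ker E Z (k : {linear Z -> rbase E}) :
  finitely_generated (rmod M : lmodType R^c) ->
  ker_act k -> FP_injective E -> FP_injective Z.
Proof.
move=> Mfg kk /FP_injectiveP EP; apply/FP_injectiveP => L Lfp A B f g fg h.
have h0 x m : raction ((k \o h) x) m = 0 by exact: (keract_raction _ _ kk).
have [l lP] := EP _ (fp_rtriv Mfg Lfp) _ _ _ _ (ses_rtriv fg) (to_linear (linear_of_rtriv h0)).
have [k' k'P] := rtriv_lift l kk.
by exists k' => a; apply: (keract_inj kk); rewrite k'P; exact: lP.
Qed.

(** By M (x) M = 0 a map M -> E is T-linear, and it extends along M -> T because
    T / M = R is finitely presented; the value at 1 induces it. *)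
Lemma FP_injective_ract E : finitely_generated (rmod M : lmodType R^c) ->
  FP_injective E -> surj (ract E).
Proof.
move=> Mfg /FP_injectiveP EP h.
have h0 x m : raction (rhom_lin h x) m = 0 by exact: rhom_raction.
have [l lP] := EP _ (fp_rtriv_rV1 Mfg) _ _ _ _ ses_trivext (to_linear (linear_of_rtriv h0)).
exists (l (const_mx 1)); apply: rhomP => m; rewrite ractE.
rewrite -[LHS](rb_act l (const_mx 1 : rbase 'rV[T^c]_1) m).
rewrite -[RHS]/(to_linear (linear_of_rtriv h0) (m : rtriv M (rmod M))) lP.
congr (l _); apply/rowP => i; rewrite !mxE; exact: (mul1r (triv_inr (m : M))).
Qed.

(** Restriction is exact and takes T to R + M. *)
Lemma fp_rbase : finitely_presented (rmod M : lmodType R^c) ->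
  forall V, finitely_presented V -> finitely_presented (rbase V).
Proof.
move=> Mfp V [m [n [q [p [pS qp]]]]].
have frV k : finitely_presented (rbase 'rV[T^c]_k).
  apply: (rV_ind (Pr := fun V => finitely_presented (rbase V))) => [A A0||A B C f g r fg _].
  - exact: fp_0.
  - apply: (fp_ext (ses_rb ses_trivext)).
      exact: Mfp.
    exact: (fp_rV R^c 1).
  - exact: (fp_ext (ses_rb fg)).
apply: (@fp_coker _ _ _ _ (rb q) (rb p)).
- exact: pS.
- exact: qp.
- exact/fp_fg/frV.
- exact: frV.
Qed.

(** Coinduction is right adjoint to restriction, which is exact and preserves
    finite presentation. *)
Lemma FP_injective_coind X : finitely_presented (rmod M : lmodType R^c) ->
  FP_injective X -> FP_injective (coind M X : lmodType T^c).
Proof.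
move=> Mfp /FP_injectiveP XP; apply/FP_injectiveP => V Vfp A B f g fg h.
have fg' := ses_rb fg.
have [k kP] := XP _ (fp_rbase Mfp Vfp) _ _ _ _ fg' (coind_out M X \o rb h).
exists (coind_adj k) => a.
apply: (coind_ext (f := h) (g := coind_adj k \o f)) => y; exact: kP.
Qed.

(** * Coherence *)

Hypothesis Tcoh : left_coherent T^c.

(** M is a finitely generated right ideal of T, hence finitely presented over T,
    and it descends to R because M acts on it as zero. *)
Lemma fp_bimod : finitely_generated (rmod M : lmodType R^c) ->
  finitely_presented (rmod M : lmodType R^c).
Proof.
move=> /fg_rtriv Mfg.
have Mfp := coherent_sub Tcoh (ses_inj ses_trivext) Mfg.
have il : linear (fun m : rbase (rtriv M (rmod M)) => (m : rmod M)) by [].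
apply: (fp_descend (q := to_linear il)) Mfp => [m|y m|y /= ->].
- by exists m.
- exact: (@rtriv_act R M (rmod M) y m).
- by exists 0%N, (fun _ => 0), (fun _ => 0); rewrite big_ord0.
Qed.

(** A finitely generated A in R^m generates a submodule AT = A + AM of T^m, which
    is finitely presented, and A = AT / AM. *)
Lemma fp_sub_rV m (A : lmodType R^c) (i : {linear A -> 'rV[R^c]_m}) :
  injective i -> finitely_generated A -> finitely_presented A.
Proof.
move=> iI [n [p pS]].
pose w j : 'rV[T^c]_m := in_row (i (p (delta_mx 0 j))).
have wl : linear (fun x : 'rV[T^c]_n => \sum_j x 0 j *: w j).
  move=> a x y; rewrite scaler_sumr -big_split; apply: eq_bigr => j _.
  by rewrite !mxE scalerDl scalerA.
pose P := to_linear wl.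
have prP (x : 'rV[T^c]_n) : pr_row m (P x) = i (p (pr_row n x)).
  have -> : pr_row m (P x) = \sum_j pr_row m (x 0 j *: w j) by exact: (linear_sum (pr_row m)).
  rewrite [pr_row n x in RHS]row_sum_delta 2!linear_sum; apply: eq_bigr => j _.
  by rewrite pr_row_scale pr_in_row !linearZ /= mxE.
have Pin (z : 'rV[R^c]_n) : P (in_row z) = in_row (i (p z)).
  rewrite [z in RHS]row_sum_delta 2!linear_sum; apply/rowP => l.
  rewrite !mxE /P /= !summxE; apply/esym.
  rewrite (raddf_sum (@triv_inlc R M : {rmorphism R^c -> T^c})); apply: eq_bigr => j _.
  rewrite !linearZ !mxE.
  exact: (rmorphM (@triv_inlc R M : {rmorphism R^c -> T^c})).
have [c cP] : exists c : {linear 'rV[T^c]_n -> immod P}, forall x, iincl P (c x) = P x.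
  by apply: lin_lift (iincl_inj (f := P)) _ => x; apply/iinclP; exists x.
have cS : surj c.
  move=> y; have [x xy] : exists x, P x = iincl P y by apply/iinclP; exists y.
  by exists x; apply: (iincl_inj (f := P)); rewrite cP.
have Vfp : finitely_presented (immod P).
  by apply: (coherent_sub Tcoh (iincl_inj (f := P))); apply: fg_quot cS _; exact: fg_rV.
have [q qP] : exists q : {linear rbase (immod P) -> A},
    forall y, i (q y) = (pr_row m \o rb (iincl P)) y.
  apply: lin_lift => // y; have [x <-] := cS y.
  by exists (p (pr_row n x)); rewrite -prP -cP.
have qc x : q (c x) = p (pr_row n x).
  by apply: iI; rewrite qP -prP -cP.
apply: (fp_descend (q := q)) Vfp => [a|y l|y].
- have [x <-] := pS a; have [x' <-] := pr_row_surj x.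
  by exists (c x'); rewrite qc.
- apply: iI; rewrite qP linear0.
  by rewrite -[LHS]/(pr_row m (rb (iincl P) (raction y l))) rb_act pr_row_act.
- have [x <-] := cS y; rewrite qc => x0.
  pose x1 : rbase 'rV[T^c]_n := x - in_row (pr_row n x).
  have x10 : pr_row n x1 = 0 by rewrite linearB pr_in_row subrr.
  have cx : c x = c x1.
    apply: (iincl_inj (f := P)); rewrite !cP /x1 linearB Pin x0 linear0.
    have -> : in_row (0 : 'rV[R^c]_m) = 0 by apply/rowP => l; rewrite !mxE.
    by rewrite subr0.
  exists n, (fun j => rb c (delta_mx 0 j)), (fun j => ((x1 : 'rV[T^c]_n) 0 j : T).2).
  rewrite cx -[LHS]/(rb c x1) [in LHS](pr_row_ker x10) linear_sum.
  by apply: eq_bigr => j _; rewrite rb_act.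
Qed.

Lemma fp_kernels_coherent : fp_kernels R^c.
Proof.
move=> L /fpP[n [p [pS Kfg]]].
exists (kermod p), 'rV[R^c]_n, (kincl p), p; split.
- exact: ses_kincl.
- exact: rV_projective.
- exact: fp_sub_rV (kincl_inj (f := p)) Kfg.
Qed.
End Transfer.

(** * Ding injective modules over the trivial extension *)

Lemma pair_inj (A B : Type) (p q : A * B) : p = q -> p.1 = q.1 /\ p.2 = q.2.
Proof. by move->. Qed.

Section DingInjectives.
Variables (R : nzRingType) (M : bimodType R).
Hypothesis MM0 : forall t : btensor M M, t = 0.
Local Notation T := (trivext M).
Local Notation Mr := (rmod M : lmodType R^c).
Implicit Types (W E : lmodType T^c) (X Y Z N : lmodType R^c).

Section CoindMap.
Variables (X Y : lmodType R^c) (f : {linear X -> Y}).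

Definition coind_map : {linear coind M X -> coind M Y} := coind_adj (f \o coind_out M X).

Lemma coind_mapE p : coind_map p = (f p.1, rhmap M f p.2).
Proof.
rewrite /coind_map coind_adjE; congr pair; apply: rhomP => m.
by rewrite !rhmapE ractE coind_act.
Qed.
End CoindMap.

Lemma ses_coind_map X Y Z (f : {linear X -> Y}) (g : {linear Y -> Z}) :
  ses f g -> ext1 Mr X -> ses (coind_map f) (coind_map g).
Proof.
move=> fg MX; have fMI := rhmap_inj (M := M) (ses_inj fg).
split.
- apply: ker0_inj => -[x h]; rewrite coind_mapE => /pair_inj[/(inj_ker0 (ses_inj fg)) x0].
  by move=> /(inj_ker0 fMI) h0; congr pair.
- move=> [z t]; have [y yz] := ses_surj fg z.
  have [s st] := rhmap_surj fg MX t.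
  by exists (y, s); rewrite coind_mapE /= yz; congr pair.
- move=> [y s]; rewrite coind_mapE; split=> [/pair_inj[y0 s0]|[[x t]]]; last first.
    rewrite coind_mapE => /pair_inj[/= <- <-]; rewrite (ses_gf fg); congr pair.
    by apply: rhomP => m; rewrite !rhmapE; exact: ses_gf fg _.
  have [x xy] := ses_ker fg y0.
  have [t ts] := rhmap_ker fg s0.
  by exists (x, t); rewrite coind_mapE; congr pair; [exact: xy | exact: ts].
Qed.

Variables (n n' : nat).
Hypothesis Tcoh : left_coherent T^c.
Hypothesis Mfg : finitely_generated Mr.
Hypothesis Mn : dim_lt (@flat R) n (M : lmodType R).
Hypothesis Mn' : dim_lt (@projective R^c) n' Mr.
Hypothesis ME : forall E : lmodType R^c, FP_injective E ->
  forall j, extn j Mr (rhom M E).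

Let Mfp : finitely_presented Mr := fp_bimod Tcoh Mfg.
Let Rker : fp_kernels R^c := fp_kernels_coherent Tcoh.

Lemma inj_FP (S : nzRingType) (J : lmodType S) : injective_mod J -> FP_injective J.
Proof. by move=> Jinj; apply/FP_injectiveP => L _; exact: ext1_inj. Qed.

Lemma ext_at_rhom_FP X (L : lmodType R^c) : FP_injective X -> finitely_presented L ->
  ext_at n L (rhom M X : lmodType R^c).
Proof. by move=> XP Lfp; apply: ext_at_rhom => //; exact: dim_lt_tor_at. Qed.

(** M has finite flat dimension, so Hom(M, X) has finite FP-injective
    dimension. *)
Lemma di_orth_rhom X : FP_injective X -> di_orth (rhom M X : lmodType R^c).
Proof.
by move=> XP; apply: (@di_orth_ext_at _ n) => // L; exact: ext_at_rhom_FP.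
Qed.

(** If Ext^j(M, X) = 0 for all j > 0, coinduction preserves injective
    coresolutions of X. *)
Lemma coind_orth k X : (forall j, extn j Mr X) ->
  (forall L, finitely_presented L -> ext_at k L X) -> di_orth (coind M X : lmodType T^c).
Proof.
elim: k X => [|k IHk] X MX LX.
  by apply: di_orth_FP; apply: FP_injective_coind => //; apply/FP_injectiveP.
have [J [C [f [g [fg Jinj]]]]] := enough_injectives X.
apply: (di_orth_sub (ses_coind_map fg (MX 0%N))).
  by apply: di_orth_FP; apply: inj_FP; exact: coind_inj.
apply: IHk => [j|L Lfp]; first by apply/(extnS j Mr fg Jinj); exact: MX.
by apply: (ext_at_cosyz Rker fg) => //; exact: LX.
Qed.

(** Killed by M, the T-module Hom(M, X) is coinduced from Hom(M, X), since
    Hom(M, Hom(M, X)) = 0, so that it has finite FP-injective dimension; and X is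
    the kernel of the map onto it from the FP-injective module coinduced from X. *)
Lemma di_orth_rtriv X : FP_injective X -> di_orth (rtriv M X).
Proof.
move=> XP; set Q : lmodType R^c := rhom M X.
have QO : di_orth (rtriv M Q).
  move=> Z DZ.
  have i0 x m : raction (coind_in M Q x) m = 0 by rewrite coind_act.
  have r0 (w : rbase (coind M Q)) m : coind_out M Q (raction w m) = 0.
    by rewrite coind_act (rhom2_eq0 MM0 w.2).
  apply: (@ext1_retractl _ (rtriv M Q) (coind M Q) _ (to_linear (linear_of_rtriv i0))
    (to_linear (linear_to_rtriv r0))) => //.
  apply: (@coind_orth n Q) => // [j|L Lfp]; first exact: ME.
  exact: ext_at_rhom_FP.
have i0 x m : raction (coind_in M X x) m = 0 by rewrite coind_act.
have r0 (w : rbase (coind M X)) m : coind_snd M X (raction w m) = 0 by rewrite coind_act.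
apply: (@di_orth_sub _ _ _ _ (to_linear (linear_of_rtriv i0))
    (to_linear (linear_to_rtriv r0))) => //; last first.
  by apply: di_orth_FP; exact: FP_injective_coind.
split=> [x y []|h|[x h]] //=; first by exists (0, h).
by split=> [->|[s [_ <-]]] //; exists x.
Qed.

(** * Psi of Ding injectives consists of Ding injectives *)

(** Membership in [Psi], for any kernel of the action in place of the chosen
    one. *)
Definition PsiDI W := exists Z (k : {linear Z -> rbase W}),
  [/\ ker_act k, surj (ract W) & ding_injective Z].

(** A Ding injective has a resolution by injectives with Ding injective
    syzygies. *)
Lemma ext1_ding Z : ding_injective Z -> ext1 Mr Z.
Proof.
apply: (@ext1_resolved _ _ _ (@ding_injective R^c) Mn') => X DX.
have [X' [[l] DX']] := ts_prev (ding_inj_self R^c).1 DX.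
exists X', (link_mod l), (link_in l), (link_out l); split=> //; first exact: link_ses.
by move=> j; apply: ext1_inj; exact: link_Pr.
Qed.

Section Embedding.
Variables (W : lmodType T^c) (Z : lmodType R^c) (k : {linear Z -> rbase W}).
Hypotheses (kk : ker_act k) (rS : surj (ract W)) (MZ : ext1 Mr Z).
Variables (I Z' : lmodType R^c) (a : {linear Z -> I}) (b : {linear I -> Z'}).
Hypotheses (ab : ses a b) (Iinj : injective_mod I).

(** Extending a along k gives an embedding of W into a coinduced module; its
    cokernel is an extension of Hom(M, Z') by Z'. *)
Lemma Psi_embedding : exists phi : {linear W -> coind M I}, injective phi /\
  exists k' : {linear Z' -> rbase (cokermod phi)},
    [/\ ker_act k', surj (ract (cokermod phi)) &
        forall x, k' (b x) = cproj phi (x, 0)].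
Proof.
have [al alP] := @Iinj _ _ k a (keract_inj kk).
pose phi := coind_adj al; exists phi.
have phiE w : phi w = (al w, rhmap M al (ract W w)) by [].
have phi_k z : phi (k z) = (a z, 0).
  rewrite phiE -alP; congr pair; apply: rhomP => m.
  by rewrite rhmapE ractE (keract_raction _ _ kk) linear0.
have al0 (w : rbase W) (m : rmod M) : al (raction w m) = 0 -> raction w m = 0.
  have [z <-] := keract_lift kk (raction_raction w m).
  by rewrite -alP => /(inj_ker0 (ses_inj ab)) ->; rewrite linear0.
have kphi (w : rbase W) x : phi w = (x, 0) -> exists z, k z = w /\ a z = x.
  rewrite phiE => /pair_inj[alw w0]; have [|z zw] := keract_lift (y := w) kk.
    move=> m; apply: al0.
    by rewrite -[LHS](rhmapE al (ract W w) m) (w0 : rhmap M al (ract W w) = 0).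
  by exists z; rewrite alP zw; split; last exact: alw.
have phiI : injective phi.
  apply: ker0_inj => w /(kphi w)[z [<- /(inj_ker0 (ses_inj ab)) ->]].
  exact: linear0.
split=> //; pose c := cproj phi.
have cS : surj c := @cproj_surj _ _ _ phi.
have sc := ses_cproj phiI.
have [k' k'P] : exists k' : {linear Z' -> rbase (cokermod phi)},
    forall x, (rb c \o coind_in M I) x = k' (b x).
  apply: (factor_coker ab) => z.
  by rewrite -[LHS]/(c (a z, 0)) -phi_k; exact: ses_gf sc _.
have k'E x : k' (b x) = c (x, 0) by rewrite -k'P.
have c_act q m : raction (c q : rbase (cokermod phi)) m = k' (b (rhom_fun q.2 m)).
  by rewrite k'E -[LHS](rb_act c (q : rbase (coind M I)) m) coind_act.
have k'I : injective k'.
  apply: ker0_inj => z'; have [x <-] := ses_surj ab z'.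
  rewrite k'E => /(ses_ker sc)[w /kphi[z [_ <-]]]; exact: ses_gf ab z.
have kk' : ker_act k'.
  split=> // w'; have [q <-] := cS w'; rewrite ract0P; split=> [q0|[z' <-] m]; last first.
    by have [x <-] := ses_surj ab z'; rewrite k'E c_act rhom0 !linear0.
  have [|g gP] := rhmap_ker (h := q.2) ab.
    apply: rhomP => m; rewrite rhmapE; apply: k'I.
    by rewrite -c_act q0 linear0.
  have [w wP] := rS (rhmap M k g).
  have e : (q - phi w).2 = 0.
    rewrite -[LHS]/(q.2 - (phi w).2) phiE /= wP -gP; apply/eqP; rewrite subr_eq0.
    by apply/eqP/rhomP => m; rewrite !rhmapE alP.
  exists (b (q - phi w).1); rewrite k'E.
  have -> : ((q - phi w).1, 0) = q - phi w :> coind M I by rewrite -e -surjective_pairing.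
  by rewrite linearB (ses_gf sc) subr0.
exists k'; split=> // h.
have [g' g'P] := keract_rhom MM0 h kk'.
have [g gP] := rhmap_surj ab MZ g'.
exists (c (0, g)); apply: rhomP => m; rewrite ractE c_act -g'P rhmapE -gP.
by rewrite rhmapE.
Qed.
End Embedding.

Lemma Psi_next W : PsiDI W ->
  exists W', inhabited (link (@injective_mod T^c) W W') /\ PsiDI W'.
Proof.
move=> [Z [k [kk rS DZ]]].
have [Z' [[l] DZ']] := ts_next (ding_inj_self R^c).1 DZ.
have [phi [phiI [k' [kk' rS' _]]]] :=
  Psi_embedding kk rS (ext1_ding DZ) (link_ses l) (link_Pr l).
exists (cokermod phi); split; last by exists Z', k'.
by constructor; apply: Link (ses_cproj phiI) _; apply: coind_inj; exact: link_Pr.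
Qed.

(** A map from an FP-injective E into the cokernel of W -> coind I is lifted in two
    steps, along 0 -> KE -> E -> Hom(M, KE) -> 0 where KE is FP-injective. *)
Lemma Psi_ext W E : PsiDI W -> FP_injective E -> ext1 E W.
Proof.
move=> [Z [k [kk rS DZ]]] EP.
have [Z' [[l] DZ']] := ts_next (ding_inj_self R^c).1 DZ.
have [phi [phiI [k' [kk' rS' k'E]]]] :=
  Psi_embedding kk rS (ext1_ding DZ) (link_ses l) (link_Pr l).
have Iinj : injective_mod (link_mod l) := link_Pr l.
apply: (ext1_of_inj (ses_cproj phiI)) => [|g]; first exact: coind_inj.
set c := cproj phi in k'E *.
have kE := ker_act_kincl E; set i := kincl (ract E) in kE.
have KP := FP_injective_ker Mfg kE EP.
have [p [pP ip]] := keract_ses MM0 kE (FP_injective_ract MM0 Mfg EP).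
have [g1 g1P] : exists g1 : {linear kermod (ract E) -> Z'}, forall z, k' (g1 z) = (rb g \o i) z.
  apply: (lin_lift (keract_inj kk')) => z; apply: (keract_lift kk') => m.
  rewrite -[LHS](rb_act g (i z) m) (keract_raction _ _ kE); exact: linear0.
have [g2 g2P] := ext1_lift (di_orth_FP KP DZ) (link_ses l) g1.
have [g3 g3P] := Iinj _ _ i g2 (keract_inj kE).
pose d0 : {linear rbase E -> rbase (cokermod phi)} := rb (g \- (c \o coind_adj g3)).
have d0E y : d0 y = g y - c (coind_adj g3 y) by [].
have d0i z : d0 (i z) = 0.
  rewrite d0E coind_adjE -g3P.
  have -> : rhmap M g3 (ract E (i z)) = 0.
    by apply: rhomP => m; rewrite rhmapE ractE (keract_raction _ _ kE) linear0.
  by rewrite -k'E g2P g1P -[(rb g \o i) z]/(g (i z)) subrr.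
have [d dP] : exists d : {linear rbase E -> Z'}, forall y, k' (d y) = d0 y.
  apply: (lin_lift (keract_inj kk')) => y; apply: (keract_lift kk') => m.
  rewrite -[LHS](rb_act (g \- (c \o coind_adj g3)) (y : rbase E) m).
  by have [z <-] := keract_lift kE (raction_raction (y : rbase E) m); exact: d0i.
have [d1 d1P] : exists d1 : {linear rhom M (kermod (ract E)) -> Z'}, forall y, d y = d1 (p y).
  apply: (factor_coker ip) => z; apply: (keract_inj kk').
  by rewrite dP d0i linear0.
have [d2 d2P] := ext1_lift (di_orth_rhom KP DZ) (link_ses l) d1.
exists (coind_adj g3 \+ coind_adj (d2 \o p)) => y.
rewrite -[LHS]/(c (coind_adj g3 y + coind_adj (d2 \o p) y)) linearD.
have -> : coind_adj (d2 \o p) y = (d2 (p y), 0).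
  rewrite coind_adjE; congr pair; apply: rhomP => m; rewrite rhmapE ractE.
  have [z <-] := keract_lift kE (raction_raction (y : rbase E) m).
  by rewrite -[LHS]/(d2 (p (i z))) (ses_gf ip) linear0.
by rewrite -k'E d2P -d1P dP d0E addrC subrK.
Qed.

(** Since Ext^1(Hom(M, I), Z) = 0, the map Hom(M, I) -> Hom(M, Z) lifts along W
    -> Hom(M, Z); together with I -> Z -> W it maps the module coinduced from I
    onto W. *)
Lemma Psi_prev W : PsiDI W ->
  exists W', inhabited (link (@injective_mod T^c) W' W) /\ PsiDI W'.
Proof.
move=> [Z [k [kk rS DZ]]].
have [Z' [[l] DZ']] := ts_prev (ding_inj_self R^c).1 DZ.
have Iinj : injective_mod (link_mod l) := link_Pr l.
have ab := link_ses l; set I := link_mod l in ab Iinj *.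
set a := link_in l in ab *; set b := link_out l in ab *.
have [p [pP kp]] := keract_ses MM0 kk rS.
have [be beP] := ext1_lift (di_orth_rhom (inj_FP Iinj) DZ) kp (rhmap M b).
have bMS : surj (rhmap M b) := rhmap_surj ab (ext1_ding DZ').
pose phi0 : {linear rbase (coind M I) -> rbase W} :=
  (k \o (b \o coind_out M I)) \+ (be \o coind_snd M I).
have phi0E q : phi0 q = k (b q.1) + be q.2 by [].
have ract_be h m : raction (be h) m = k (b (rhom_fun h m)).
  by rewrite -ractE -pP rhmapE beP rhmapE.
have phi_act q m : phi0 (raction q m) = raction (phi0 q) m.
  rewrite coind_act !phi0E ractionD (keract_raction _ _ kk) add0r ract_be.
  by rewrite linear0 addr0.
pose phi : {linear coind M I -> W} := to_linear (linear_of_rb phi_act).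
have phiE q : phi q = k (b q.1) + be q.2 by [].
have phiS : surj phi.
  move=> w; have [h hw] := bMS (p w).
  have [z zw] : exists z, k z = w - be h.
    by apply: (ses_ker kp); rewrite linearB beP hw subrr.
  have [x xz] := ses_surj ab z.
  by exists (x, h); rewrite phiE /= xz zw subrK.
pose i := rb (kincl phi).
have iI : injective i by exact: kincl_inj.
have [k' k'P] : exists k' : {linear Z' -> rbase (kermod phi)},
    forall z, i (k' z) = (coind_in M I \o a) z.
  apply: (lin_lift iI) => z; apply/kinclP.
  by rewrite -[LHS]/(k (b (a z)) + be 0) (ses_gf ab) !linear0 addr0.
have k'E z : kincl phi (k' z) = (a z, 0) by exact: k'P.
have i_act (y : rbase (kermod phi)) m : i (raction y m) = (rhom_fun (kincl phi y).2 m, 0).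
  by rewrite rb_act coind_act.
have kk' : ker_act k'.
  split=> [x y /(congr1 i)|y].
    by rewrite !k'P => /pair_inj[/(ses_inj ab)].
  rewrite ract0P; split=> [y0|[z <-] m]; last first.
    by apply: iI; rewrite i_act k'E rhom0 linear0.
  have h0 : (kincl phi y).2 = 0.
    apply: rhomP => m; have := i_act y m; rewrite y0 linear0.
    by move=> /pair_inj[/= <-].
  have [z zx] : exists z, a z = (kincl phi y).1.
    apply: (ses_ker ab); apply: (keract_inj kk); rewrite linear0.
    have := kincl0 phi y; rewrite phiE h0 => e.
    by rewrite -[RHS]e linear0 addr0.
  exists z; apply: iI; rewrite k'P -[LHS]/(a z, 0) zx -h0.
  by rewrite -surjective_pairing.
exists (kermod phi); split.
  by constructor; apply: Link (ses_kincl phiS) _; exact: coind_inj.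
exists Z', k'; split=> // g.
have [g' g'P] := keract_rhom MM0 g kk'.
have [z zE] : exists z, k z = be (rhmap M a g').
  apply: (ses_ker kp); rewrite beP; apply: rhomP => m; rewrite !rhmapE.
  exact: ses_gf ab _.
have [x xz] := ses_surj ab z.
have /kinclP[y yE] : phi (- x, rhmap M a g') = 0.
  by rewrite phiE /= linearN linearN xz zE addNr.
exists y; apply: rhomP => m; rewrite ractE; apply: iI.
by rewrite i_act yE -g'P rhmapE; exact: esym (k'P _).
Qed.

Lemma Psi_ding W : PsiDI W -> ding_injective W.
Proof.
apply: (@ding_injective_coind _ PsiDI); split=> [|E V DV /FP_injectiveP EP].
  by split; [exact: Psi_next | exact: Psi_prev].
exact: Psi_ext.
Qed.

(** * Ding injectives lie in Psi of Ding injectives *)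

Lemma inj_ker E Z (k : {linear Z -> rbase E}) :
  injective_mod E -> ker_act k -> injective_mod Z.
Proof.
move=> Einj kk A B f h fI.
have h0 x m : raction ((k \o h) x) m = 0 by exact: (keract_raction _ _ kk).
have [l lP] := Einj _ _ (rtriv_map M f) (to_linear (linear_of_rtriv h0)) fI.
have [k' k'P] := rtriv_lift l kk.
by exists k' => a; apply: (keract_inj kk); rewrite k'P; exact: lP.
Qed.

(** E is an extension of Hom(M, K) by the injective module K of elements killed
    by M. *)
Lemma extn_base_inj E : injective_mod E -> forall j, extn j Mr (rbase E).
Proof.
move=> Einj j; have kE := ker_act_kincl E; have Kinj := inj_ker Einj kE.
have [p [_ ip]] := keract_ses MM0 kE (FP_injective_ract MM0 Mfg (inj_FP Einj)).
by apply: (extn_ext ip); [exact: ext1_inj | apply: ME; exact: inj_FP].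
Qed.

Lemma ext1_base_ding W : ding_injective W -> ext1 Mr (rbase W).
Proof.
move=> DW; apply: (@ext1_resolved _ _ _
  (fun Z => exists W, ding_injective W /\ Z = rbase W) Mn' _ (rbase W)); last by exists W.
move=> _ [V [DV ->]]; have [V' [[l] DV']] := ts_prev (ding_inj_self T^c).1 DV.
exists (rbase V'), (rbase (link_mod l)), (rb (link_in l)), (rb (link_out l)).
split; last by exists V'.
  exact: (ses_rb (link_ses l)).
by apply: extn_base_inj; exact: link_Pr.
Qed.

(** W is a quotient of an injective module along which maps M -> W lift, and
    over an injective module they come from elements. *)
Lemma ding_ract_surj W : ding_injective W -> surj (ract W).
Proof.
move=> DW h; have [W' [[l] DW']] := ts_prev (ding_inj_self T^c).1 DW.
have sl := ses_rb (link_ses l).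
have [g gh] := rhmap_surj sl (ext1_base_ding DW') h.
have [e eg] := FP_injective_ract MM0 Mfg (inj_FP (link_Pr l)) g.
exists (rb (link_out l) e); apply: rhomP => m.
by rewrite ractE -rb_act -ractE eg -gh rhmapE.
Qed.

(** The snake lemma for W -> Hom(M, W) on W1, Q and W2; surjectivity on W1 makes
    the sequence of kernels exact on the right. *)
Lemma keract_ses3 W1 (Q : lmodType T^c) W2 (i : {linear W1 -> Q}) (o : {linear Q -> W2})
    Z1 (Y : lmodType R^c) Z2 (k1 : {linear Z1 -> rbase W1}) (q : {linear Y -> rbase Q})
    (k2 : {linear Z2 -> rbase W2}) :
  ses i o -> ker_act k1 -> ker_act q -> ker_act k2 -> surj (ract W1) ->
  exists (a : {linear Z1 -> Y}) (b : {linear Y -> Z2}),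
    [/\ forall z, q (a z) = i (k1 z), forall y, k2 (b y) = o (q y) & ses a b].
Proof.
move=> io c1 cq c2 r1.
have iI : injective (rb i) := ses_inj io.
have [a aP] : exists a : {linear Z1 -> Y}, forall z, q (a z) = (rb i \o k1) z.
  apply: (lin_lift (keract_inj cq)) => z; apply: (keract_lift cq) => m.
  by rewrite -[LHS](rb_act i (k1 z) m) (keract_raction _ _ c1) linear0.
have [b bP] : exists b : {linear Y -> Z2}, forall y, k2 (b y) = (rb o \o q) y.
  apply: (lin_lift (keract_inj c2)) => y; apply: (keract_lift c2) => m.
  by rewrite -[LHS](rb_act o (q y) m) (keract_raction _ _ cq) linear0.
have aE z : q (a z) = i (k1 z) by exact: aP.
have bE y : k2 (b y) = o (q y) by exact: bP.
exists a, b; split=> //; split.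
- apply: ker0_inj => z z0; apply: (inj_ker0 (keract_inj c1)).
  by apply: (inj_ker0 (ses_inj io)); rewrite -aE z0 linear0.
- move=> z; have [v vz] := ses_surj io (k2 z).
  have [h hP] : exists h, rhmap M (rb i) h = ract Q v.
    apply: (rhmap_lift iI) => m; apply: (ses_ker io).
    by rewrite ractE -[LHS]/(rb o _) rb_act -[rb o v]/(o v) vz (keract_raction _ _ c2).
  have [w wh] := r1 h.
  have [y yv] : exists y, q y = (v : rbase Q) - rb i w.
    apply: (keract_lift cq) => m; rewrite ractionB -rb_act -!ractE wh.
    by rewrite -rhmapE hP subrr.
  exists y; apply: (keract_inj c2); rewrite bE yv -[LHS]/(o (v - i w)) linearB vz.
  by rewrite (ses_gf io) subr0.
- move=> y; split=> [y0|[z <-]]; last first.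
    by apply: (keract_inj c2); rewrite bE aE (ses_gf io) linear0.
  have [w wy] : exists w, i w = q y by apply: (ses_ker io); rewrite -bE y0 linear0.
  have [z zw] : exists z, k1 z = (w : rbase W1).
    apply: (keract_lift c1) => m; apply: (inj_ker0 iI).
    by rewrite rb_act -[rb i w]/(i w) wy (keract_raction _ _ cq).
  by exists z; apply: (keract_inj cq); rewrite aE zw.
Qed.

Definition ker_ding Z := exists W (k : {linear Z -> rbase W}),
  ker_act k /\ ding_injective W.

Lemma ker_ding_class : ding_inj_class ker_ding.
Proof.
split=> [|E Z [W [k [kk DW]]] /FP_injectiveP EP].
  split=> Z [W [k [kk DW]]].
    have [W' [[l] DW']] := ts_next (ding_inj_self T^c).1 DW.
    have kq := ker_act_kincl (link_mod l).
    have [a [b [_ _ ab]]] := keract_ses3 (link_ses l) kk kq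
      (ker_act_kincl W') (ding_ract_surj DW).
    exists (kermod (ract W')); split.
      by constructor; apply: Link ab (inj_ker (link_Pr l) kq).
    by exists W', (kincl _); split=> //; exact: ker_act_kincl.
  have [W' [[l] DW']] := ts_prev (ding_inj_self T^c).1 DW.
  have kq := ker_act_kincl (link_mod l).
  have [a [b [_ _ ab]]] := keract_ses3 (link_ses l) (ker_act_kincl W') kq kk
    (ding_ract_surj DW').
  exists (kermod (ract W')); split.
    by constructor; apply: Link ab (inj_ker (link_Pr l) kq).
  by exists W', (kincl _); split=> //; exact: ker_act_kincl.
have [W' [[l] DW']] := ts_next (ding_inj_self T^c).1 DW.
have kq := ker_act_kincl (link_mod l); have kk' := ker_act_kincl W'.
have [a [b [_ bE ab]]] := keract_ses3 (link_ses l) kk kq kk' (ding_ract_surj DW).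
apply: (ext1_of_inj ab (inj_ker (link_Pr l) kq)) => h.
have h0 x m : raction ((kincl (ract W') \o h) x) m = 0 by exact: (keract_raction _ _ kk').
have [g gP] := ext1_lift (di_orth_rtriv EP DW) (link_ses l) (to_linear (linear_of_rtriv h0)).
have [k' k'P] := rtriv_lift g kq.
exists k' => x; apply: (keract_inj kk'); rewrite bE k'P; exact: gP.
Qed.

Theorem ding_injective_Psi W : ding_injective W <-> Psi (@ding_injective R^c) W.
Proof.
split=> [DW|[rS DK]].
  split; first exact: ding_ract_surj.
  apply: (ding_injective_coind ker_ding_class).
  by exists W, (kincl (ract W)); split=> //; exact: ker_act_kincl.
apply: Psi_ding; exists (kermod (ract W)), (kincl (ract W)); split=> //.
exact: ker_act_kincl.
Qed.
End DingInjectives.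

(** * Both descriptions *)

Theorem corollary4p2 (R : nzRingType) (M : bimodType R)
    (MM0 : forall t : btensor M M, t = 0) :
  ((forall F : lmodType R, flat F ->
      forall j : nat, (1 <= j)%N -> Tor_zero j (rmod M) (btensor M F)) ->
   finite_fd (M : lmodType R) ->
   finite_fd (rmod M : lmodType R^c) ->
   forall W : lmodType (trivext M),
     ding_projective W <-> Phi (@ding_projective R) W)
  /\
  (right_coherent (trivext M) ->
   finitely_generated (rmod M : lmodType R^c) ->
   (forall E : lmodType R^c, FP_injective E ->
      forall j : nat, (1 <= j)%N -> Ext_zero j (rmod M : lmodType R^c) (rhom M E)) ->
   finite_fd (M : lmodType R) ->
   finite_pd (rmod M : lmodType R^c) ->
   forall W : lmodType (trivext M)^c,
     ding_injective W <-> Psi (@ding_injective R^c) W).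
Proof.
split=> [MF /dim_lt_finite[n Mn] /dim_lt_finite[n' Mn'] W|].
  apply: (ding_projective_Phi MM0 Mn Mn') => F flF j.
  exact: torn_Tor_zero (MF F flF j.+1 isT).
move=> Tcoh Mfg ME /dim_lt_finite[n Mn] /dim_lt_finite[n' Mn'] W.
apply: (ding_injective_Psi MM0 Tcoh Mfg Mn Mn') => E EP j.
exact: extn_Ext_zero (ME E EP j.+1 isT).
Qed.
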